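(* Let $\mathbb{F}$ be a field of characteristic $0$ and let $i<n$ be positive integers with $n\equiv \pm 1 \pmod i$. Let $r=r_{CG}(i,n)\in\mathfrak{sl}_n\wedge\mathfrak{sl}_n$ be the Cremmer–Gervais $r$-matrix of type $(i,n)$ and let $\Phi:\mathbb{F}^\times\to SL_n$ be the map $\Phi(t)=t^{2nH}g$ defined in the context. Then: (1) there exist $r^\prime\in\mathcal{M}$ and $b\in\mathcal{C}$, not depending on $t$, such that $\Phi(t).r=r^\prime+t^{2n}b$ for all $t\in\mathbb{F}^\times$; (2) the $r$-matrices $r^\prime$ and $b$ in (1) lie in the Zariski closure of the component of $\mathcal{M}$ containing $r$; (3) $b$ is a boundary solution to the classical Yang–Baxter equation; (4) the carrier of $b$ is the maximal parabolic subalgebra $\mathfrak{p}(i,n)\subseteq\mathfrak{sl}_n$.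
   Context: Notation: $e_{jk}$ is the $n\times n$ matrix unit, with the convention $e_{jk}:=0$ if $j$ or $k$ lies outside $[1,n]$; $[a,b]=\{a,a+1,\dots,b\}$; for integers $p$ and $q>0$, $p \bmod q$ denotes the residue in $[0,q-1]$. For vectors $u,v$, $u\wedge v:=\tfrac12(u\otimes v-v\otimes u)$. $g\in SL_n$ acts on $\mathfrak{gl}_n\otimes\mathfrak{gl}_n$ by $g.(u\otimes v)=gug^{-1}\otimes gvg^{-1}$; $x\in\mathfrak{gl}_n$ acts by $x.(u\otimes v)=[x,u]\otimes v+u\otimes[x,v]$. CYBE/MCYBE: for $r\in\mathfrak{sl}_n\wedge\mathfrak{sl}_n$, $\langle r,r\rangle:=[r_{12},r_{13}]+[r_{12},r_{23}]+[r_{13},r_{23}]$ where $r_{12}=r\otimes1$, $r_{23}=1\otimes r$, $r_{13}=\sigma(r_{23})$ with $\sigma(x\otimes y\otimes z)=y\otimes x\otimes z$. $\mathcal{C}$ is the set of $r$ with $\langle r,r\rangle=0$; $\mathcal{M}$ is the set of $r$ with $\langle r,r\rangle$ nonzero and $\mathfrak{sl}_n$-invariant. A boundary solution to the CYBE is an element of $\mathcal{C}$ lying in the Zariski closure of $\mathcal{M}$ (as points of $\mathbb{P}(\mathfrak{sl}_n\wedge\mathfrak{sl}_n)$). The component of $\mathcal{M}$ containing $r_{CG}(i,n)$ is $\{\lambda\, g.r_{CG}(i,n):\lambda\in\mathbb{F}^\times, g\in SL_n\}$. The carrier of $r$ is the span of $\{(\varphi\otimes1)r:\varphi\in\mathfrak{sl}_n^*\}$.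 $\mathfrak{p}(i,n)$ is the set of traceless $n\times n$ matrices whose $(j,k)$ entry is $0$ whenever $j>i$ and $k\le i$. Cremmer–Gervais $r$-matrix ($\gcd(i,n)=1$): let $\mathcal{S}_1=[1,n-1]\setminus\{n-i\}$ and $\mathcal{T}:\mathcal{S}_1\to[1,n-1]\setminus\{i\}$, $\mathcal{T}(j)=(j+i)\bmod n$. Put $j\prec k$ on $[1,n-1]$ iff $\mathcal{T}^N(j)=k$ for some $N\ge1$. For positive root vectors ($j<k$, $\ell<m$) put $e_{jk}\prec e_{\ell m}$ iff $m-\ell=k-j$ and $j+s\prec\ell+s$ for all $s\in[0,k-j-1]$. Set $\alpha:=2\sum e_{jk}\wedge e_{m\ell}$ over all $(j,k,\ell,m)$ with $e_{jk}\prec e_{\ell m}$; $\beta:=\sum_{1\le j<\ell\le n}\big(-1+\tfrac2n((j-\ell)i^{-1}\bmod n)\big)e_{jj}\wedge e_{\ell\ell}$, where $i^{-1}$ is the inverse of $i$ modulo $n$; $\gamma:=\sum_{1\le k<\ell\le n}e_{k\ell}\wedge e_{\ell k}$. Then $r_{CG}(i,n):=\alpha+\beta+\gamma$. The map $\Phi$: let $\epsilon:=1$ if $n\bmod i=1$ and $\epsilon:=-1$ otherwise; $c_k:=\lfloor (n-k)/i\rfloor$, $a_k:=\epsilon((-nk)\bmod i)$. For $k,\ell\in\mathbb{Z}$, $\xi_{k\ell}:=\sum_{p\in\mathbb{Z}}e_{k+ip,\ell+ip}$, and $E_{k\ell}:=\xi_{k+1,\ell+1}$ if $n\bmod i=1$,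 $E_{k\ell}:=-\xi_{i-\ell,i-k}$ otherwise. $X:=\sum_{1\le j\le n-i}c_je_{j,j+i}$, $Z:=\sum_{1\le j<i}a_j\xi_{j+1,j}$. $H:=\operatorname{diag}(H_1,\dots,H_n)$ where $H_j=s-q+\Theta$ when $j-1=qi+s$ with $0\le s<i$ (so the diagonal is $(0,1,\dots,i-1,-1,0,\dots,i-2,-2,\dots)+\Theta$), and $\Theta$ is the scalar making $H$ traceless; then each $2nH_j$ is an integer and $t^{2nH}:=\operatorname{diag}(t^{2nH_1},\dots,t^{2nH_n})$. Let $g:=e^{-Z}e^{-X}\exp\big(-\sum_{1\le k<i}\binom{i}{k}E_{ki}\big)\in SL_n$ and $\Phi(t):=t^{2nH}g$. *)

(* Defs.v *)
From HB Require Import structures.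
From mathcomp Require Import all_boot all_order all_algebra.
From mathcomp.classical Require Import boolp.
From mathcomp Require Import mpoly.
Set Implicit Arguments. Unset Strict Implicit. Unset Printing Implicit Defensive.
Import Order.TTheory GRing.Theory Num.Theory.
Local Open Scope ring_scope.

(* Tensors.  An element of gl_n (x) gl_n is stored through its coordinates   *)
(* in the basis e_ab (x) e_cd (0-based ordinals a b c d : 'I_n), i.e. as a   *)
(* function (a,b,c,d) |-> coefficient.  Likewise gl_n^{(x)3} with six indices.*)
Section Tensors.
Variables (F : fieldType) (n : nat).

Definition I2 := ('I_n * 'I_n * 'I_n * 'I_n)%type.
Definition I3 := ('I_n * 'I_n * 'I_n * 'I_n * 'I_n * 'I_n)%type.
Definition T2 := {ffun I2 -> F^o}.
Definition T3 := {ffun I3 -> F^o}.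

Definition E (a b : 'I_n) : 'M[F]_n := delta_mx a b.

Definition tens (u v : 'M[F]_n) : T2 :=
  [ffun x : I2 => let: (a, b, c, d) := x in u a b * v c d].
Definition tens3 (u v w : 'M[F]_n) : T3 :=
  [ffun x : I3 => let: (a, b, c, d, e, f) := x in u a b * v c d * w e f].

Definition wedge (u v : 'M[F]_n) : T2 := 2^-1 *: (tens u v - tens v u).

Definition traceless (u : 'M[F]_n) : bool := \tr u == 0.

Definition in_slwedge (r : T2) : Prop :=
  exists s : seq ('M[F]_n * 'M[F]_n),
    all (fun p => traceless p.1 && traceless p.2) s /\
    r = \sum_(p <- s) wedge p.1 p.2.

Definition conjmx (g u : 'M[F]_n) : 'M[F]_n := g *m u *m invmx g.
Definition act (g : 'M[F]_n) (r : T2) : T2 :=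
  \sum_(x : I2) r x *: (let: (a, b, c, d) := x in
                        tens (conjmx g (E a b)) (conjmx g (E c d))).

Definition lbr (u v : 'M[F]_n) : 'M[F]_n := u *m v - v *m u.

Definition lie_act3 (x : 'M[F]_n) (T : T3) : T3 :=
  \sum_(y : I3) T y *: (let: (a, b, c, d, e, f) := y in
      tens3 (lbr x (E a b)) (E c d) (E e f)
    + tens3 (E a b) (lbr x (E c d)) (E e f)
    + tens3 (E a b) (E c d) (lbr x (E e f))).

Definition r12 (r : T2) : T3 :=
  \sum_(y : I2) r y *: (let: (a, b, c, d) := y in tens3 (E a b) (E c d) 1%:M).
Definition r23 (r : T2) : T3 :=
  \sum_(y : I2) r y *: (let: (a, b, c, d) := y in tens3 1%:M (E a b) (E c d)).
Definition sigma3 (T : T3) : T3 :=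
  [ffun y : I3 => let: (a, b, c, d, e, f) := y in T (c, d, a, b, e, f)].
Definition r13 (r : T2) : T3 := sigma3 (r23 r).

Definition mul3 (X Y : T3) : T3 :=
  \sum_(y : I3) \sum_(z : I3) (X y * Y z) *:
    (let: (a, b, c, d, e, f) := y in let: (a', b', c', d', e', f') := z in
     tens3 (E a b *m E a' b') (E c d *m E c' d') (E e f *m E e' f')).
Definition br3 (X Y : T3) : T3 := mul3 X Y - mul3 Y X.

Definition cybe (r : T2) : T3 :=
  br3 (r12 r) (r13 r) + br3 (r12 r) (r23 r) + br3 (r13 r) (r23 r).

Definition inC (r : T2) : Prop := in_slwedge r /\ cybe r = 0.
Definition inM (r : T2) : Prop :=
  [/\ in_slwedge r, cybe r != 0 &
      forall x : 'M[F]_n, traceless x -> lie_act3 x (cybe r) = 0].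

Definition Mcomp (r0 : T2) (y : T2) : Prop :=
  exists (lam : F) (g : 'M[F]_n), [/\ lam != 0, \det g = 1 & y = lam *: act g r0].

(* Zariski closure in the projective space: coordinates of a tensor,
   and homogeneous polynomials in those coordinates *)
Definition coords (x : T2) : 'I_#|{: I2}| -> F := fun k => x (enum_val k).
Definition zclosure (S : T2 -> Prop) (x : T2) : Prop :=
  x != 0 /\
  forall (d : nat) (p : {mpoly F[#|{: I2}|]}), p \is d.-homog ->
    (forall y, S y -> p.@[coords y] = 0) -> p.@[coords x] = 0.

Definition boundary (b : T2) : Prop := inC b /\ zclosure inM b.

Definition contract (phi : {linear 'M[F]_n -> F^o}) (r : T2) : 'M[F]_n :=
  \sum_(y : I2) r y *: (let: (a, b, c, d) := y in phi (E a b) *: E c d).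

Definition carrier (r : T2) (M : 'M[F]_n) : Prop :=
  exists s : seq (F * {linear 'M[F]_n -> F^o}),
    M = \sum_(p <- s) p.1 *: contract p.2 r.

Definition in_parabolic (i : nat) (M : 'M[F]_n) : Prop :=
  traceless M /\ forall j k : 'I_n, (i < j.+1)%N -> (k.+1 <= i)%N -> M j k = 0.

End Tensors.

Section CG.
Variables (F : fieldType) (i n : nat).

(* e_{jk} for integer (1-based) indices, 0 outside [1,n] *)
Definition emx (j k : int) : 'M[F]_n :=
  \matrix_(a, b) ((Posz a.+1 == j) && (Posz b.+1 == k))%:R.

Definition Tmap (j : nat) : nat := (j + i) %% n.
Definition S1 (j : nat) : bool := [&& (1 <= j)%N, (j <= n - 1)%N & j != (n - i)%N].

Definition prec (j k : nat) : Prop :=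
  exists N : nat, [/\ (0 < N)%N, forall m, (m < N)%N -> S1 (iter m Tmap j)
                                & iter N Tmap j = k].
Definition precb (j k : nat) : bool := asbool (prec j k).

(* e_{jk} < e_{lm} (1-based, j<k, l<m) *)
Definition rootprec (j k l m : nat) : bool :=
  [&& (j < k)%N, (l < m)%N, (m - l == k - j)%N &
      all (fun s => precb (j + s) (l + s)) (iota 0 (k - j))].

Definition alpha : T2 F n :=
  2%:R *: \sum_(j < n) \sum_(k < n) \sum_(l < n) \sum_(m < n | rootprec j.+1 k.+1 l.+1 m.+1)
     wedge (E F j k) (E F m l).

Definition iinv : nat := val ((i%:R : 'Z_n)^-1).

Definition betacoef (j l : nat) : F :=
  -1 + (2%:R / n%:R) * ((((Posz j - Posz l) * Posz iinv) %% Posz n)%Z)%:~R.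

Definition beta : T2 F n :=
  \sum_(j < n) \sum_(l < n | (j < l)%N) betacoef j.+1 l.+1 *: wedge (E F j j) (E F l l).

Definition gamma : T2 F n :=
  \sum_(k < n) \sum_(l < n | (k < l)%N) wedge (E F k l) (E F l k).

Definition rCG : T2 F n := alpha + beta + gamma.

(* xi_{kl} = sum_{p in Z} e_{k+ip, l+ip}: its (a+1,b+1) entry is 1 iff
   a+1 = k+ip and b+1 = l+ip for some (necessarily unique) integer p *)
Definition xi (k l : int) : 'M[F]_n :=
  \matrix_(a, b) ((Posz a.+1 - k == Posz b.+1 - l) && (Posz i %| Posz a.+1 - k)%Z)%:R.

Definition eps_bool : bool := (n %% i == 1)%N.

Definition Emk (k l : int) : 'M[F]_n :=
  if eps_bool then xi (k + 1) (l + 1) else - xi (Posz i - l) (Posz i - k).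

Definition cc (k : nat) : nat := ((n - k) %/ i)%N.
Definition ac (k : nat) : int :=
  (if eps_bool then 1 else -1) * ((- Posz (n * k)) %% Posz i)%Z.

Definition Xm : 'M[F]_n :=
  \sum_(j < n | (j.+1 <= n - i)%N) (cc j.+1)%:R *: emx (Posz j.+1) (Posz (j.+1 + i)).
Definition Zm : 'M[F]_n :=
  \sum_(j < i | (1 <= j)%N) (ac j)%:~R *: xi (Posz j + 1) (Posz j).
Definition Ym : 'M[F]_n :=
  \sum_(k < i | (1 <= k)%N) ('C(i, k))%:R *: Emk (Posz k) (Posz i).

(* exponential of a nilpotent n x n matrix: A^n = 0, so the series stops *)
Definition expmx (A : 'M[F]_n) : 'M[F]_n :=
  \sum_(m < n) (m`!%:R)^-1 *: A ^+ m.

Definition gmat : 'M[F]_n := expmx (- Zm) *m expmx (- Xm) *m expmx (- Ym).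

(* for 0-based a (= j-1 = q i + s): s - q ;  2n H_j = 2n(s-q) - 2 sum_b (s_b - q_b) *)
Definition hq (a : nat) : int := Posz (a %% i) - Posz (a %/ i).
Definition hexp (a : nat) : int := 2%:Z * Posz n * hq a - 2%:Z * \sum_(b < n) hq b.

Definition tH (t : F) : 'M[F]_n := diag_mx (\row_(a < n) t ^ hexp a).

Definition Phi (t : F) : 'M[F]_n := tH t *m gmat.

End CG.

(* Main.v *)
From HB Require Import structures.
From mathcomp Require Import all_boot all_order all_algebra.
From mathcomp.classical Require Import boolp.
From mathcomp Require Import mpoly zify ring.
Require Import Defs.
Set Implicit Arguments. Unset Strict Implicit. Unset Printing Implicit Defensive.
Import Order.TTheory GRing.Theory Num.Theory.
Local Open Scope ring_scope.

(** Identify a skew tensor [r] with the operator [R = Rop r] on gl_n through the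
trace form.  The solution [rCG] of the modified Yang-Baxter equation is encoded
by the Lagrangian subalgebra [{(x, y)}] of pairs [(R u + u/2, R u - u/2)], and
this subalgebra is [{(x, S^-1 (x + nu) S) : x in p, nu in n}], where [p] is the
parabolic subalgebra p(i,n), [n] its nilradical and [S] the cyclic permutation
matrix [e_b |-> e_(b+i mod n)].

The point of the matrix [g] is that it normalises [p] and that, up to a left
factor acting on [p/n] as the identity, [g S g^-1 = 1 + J + (degree <= -2)] for
the grading of gl_n by [H], where [J] has degree -1 and the functional
[tr (J -)] is Frobenius on [p]: if [x] is in [p] and [[J, x]] is in [n] then [x]
is scalar.  Comparing top degrees in [S' x - x S' = nu S' + S' u] shows that
[g.rCG] has no component of degree > 1 and that its component [b] of degree 1
inverts [x |-> [J, x]] on [p]; hence the carrier of [b] is [p].  Components of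
negative degree do not occur since [g] and [rCG] have none.  Everything else
(the Yang-Baxter equations for the two components, membership in the Zariski
closures) follows from the polynomial dependence on [t^(2n)]. *)

(** * Tensors as operators *)

(** The congruence n = 1 or -1 modulo i enters twice. It makes [g] explicit: (-nj) mod i is i - j or
    j, so exp(-Z) and exp(-X) exp(-Y) have signed binomial entries, and the conjugation identity
    splits into Pascal's rule on the rows from i on and a product of three i x i blocks in the upper
    left corner. It also makes tr (J -) Frobenius: an x in p with [J, x] in n is constant along
    steps (i, i), and for such n these diagonals leave the matrix soon enough to kill everything
    that is not scalar. The left factor [K] is there because only those rows and that corner are
    compared. It is harmless: its diagonal blocks are scalar, so conjugation by [K] moves p only by
    n. The Frobenius property serves above all as a uniqueness principle: a traceless x in p with S'
    x - x S' in n S' is zero. One descent lemma, [filtration], thus yields the modified Yang-Baxter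
    equation for g.rCG, its degree bound and the inversion formula for b; the Yang-Baxter tensor of
    [rCG] is never expanded from its formula. *)

Section TensorsAsOperators.
Variables (F : fieldType) (n : nat).
Implicit Types (r s : T2 F n) (u v w g : 'M[F]_n).

Lemma sum_I2 (V : nmodType) (f : I2 n -> V) :
  \sum_x f x = \sum_a \sum_b \sum_c \sum_d f (a, b, c, d).
Proof. by rewrite !pair_bigA /=; apply: eq_bigr => -[[[a b] c] d]. Qed.

Lemma sum_I3 (V : nmodType) (f : I3 n -> V) :
  \sum_x f x =
  \sum_a \sum_b \sum_c \sum_d \sum_p \sum_q f (a, b, c, d, p, q).
Proof. by rewrite !pair_bigA /=; apply: eq_bigr => -[[[[[a b] c] d] p] q]. Qed.

Lemma sum_delta (R : pzSemiRingType) (a : 'I_n) (f : 'I_n -> R) :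
  \sum_b (b == a)%:R * f b = f a.
Proof.
rewrite (bigD1 a) //= eqxx mul1r big1 ?addr0 // => b /negPf ->.
by rewrite mul0r.
Qed.

Lemma sum_deltar (R : pzSemiRingType) (a : 'I_n) (f : 'I_n -> R) :
  \sum_b f b * (b == a)%:R = f a.
Proof.
rewrite (bigD1 a) //= eqxx mulr1 big1 ?addr0 // => b /negPf ->.
by rewrite mulr0.
Qed.

(** The second leg is paired with [u] by the trace form, so [tens v w] becomes the rank one operator
    u |-> tr (w u) v; this form accounts for the transposed indices [u d c]. *)
Definition Rop (r : T2 F n) (u : 'M[F]_n) : 'M[F]_n :=
  \matrix_(a, b) \sum_c \sum_d r (a, b, c, d) * u d c.

Lemma Rop_E r (c d a b : 'I_n) : Rop r (E F d c) a b = r (a, b, c, d).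
Proof.
rewrite mxE; under eq_bigr => c' _.
  under eq_bigr => d' _ do rewrite mxE -mulnb natrM mulrA.
  rewrite -mulr_suml sum_deltar; over.
by rewrite sum_deltar.
Qed.

Lemma RopD r u v : Rop r (u + v) = Rop r u + Rop r v.
Proof.
apply/matrixP => a b; rewrite !mxE -big_split; apply: eq_bigr => c _ /=.
by rewrite -big_split; apply: eq_bigr => d _; rewrite mxE mulrDr.
Qed.

Lemma RopZ r k u : Rop r (k *: u) = k *: Rop r u.
Proof.
apply/matrixP => a b; rewrite !mxE mulr_sumr; apply: eq_bigr => c _ /=.
by rewrite mulr_sumr; apply: eq_bigr => d _; rewrite mxE mulrCA.
Qed.

Lemma Rop0 r : Rop r 0 = 0.
Proof. by have := RopZ r 0 0; rewrite !scale0r. Qed.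

Lemma RopN r u : Rop r (- u) = - Rop r u.
Proof. by rewrite -scaleN1r RopZ scaleN1r. Qed.

Lemma RopB r u v : Rop r (u - v) = Rop r u - Rop r v.
Proof. by rewrite RopD RopN. Qed.

Lemma Rop_sum r (I : finType) (f : I -> 'M[F]_n) :
  Rop r (\sum_k f k) = \sum_k Rop r (f k).
Proof. exact: (big_morph (Rop r) (RopD r) (Rop0 r)). Qed.

Lemma mx_sumE u : u = \sum_d \sum_c u d c *: E F d c.
Proof. exact: matrix_sum_delta. Qed.

Lemma Rop_sumE r u : Rop r u = \sum_d \sum_c u d c *: Rop r (E F d c).
Proof.
rewrite {1}(mx_sumE u) Rop_sum; apply: eq_bigr => d _; rewrite Rop_sum.
by apply: eq_bigr => c _; rewrite RopZ.
Qed.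

Lemma Rop_inj r s : (forall u, Rop r u = Rop s u) -> r = s.
Proof.
by move=> h; apply/ffunP => -[[[a b] c] d]; rewrite -!Rop_E h.
Qed.

Lemma RopDl r s u : Rop (r + s) u = Rop r u + Rop s u.
Proof.
apply/matrixP => a b; rewrite !mxE -big_split; apply: eq_bigr => c _ /=.
by rewrite -big_split; apply: eq_bigr => d _; rewrite ffunE mulrDl.
Qed.

Lemma RopZl k r u : Rop (k *: r) u = k *: Rop r u.
Proof.
apply/matrixP => a b; rewrite !mxE mulr_sumr; apply: eq_bigr => c _ /=.
by rewrite mulr_sumr; apply: eq_bigr => d _; rewrite ffunE mulrA.
Qed.

Lemma Rop_tens u v w : Rop (tens u v) w = \tr (v *m w) *: u.
Proof.
apply/matrixP => a b; rewrite !mxE /mxtrace mulr_suml.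
apply: eq_bigr => c _; rewrite mxE mulr_suml; apply: eq_bigr => d _.
by rewrite ffunE [RHS]mulrC mulrA.
Qed.

(** Invariance of the trace form moves the conjugation of the second leg onto the argument. *)
Lemma Rop_act g r u : g \in unitmx ->
  Rop (act g r) u = conjmx g (Rop r (conjmx (invmx g) u)).
Proof.
move=> ug; rewrite /act.
have Rop0l : Rop 0 u = 0.
  by have := RopZl 0 0 u; rewrite !scale0r.
rewrite (big_morph (fun r => Rop r u) (fun r s => RopDl r s u) Rop0l).
rewrite sum_I2.
set w := conjmx (invmx g) u.
have trw c d : \tr (conjmx g (E F c d) *m u) = w d c.
  have -> : \tr (conjmx g (E F c d) *m u) = \tr (E F c d *m w).
    by rewrite /w /conjmx invmxK -!mulmxA mxtrace_mulC !mulmxA.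
  rewrite /mxtrace (bigD1 c) //= big1 ?addr0; last first.
    by move=> a /negPf ac; rewrite mxE big1 // => b _; rewrite mxE ac mul0r.
  rewrite mxE; under eq_bigr do rewrite mxE eqxx.
  by rewrite sum_delta.
rewrite [in RHS](mx_sumE (Rop r w)) /conjmx mulmx_sumr mulmx_suml.
apply: eq_bigr => a _; rewrite mulmx_sumr mulmx_suml; apply: eq_bigr => b _.
rewrite -scalemxAr -scalemxAl mxE scaler_suml; apply: eq_bigr => c _.
rewrite scaler_suml; apply: eq_bigr => d _.
by rewrite RopZl Rop_tens trw scalerA.
Qed.

End TensorsAsOperators.

(** * The Yang-Baxter tensor as a bracket identity for operators *)

Section YangBaxter.
Variables (F : fieldType) (n : nat).
Implicit Types (r s : T2 F n) (X Y : T3 F n) (u v w x g : 'M[F]_n).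

Definition skew_tensor r := forall a b c d, r (a, b, c, d) = - r (c, d, a, b).

(** The operator form of the Yang-Baxter equation: classical for [k = 0], modified for nonzero
    [k]. *)
Definition mcybe k r := forall u v,
  lbr (Rop r u) (Rop r v) - Rop r (lbr u (Rop r v) + lbr (Rop r u) v) =
  k *: lbr u v.

Lemma mulmx_E u (a b c d : 'I_n) : (u *m E F a b) c d = u c a * (d == b)%:R.
Proof.
rewrite mxE; under eq_bigr => j _ do rewrite mxE -mulnb natrM mulrA.
by rewrite -mulr_suml sum_deltar.
Qed.

Lemma E_mulmx u (a b c d : 'I_n) : (E F a b *m u) c d = (c == a)%:R * u b d.
Proof.
rewrite mxE; under eq_bigr => j _ do rewrite mxE -mulnb natrM -mulrA.
by rewrite -mulr_sumr sum_delta.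
Qed.

Lemma mul3E X Y (a b c d p q : 'I_n) :
  mul3 X Y (a, b, c, d, p, q) =
  \sum_j \sum_k \sum_l X (a, j, c, k, p, l) * Y (j, b, k, d, l, q).
Proof.
rewrite /mul3 sum_ffunE.
transitivity (\sum_(y : I3 n)
    let: (a1, j, c1, k, p1, l) := y in
    (a1 == a)%:R * ((c1 == c)%:R * ((p1 == p)%:R *
      (X (a1, j, c1, k, p1, l) * Y (j, b, k, d, l, q))))).
  apply: eq_bigr => -[[[[[a1 j] c1] k] p1] l] _; rewrite sum_ffunE.
  rewrite (bigD1 (j, b, k, d, l, q)) //= big1 ?addr0.
    rewrite !ffunE !E_mulmx !mxE !eqxx /= !mulr1 ![a1 == a]eq_sym.
    rewrite ![c1 == c]eq_sym ![p1 == p]eq_sym /GRing.scale /=.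
    by case: (a == a1); case: (c == c1); case: (p == p1);
      rewrite ?(mulr0, mul0r, mulr1, mul1r).
  move=> [[[[[a2 b2] c2] d2] p2] q2]; rewrite !xpair_eqE => ne.
  rewrite !ffunE !E_mulmx !mxE /GRing.scale /=.
  move: ne; rewrite ![_ == b]eq_sym ![_ == d]eq_sym ![_ == q]eq_sym.
  rewrite ![_ == j]eq_sym ![_ == k]eq_sym ![_ == l]eq_sym.
  case: (j == a2); case: (b == b2); case: (k == c2); case: (d == d2);
  case: (l == p2); case: (q == q2) => //= _;
  by rewrite ?(mulr0, mul0r).
rewrite sum_I3.
under eq_bigr => a1 _.
  under eq_bigr => j _.
    under eq_bigr => c1 _.
      under eq_bigr => k _.
        under eq_bigr => p1 _ do rewrite -!mulr_sumr.
        rewrite -!mulr_sumr sum_delta; over.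
      rewrite -!mulr_sumr; over.
    rewrite -!mulr_sumr sum_delta; over.
  rewrite -!mulr_sumr; over.
by rewrite sum_delta.
Qed.

Lemma r12E r (a b c d p q : 'I_n) :
  r12 r (a, b, c, d, p, q) = r (a, b, c, d) * (p == q)%:R.
Proof.
rewrite /r12 sum_ffunE (bigD1 (a, b, c, d)) //= big1 ?addr0.
  by rewrite !ffunE !mxE !eqxx /= !mul1r.
move=> [[[a2 b2] c2] d2]; rewrite !xpair_eqE => ne.
rewrite !ffunE !mxE /GRing.scale /= ![_ == a2]eq_sym ![_ == b2]eq_sym.
rewrite ![_ == c2]eq_sym ![_ == d2]eq_sym.
move: ne; case: (a2 == a); case: (b2 == b); case: (c2 == c);
  case: (d2 == d) => //= _; by rewrite ?(mulr0, mul0r).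
Qed.

Lemma r23E r (a b c d p q : 'I_n) :
  r23 r (a, b, c, d, p, q) = (a == b)%:R * r (c, d, p, q).
Proof.
rewrite /r23 sum_ffunE (bigD1 (c, d, p, q)) //= big1 ?addr0.
  by rewrite !ffunE !mxE !eqxx /= !mulr1 [RHS]mulrC.
move=> [[[a2 b2] c2] d2]; rewrite !xpair_eqE => ne.
rewrite !ffunE !mxE /GRing.scale /= ![_ == a2]eq_sym ![_ == b2]eq_sym.
rewrite ![_ == c2]eq_sym ![_ == d2]eq_sym.
move: ne; case: (a2 == c); case: (b2 == d); case: (c2 == p);
  case: (d2 == q) => //= _; by rewrite ?(mulr0, mul0r).
Qed.

Lemma r13E r (a b c d p q : 'I_n) :
  r13 r (a, b, c, d, p, q) = (c == d)%:R * r (a, b, p, q).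
Proof. by rewrite ffunE r23E. Qed.

Lemma lbrE u v a b : lbr u v a b = (u *m v) a b - (v *m u) a b.
Proof. by rewrite mxE [X in _ + X]mxE. Qed.

Lemma Rop_lbrE r u (c d a b : 'I_n) :
  Rop r (lbr u (E F d c)) a b =
  \sum_j (u j d * r (a, b, c, j) - u c j * r (a, b, j, d)).
Proof.
rewrite mxE sumrB /=.
under eq_bigr => c' _ do under eq_bigr => d' _ do
  rewrite lbrE mulmx_E E_mulmx mulrBr.
under eq_bigr => c' _ do rewrite sumrB.
rewrite sumrB; congr (_ - _).
  under [LHS]eq_bigr => c' _ do under eq_bigr => d' _ do rewrite mulrA.
  under [LHS]eq_bigr => c' _ do rewrite -mulr_suml.
  by rewrite sum_deltar; apply: eq_bigr => d' _; rewrite mulrC.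
under [LHS]eq_bigr => c' _ do under eq_bigr => d' _ do rewrite mulrCA.
by under [LHS]eq_bigr => c' _ do rewrite sum_delta mulrC.
Qed.

Lemma sum3_kl (k0 l0 : 'I_n) (f : 'I_n -> 'I_n -> 'I_n -> F) :
  \sum_j \sum_k \sum_l (k == k0)%:R * ((l == l0)%:R * f j k l) =
  \sum_j f j k0 l0.
Proof.
apply: eq_bigr => j _; under eq_bigr => k _ do rewrite -mulr_sumr sum_delta.
by rewrite sum_delta.
Qed.

Lemma sum3_jl (j0 l0 : 'I_n) (f : 'I_n -> 'I_n -> 'I_n -> F) :
  \sum_j \sum_k \sum_l (j == j0)%:R * ((l == l0)%:R * f j k l) =
  \sum_k f j0 k l0.
Proof. by rewrite exchange_big sum3_kl. Qed.

Lemma sum3_jk (j0 k0 : 'I_n) (f : 'I_n -> 'I_n -> 'I_n -> F) :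
  \sum_j \sum_k \sum_l (j == j0)%:R * ((k == k0)%:R * f j k l) =
  \sum_l f j0 k0 l.
Proof.
under eq_bigr => j _ do rewrite exchange_big.
by rewrite exchange_big sum3_kl.
Qed.

(** Pairing the last two legs with u = E d c and v = E q p turns [r12, r13] into [R u, R v],
    [r12, r23] into -R [u, R v] and, after one use of skewness, [r13, r23] into -R [R u, v]. *)
Lemma cybeE r (a b c d p q : 'I_n) : skew_tensor r ->
  cybe r (a, b, c, d, p, q) =
  (lbr (Rop r (E F d c)) (Rop r (E F q p)) -
   Rop r (lbr (E F d c) (Rop r (E F q p)) + lbr (Rop r (E F d c)) (E F q p)))
   a b.
Proof.
move=> sk.
have -> : lbr (E F d c) (Rop r (E F q p)) = - lbr (Rop r (E F q p)) (E F d c).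
  by rewrite /lbr opprB.
rewrite RopD RopN opprD opprK mxE [X in _ = _ + X]mxE [X in _ = _ + (_ + X)]mxE.
rewrite !Rop_lbrE lbrE addrA /cybe !ffunE !mul3E.
rewrite ![in RHS]mxE.
congr (_ + _ + _).
- congr (_ - _).
    transitivity (\sum_j r (a, j, c, d) * r (j, b, p, q)).
      rewrite -(sum3_kl d p (fun j k l => r (a, j, c, k) * r (j, b, l, q))).
      apply: eq_bigr => j _; apply: eq_bigr => k _; apply: eq_bigr => l _.
      by rewrite r12E r13E [p == l]eq_sym; ring.
    by apply: eq_bigr => j _; rewrite !Rop_E.
  transitivity (\sum_j r (a, j, p, q) * r (j, b, c, d)).
    rewrite -(sum3_kl c q (fun j k l => r (a, j, p, l) * r (j, b, k, d))).
    apply: eq_bigr => j _; apply: eq_bigr => k _; apply: eq_bigr => l _.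
    by rewrite r12E r13E [c == k]eq_sym; ring.
  by apply: eq_bigr => j _; rewrite !Rop_E.
- rewrite sumrB; congr (_ - _).
    transitivity (\sum_j r (a, b, c, j) * r (j, d, p, q)).
      rewrite -(sum3_jl b p (fun j k l => r (a, j, c, k) * r (k, d, l, q))).
      apply: eq_bigr => j _; apply: eq_bigr => k _; apply: eq_bigr => l _.
      by rewrite r12E r23E [p == l]eq_sym; ring.
    by apply: eq_bigr => j _; rewrite !Rop_E mulrC.
  transitivity (\sum_j r (c, j, p, q) * r (a, b, j, d)).
    rewrite -(sum3_jl a q (fun j k l => r (c, k, p, l) * r (j, b, k, d))).
    apply: eq_bigr => j _; apply: eq_bigr => k _; apply: eq_bigr => l _.
    by rewrite r12E r23E [a == j]eq_sym; ring.
  by apply: eq_bigr => j _; rewrite !Rop_E.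
- rewrite sumrB opprB addrC; congr (_ + _).
    transitivity (\sum_j - (r (c, d, p, j) * r (a, b, j, q))).
      rewrite -(sum3_jk a d (fun j k l => - (r (c, k, p, l) * r (j, b, l, q)))).
      rewrite -sumrN; apply: eq_bigr => j _; rewrite -sumrN.
      apply: eq_bigr => k _; rewrite -sumrN; apply: eq_bigr => l _.
      by rewrite r13E r23E [a == j]eq_sym; ring.
    by apply: eq_bigr => j _; rewrite !Rop_E (sk p j) mulNr.
  transitivity (\sum_j r (a, b, p, j) * r (c, d, j, q)).
    rewrite -(sum3_jk b c (fun j k l => r (a, j, p, l) * r (k, d, l, q))).
    apply: eq_bigr => j _; apply: eq_bigr => k _; apply: eq_bigr => l _.
    by rewrite r13E r23E [c == k]eq_sym; ring.
  rewrite -sumrN; apply: eq_bigr => j _.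
  by rewrite Rop_E (sk j q) mulNr opprK mulrC.
Qed.

Lemma lie_act3E x X (a b c d p q : 'I_n) :
  lie_act3 x X (a, b, c, d, p, q) =
    \sum_j (x a j * X (j, b, c, d, p, q) - X (a, j, c, d, p, q) * x j b)
  + \sum_j (x c j * X (a, b, j, d, p, q) - X (a, b, c, j, p, q) * x j d)
  + \sum_j (x p j * X (a, b, c, d, j, q) - X (a, b, c, d, p, j) * x j q).
Proof.
have lE (a' b' j k : 'I_n) : lbr x (E F j k) a' b' =
    x a' j * (k == b')%:R - (j == a')%:R * x k b'.
  by rewrite lbrE mulmx_E E_mulmx ![_ == k]eq_sym ![_ == j]eq_sym.
have EE (a' b' j k : 'I_n) : E F j k a' b' = (j == a')%:R * (k == b')%:R.
  by rewrite mxE ![_ == k]eq_sym ![_ == j]eq_sym -natrM mulnb.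
have col (f : 'I_n -> 'I_n -> F) (a' b' : 'I_n) :
    \sum_j \sum_k f j k * (x a' j * (k == b')%:R - (j == a')%:R * x k b') =
    \sum_j (x a' j * f j b' - f a' j * x j b').
  under eq_bigr => j _ do under eq_bigr => k _ do rewrite mulrBr.
  under eq_bigr => j _ do rewrite sumrB.
  rewrite !sumrB; congr (_ - _).
    apply: eq_bigr => j _; under eq_bigr => k _ do rewrite mulrA.
    by rewrite sum_deltar mulrC.
  rewrite exchange_big; apply: eq_bigr => k _.
  under eq_bigr => j _ do rewrite mulrCA.
  by rewrite sum_delta.
rewrite /lie_act3 sum_ffunE.
transitivity (
  \sum_(y : I3 n) (let: (a1, b1, c1, d1, p1, q1) := y in
     (c1 == c)%:R * ((d1 == d)%:R * ((p1 == p)%:R * ((q1 == q)%:R *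
     (X y * lbr x (E F a1 b1) a b)))))
+ \sum_(y : I3 n) (let: (a1, b1, c1, d1, p1, q1) := y in
     (a1 == a)%:R * ((b1 == b)%:R * ((p1 == p)%:R * ((q1 == q)%:R *
     (X y * lbr x (E F c1 d1) c d)))))
+ \sum_(y : I3 n) (let: (a1, b1, c1, d1, p1, q1) := y in
     (a1 == a)%:R * ((b1 == b)%:R * ((c1 == c)%:R * ((d1 == d)%:R *
     (X y * lbr x (E F p1 q1) p q)))))).
  rewrite -!big_split; apply: eq_bigr => -[[[[[a1 b1] c1] d1] p1] q1] _.
  by rewrite !ffunE /GRing.scale /= !EE; ring.
rewrite !sum_I3 -[X in _ = X + _ + _](col (fun j k => X (j, k, c, d, p, q))).
rewrite -[X in _ = _ + X + _](col (fun j k => X (a, b, j, k, p, q))).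
rewrite -[X in _ = _ + _ + X](col (fun j k => X (a, b, c, d, j, k))).
congr (_ + _ + _).
- apply: eq_bigr => a1 _; apply: eq_bigr => b1 _.
  under eq_bigr => c1 _ do (under eq_bigr => d1 _ do
    (under eq_bigr => p1 _ do rewrite -!mulr_sumr sum_delta;
     rewrite -!mulr_sumr sum_delta); rewrite -!mulr_sumr sum_delta).
  by rewrite sum_delta lE.
- under eq_bigr => a1 _ do (under eq_bigr => b1 _ do
   (under eq_bigr => c1 _ do (under eq_bigr => d1 _ do
     (under eq_bigr => p1 _ do rewrite -!mulr_sumr sum_delta;
     rewrite -!mulr_sumr sum_delta); rewrite -!mulr_sumr);
    rewrite -!mulr_sumr); rewrite -!mulr_sumr sum_delta).
  rewrite sum_delta; apply: eq_bigr => c1 _; apply: eq_bigr => d1 _.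
  by rewrite lE.
- under eq_bigr => a1 _ do (under eq_bigr => b1 _ do
   (under eq_bigr => c1 _ do (under eq_bigr => d1 _ do
     (under eq_bigr => p1 _ do rewrite -!mulr_sumr;
     rewrite -!mulr_sumr); rewrite -!mulr_sumr sum_delta);
    rewrite -!mulr_sumr sum_delta); rewrite -!mulr_sumr sum_delta).
  rewrite sum_delta; apply: eq_bigr => c1 _; apply: eq_bigr => d1 _.
  by rewrite lE.
Qed.

End YangBaxter.

(** * Membership in M and C, and transport under the group action *)

Section Membership.
Variables (F : fieldType) (n : nat).
Hypothesis char0 : [pchar F] =i pred0.
Implicit Types (r s : T2 F n) (u v w x g : 'M[F]_n).

Lemma char0_natr_neq0 k : (0 < k)%N -> k%:R != 0 :> F.
Proof. by move=> k0; rewrite (iffLR (pcharf0P F) char0) -lt0n. Qed.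

Lemma lbrZl k u v : lbr (k *: u) v = k *: lbr u v.
Proof. by rewrite /lbr -scalemxAl -scalemxAr scalerBr. Qed.

Lemma lbrZr k u v : lbr u (k *: v) = k *: lbr u v.
Proof. by rewrite /lbr -scalemxAl -scalemxAr scalerBr. Qed.

Lemma lbrDl u v w : lbr (u + v) w = lbr u w + lbr v w.
Proof. by rewrite /lbr mulmxDl mulmxDr opprD addrACA. Qed.

Lemma lbrDr u v w : lbr w (u + v) = lbr w u + lbr w v.
Proof. by rewrite /lbr mulmxDl mulmxDr opprD addrACA. Qed.

Lemma lbrC u v : lbr u v = - lbr v u.
Proof. by rewrite /lbr opprB. Qed.

Lemma lbrBl u v w : lbr (u - v) w = lbr u w - lbr v w.
Proof. by rewrite lbrDl -scaleN1r lbrZl scaleN1r. Qed.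

Lemma lbrBr u v w : lbr w (u - v) = lbr w u - lbr w v.
Proof. by rewrite lbrDr -scaleN1r lbrZr scaleN1r. Qed.

Lemma lbr_sumr (I : finType) (f : I -> 'M[F]_n) u :
  lbr u (\sum_j f j) = \sum_j lbr u (f j).
Proof.
rewrite /lbr mulmx_sumr mulmx_suml -sumrB; exact: eq_bigr.
Qed.

Lemma lbr_suml (I : finType) (f : I -> 'M[F]_n) u :
  lbr (\sum_j f j) u = \sum_j lbr (f j) u.
Proof.
rewrite /lbr mulmx_sumr mulmx_suml -sumrB; exact: eq_bigr.
Qed.

Lemma lbr_jacobi u v w :
  lbr u (lbr v w) = lbr (lbr u v) w + lbr v (lbr u w).
Proof.
rewrite /lbr !mulmxBl !mulmxBr !mulmxA !opprB !addrA.

apply/matrixP => a b; rewrite !mxE; ring.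
Qed.

Lemma trace_lbr u v : \tr (lbr u v) = 0.
Proof. by rewrite /lbr raddfB /= mxtrace_mulC subrr. Qed.

Lemma lbr_scalar u k : lbr k%:M u = 0.
Proof. by rewrite /lbr scalar_mxC subrr. Qed.

Lemma cybe_mcybe k r (a b c d p q : 'I_n) : skew_tensor r -> mcybe k r ->
  cybe r (a, b, c, d, p, q) = k * lbr (E F d c) (E F q p) a b.
Proof. by move=> sk mr; rewrite cybeE // mr mxE. Qed.

(** [cybe r] is [k] times the tensor of the Lie bracket. Under the trace form, acting by [x] on one
    of the last two legs is minus the adjoint action on the corresponding argument, and the three
    terms cancel by the Jacobi identity. *)
Lemma mcybe_inv k r x : skew_tensor r -> mcybe k r -> lie_act3 x (cybe r) = 0.
Proof.
move=> sk mr; apply/ffunP => -[[[[[a b] c] d] p] q].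
rewrite lie_act3E ffunE.
under eq_bigr => j _ do rewrite !(cybe_mcybe _ _ _ _ _ _ sk mr).
under [X in _ + X + _]eq_bigr => j _ do rewrite !(cybe_mcybe _ _ _ _ _ _ sk mr).
under [X in _ + _ + X]eq_bigr => j _ do rewrite !(cybe_mcybe _ _ _ _ _ _ sk mr).
have -> : \sum_j (x a j * (k * lbr (E F d c) (E F q p) j b) -
              k * lbr (E F d c) (E F q p) a j * x j b) =
          k * lbr x (lbr (E F d c) (E F q p)) a b.
  rewrite lbrE 2![in RHS]mxE -sumrB mulr_sumr; apply: eq_bigr => j _; ring.
have sE (c' d' : 'I_n) : lbr x (E F d' c') =
    \sum_j (x j d' *: E F j c' - x c' j *: E F d' j).
  apply/matrixP => a' b'; rewrite summxE lbrE mulmx_E E_mulmx.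
  rewrite -[X in X - _ = _](sum_delta a' (fun j => x j d' * (b' == c')%:R)).
  rewrite -[X in _ - X = _](sum_delta b' (fun j => (a' == d')%:R * x c' j)).
  rewrite -sumrB; apply: eq_bigr => j _.
  by rewrite !mxE -!mulnb !natrM ![_ == j]eq_sym; ring.
have -> : \sum_j (x c j * (k * lbr (E F d j) (E F q p) a b) -
              k * lbr (E F j c) (E F q p) a b * x j d) =
          - (k * lbr (lbr x (E F d c)) (E F q p) a b).
  rewrite sE lbr_suml summxE mulr_sumr -sumrN; apply: eq_bigr => j _.
  by rewrite lbrBl !lbrZl !mxE; ring.
have -> : \sum_j (x p j * (k * lbr (E F d c) (E F q j) a b) -
              k * lbr (E F d c) (E F j p) a b * x j q) =
          - (k * lbr (E F d c) (lbr x (E F q p)) a b).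
  rewrite sE lbr_sumr summxE mulr_sumr -sumrN; apply: eq_bigr => j _.
  by rewrite lbrBr !lbrZr !mxE; ring.
by rewrite lbr_jacobi mxE mulrDr -addrA -opprD subrr.
Qed.

Lemma mcybe_neq0 (k : F) r : (1 < n)%N -> k != 0 -> skew_tensor r -> mcybe k r ->
  cybe r != 0.
Proof.
move=> n1 k0 sk mr; have n0 : (0 < n)%N by apply: ltnW.
pose a : 'I_n := Ordinal n0; pose b : 'I_n := Ordinal n1.
(* This coefficient is [k] times the (a, b) entry of [E a a, E a b] = E a b. *)
apply/eqP => /ffunP /(_ (a, b, a, a, b, a)).
rewrite [X in _ = X]ffunE (cybe_mcybe _ _ _ _ _ _ sk mr) lbrE mulmx_E E_mulmx !mxE !eqxx /=.
by rewrite mulr1 mulr0 subr0 mulr1 => /eqP; apply/negP.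
Qed.

Definition slproj (u : 'M[F]_n) : 'M[F]_n := u - (\tr u / n%:R)%:M.

Lemma slproj_traceless u : (0 < n)%N -> \tr (slproj u) = 0.
Proof.
move=> n0; rewrite raddfB /= mxtrace_scalar -[X in _ - X]mulr_natr divfK ?subrr //.
exact: char0_natr_neq0.
Qed.

Lemma slprojZ (k : F) u : slproj (k *: u) = k *: slproj u.
Proof. by rewrite /slproj mxtraceZ scalerBr -mulrA scale_scalar_mx. Qed.

Lemma slprojD u v : slproj (u + v) = slproj u + slproj v.
Proof. by rewrite /slproj raddfD /= mulrDl raddfD /= opprD addrACA. Qed.

Lemma slproj_id u : \tr u = 0 -> slproj u = u.
Proof. by move=> tu; rewrite /slproj tu mul0r raddf0 subr0. Qed.

Lemma slproj_sum (I : finType) (f : I -> 'M[F]_n) :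
  slproj (\sum_j f j) = \sum_j slproj (f j).
Proof.
apply: (big_morph slproj slprojD); apply: slproj_id; exact: mxtrace0.
Qed.

(** By skewness the value at the identity is minus the partial trace of the first leg. *)
Lemma Rop1 r : skew_tensor r -> (forall u, \tr (Rop r u) = 0) -> Rop r 1%:M = 0.
Proof.
move=> sk tr0; apply/matrixP => a b; rewrite mxE [RHS]mxE.
under eq_bigr => c _ do under eq_bigr => d _ do rewrite mxE.
under eq_bigr => c _ do rewrite sum_deltar sk -Rop_E.
by rewrite sumrN -/(mxtrace _) tr0 oppr0.
Qed.

Lemma Rop_slproj r u : skew_tensor r -> (forall u, \tr (Rop r u) = 0) ->
  Rop r (slproj u) = Rop r u.
Proof.
by move=> sk tr0; rewrite RopB -scalemx1 RopZ Rop1 // scaler0 subr0.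
Qed.

Lemma Rop_suml (I : finType) (f : I -> T2 F n) u :
  Rop (\sum_j f j) u = \sum_j Rop (f j) u.
Proof.
apply: (big_morph (fun r => Rop r u) (fun r s => RopDl r s u)).
by have := RopZl 0 0 u; rewrite !scale0r.
Qed.

Lemma trace_mulE u (c d : 'I_n) : \tr (E F c d *m u) = u d c.
Proof.
rewrite /mxtrace -(sum_delta c (fun a => u d a)).
by apply: eq_bigr => a _; rewrite E_mulmx.
Qed.

(* Skewness turns vanishing of one partial trace into vanishing of both, so
   projecting both legs to traceless matrices leaves the tensor unchanged. *)
Lemma in_slwedgeP r : (0 < n)%N -> skew_tensor r ->
  (forall u, \tr (Rop r u) = 0) -> in_slwedge r.
Proof.
move=> n0 sk tr0.
have two0 : 2%:R != 0 :> F by exact: char0_natr_neq0.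
pose m (x : I2 n) := let: (a, b, c, d) := x in
  (r x *: slproj (E F a b), slproj (E F c d)).
exists [seq m y | y <- index_enum (I2 n)]; split.
  apply/allP => y /mapP [[[[a b] c] d] _ ->] /=.
  by rewrite /traceless mxtraceZ !slproj_traceless // mulr0 eqxx.
rewrite big_map.
have slprojE u v : \tr (slproj u *m v) = \tr (u *m slproj v).
  rewrite /slproj mulmxBl mulmxBr !raddfB /= mul_scalar_mx mul_mx_scalar.
  by rewrite !mxtraceZ; congr (_ - _); ring.
have key : r = \sum_(x : I2 n) (let: (a, b, c, d) := x in
    r x *: tens (slproj (E F a b)) (slproj (E F c d))).
  apply: Rop_inj => w; rewrite Rop_suml sum_I2.
  have -> : Rop r w = slproj (Rop r (slproj w)).
    by rewrite Rop_slproj // /slproj tr0 mul0r raddf0 subr0.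
  rewrite (mx_sumE (Rop r _)) slproj_sum; apply: eq_bigr => a _.
  rewrite slproj_sum; apply: eq_bigr => b _; rewrite slprojZ mxE scaler_suml.
  apply: eq_bigr => c _; rewrite scaler_suml; apply: eq_bigr => d _.
  by rewrite RopZl Rop_tens slprojE trace_mulE scalerA.
have sk' : r = \sum_(x : I2 n) (let: (a, b, c, d) := x in
    - r x *: tens (slproj (E F c d)) (slproj (E F a b))).
  pose f (x : I2 n) : I2 n := let: (a, b, c, d) := x in (c, d, a, b).
  have f_inj : injective f.
    by move=> [[[a b] c] d] [[[a' b'] c'] d'] [-> -> -> ->].
  rewrite {1}key (reindex_inj f_inj) /=.
  by apply: eq_bigr => -[[[a b] c] d] _ /=; rewrite -sk.
have r2 : r = 2^-1 *: (r + r).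
  by rewrite -mulr2n -scaler_nat scalerA mulVf ?scale1r.
rewrite [LHS]r2 [X in _ *: (X + _) = _]key [X in _ *: (_ + X) = _]sk'.
rewrite -big_split scaler_sumr /=.
apply: eq_bigr => -[[[a b] c] d] _ /=; rewrite /wedge; congr (_ *: _).
apply/ffunP => -[[[a' b'] c'] d']; rewrite !ffunE !mxE /GRing.scale /=; ring.
Qed.

Lemma inMP (k : F) r : (1 < n)%N -> k != 0 -> skew_tensor r ->
  (forall u, \tr (Rop r u) = 0) -> mcybe k r -> inM r.
Proof.
move=> n1 k0 sk tr0 mr; split; first exact: in_slwedgeP (ltnW n1) sk tr0.
  exact: mcybe_neq0 mr.
by move=> x _; apply: mcybe_inv mr.
Qed.

Lemma inCP r : (0 < n)%N -> skew_tensor r ->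
  (forall u, \tr (Rop r u) = 0) -> mcybe 0 r -> inC r.
Proof.
move=> n0 sk tr0 mr; split; first exact: in_slwedgeP n0 sk tr0.
apply/ffunP => -[[[[[a b] c] d] p] q].
by rewrite (cybe_mcybe _ _ _ _ _ _ sk mr) mul0r [RHS]ffunE.
Qed.

Lemma mxconjM g u v : g \in unitmx -> conjmx g (u *m v) = conjmx g u *m conjmx g v.
Proof. by move=> ug; rewrite /conjmx !mulmxA mulmxKV. Qed.

Lemma mxconjB g u v : conjmx g (u - v) = conjmx g u - conjmx g v.
Proof. by rewrite /conjmx mulmxBr mulmxBl. Qed.

Lemma mxconjD g u v : conjmx g (u + v) = conjmx g u + conjmx g v.
Proof. by rewrite /conjmx mulmxDr mulmxDl. Qed.

Lemma mxconjZ g k u : conjmx g (k *: u) = k *: conjmx g u.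
Proof. by rewrite /conjmx -scalemxAr -scalemxAl. Qed.

Lemma mxconjK g u : g \in unitmx -> conjmx g (conjmx (invmx g) u) = u.
Proof.
by move=> ug; rewrite /conjmx invmxK !mulmxA mulmxV // mul1mx mulmxK.
Qed.

Lemma mxconjVK g u : g \in unitmx -> conjmx (invmx g) (conjmx g u) = u.
Proof.
by move=> ug; rewrite /conjmx invmxK !mulmxA mulVmx // mul1mx mulmxKV.
Qed.

Lemma mxconj_lbr g u v : g \in unitmx ->
  conjmx g (lbr u v) = lbr (conjmx g u) (conjmx g v).
Proof. by move=> ug; rewrite /lbr mxconjB !mxconjM. Qed.

Lemma trace_conjmx g u : g \in unitmx -> \tr (conjmx g u) = \tr u.
Proof. by move=> ug; rewrite /conjmx mxtrace_mulC mulmxA mulVmx // mul1mx. Qed.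

Lemma skew_tensorP r :
  (forall u v, \tr (Rop r u *m v) = - \tr (u *m Rop r v)) -> skew_tensor r.
Proof.
move=> h a b c d; have := h (E F d c) (E F b a).
by rewrite mxtrace_mulC !trace_mulE !Rop_E.
Qed.

Lemma skew_trace r u v : skew_tensor r ->
  \tr (Rop r u *m v) = - \tr (u *m Rop r v).
Proof.
move=> sk; rewrite /mxtrace.
under eq_bigr => a _ do rewrite mxE.
under [in RHS]eq_bigr => c _ do rewrite mxE.
under eq_bigr => a _ do under eq_bigr => b _ do rewrite mxE mulr_suml.
under [in RHS]eq_bigr => c _ do under eq_bigr => d _ do rewrite mxE mulr_sumr.
under eq_bigr => a _ do under eq_bigr => b _ do
  under eq_bigr => c _ do rewrite mulr_suml.
under [in RHS]eq_bigr => c _ do under eq_bigr => d _ do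
  under eq_bigr => a _ do rewrite mulr_sumr.
rewrite [in RHS]exchange_big.
rewrite -(sum_I2 (fun y => let: (a, b, c, d) := y in
   r (a, b, c, d) * u d c * v b a)).
rewrite -(sum_I2 (fun y => let: (d, c, a, b) := y in
   u c d * (r (d, c, a, b) * v b a))).
pose f (x : I2 n) : I2 n := let: (a, b, c, d) := x in (c, d, a, b).
have f_inj : injective f.
  by move=> [[[a b] c] d] [[[a' b'] c'] d'] [-> -> -> ->].
rewrite (reindex_inj f_inj) -sumrN /=.
by apply: eq_bigr => -[[[a b] c] d] _ /=; rewrite sk; ring.
Qed.

Lemma skew_act g r : g \in unitmx -> skew_tensor r -> skew_tensor (act g r).
Proof.
move=> ug sk; apply: skew_tensorP => u v; rewrite !Rop_act //.
set u' := conjmx _ u; set v' := conjmx _ v.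
have -> : v = conjmx g v' by rewrite mxconjK.
have -> : u = conjmx g u' by rewrite mxconjK.
by rewrite -!mxconjM // !trace_conjmx // skew_trace.
Qed.

Lemma mcybe_act k g r : g \in unitmx -> mcybe k r -> mcybe k (act g r).
Proof.
move=> ug mr u v; rewrite -(mxconjK u ug) -(mxconjK v ug).
move: (conjmx (invmx g) u) (conjmx (invmx g) v) => u' v'.
rewrite !Rop_act // !mxconjVK // -!mxconj_lbr // -mxconjD mxconjVK //.
by rewrite -mxconjB mr mxconjZ.
Qed.

Lemma mcybeZ k l r : mcybe k r -> mcybe (l ^+ 2 * k) (l *: r).
Proof.
move=> mr u v; rewrite !RopZl !lbrZl !lbrZr -scalerDr RopZ !scalerA -expr2.
by rewrite -scalerBr mr scalerA.
Qed.

Lemma trace_act g r : g \in unitmx -> (forall u, \tr (Rop r u) = 0) ->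
  forall u, \tr (Rop (act g r) u) = 0.
Proof. by move=> ug tr0 u; rewrite Rop_act // trace_conjmx. Qed.

Lemma act_comp g h r : g \in unitmx -> h \in unitmx ->
  act (g *m h) r = act g (act h r).
Proof.
move=> ug uh; apply: Rop_inj => u; rewrite !Rop_act ?unitmx_mul ?ug //.
have iE : invmx (g *m h) = invmx h *m invmx g.
  apply: (can_inj (mulKmx (_ : g *m h \in unitmx))); first by rewrite unitmx_mul ug.
  by rewrite mulmxV ?unitmx_mul ?ug // mulmxA mulmxK ?mulmxV.
by rewrite /conjmx !invmxK iE !mulmxA.
Qed.

End Membership.

(** * Degree filtration and the Lagrangian subalgebra *)

(* A matrix stabilising a flag of coordinate subspaces is inverted by a
   polynomial in itself (Cayley-Hamilton), so its inverse does as well. *)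
Lemma filtered_inv (F : fieldType) (n : nat) (f : 'I_n -> int) (u : 'M[F]_n) :
  u \in unitmx ->
  (forall a b, f a < f b -> u a b = 0) ->
  forall a b, f a < f b -> invmx u a b = 0.
Proof.
case: n f u => [|m] f u uu fu; first by case.
pose fil (v : 'M[F]_m.+1) := forall a b, f a < f b -> v a b = 0.
have filD v w : fil v -> fil w -> fil (v + w).
  by move=> fv fw a b ab; rewrite mxE fv ?fw ?addr0.
have filZ k v : fil v -> fil (k *: v).
  by move=> fv a b ab; rewrite mxE fv ?mulr0.
have filM v w : fil v -> fil w -> fil (v *m w).
  move=> fv fw a b ab; rewrite mxE big1 // => c _.
  by case: (ltP (f a) (f c)) => ac; [rewrite fv ?mul0r |
    rewrite fw ?mulr0 // (le_lt_trans ac)].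
have fil_scal k : fil k%:M.
  by move=> a b ab; rewrite mxE; case: eqP ab => // ->; rewrite ltxx.
have fil_h (p : {poly F}) : fil (horner_mx u p).
  elim/poly_ind: p => [|p k IH]; first by rewrite rmorph0 => a b _; rewrite mxE.
  rewrite rmorphD rmorphM /= horner_mx_X horner_mx_C.
  by apply: filD => //; apply: filM.
have := Cayley_Hamilton u.
set p := char_poly u.
have p0 : p`_0 != 0.
  rewrite char_poly_det mulf_neq0 ?signr_eq0 //.
  by move: uu; rewrite unitmxE unitfE.
have -> : p = (p %/ 'X) * 'X + (p`_0)%:P.
  rewrite {1}(divp_eq p 'X); congr (_ + _).
  have -> : 'X = 'X - 0%:P :> {poly F} by rewrite subr0.
  by rewrite modp_XsubC horner_coef0.
rewrite rmorphD rmorphM /= horner_mx_X horner_mx_C => /eqP.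
rewrite addr_eq0 => /eqP hE.
have -> : invmx u = - (p`_0)^-1 *: horner_mx u (p %/ 'X).
  apply: (can_inj (mulmxK uu)); rewrite mulVmx // -scalemxAl.
  by rewrite [_ *m u]hE scalerN scaleNr opprK scale_scalar_mx mulVf.
exact/filZ/fil_h.
Qed.

(** * The parabolic subalgebra and its nilradical *)

Section Parabolic.
Variables (F : fieldType) (n i : nat).
Implicit Types (u v w x nu g : 'M[F]_n).

(** 0-based, and without the trace condition: this is the parabolic in gl_n, which is closed under
    products and, by [filtered_inv], under inverses. *)
Definition in_p u := forall a b : 'I_n, (i <= a)%N -> (b < i)%N -> u a b = 0.
Definition in_n u :=
  forall a b : 'I_n, ~~ ((a < i)%N && (i <= b)%N) -> u a b = 0.

Lemma in_n_p u : in_n u -> in_p u.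
Proof. by move=> nu a b ia ib; rewrite nu // negb_and -leqNgt ia. Qed.

Lemma in_pD u v : in_p u -> in_p v -> in_p (u + v).
Proof. by move=> pu pv a b ia ib; rewrite mxE pu ?pv ?addr0. Qed.

Lemma in_pN u : in_p u -> in_p (- u).
Proof. by move=> pu a b ia ib; rewrite mxE pu ?oppr0. Qed.

Lemma in_pB u v : in_p u -> in_p v -> in_p (u - v).
Proof. by move=> pu pv; apply/in_pD/in_pN. Qed.

Lemma in_nD u v : in_n u -> in_n v -> in_n (u + v).
Proof. by move=> pu pv a b ab; rewrite mxE pu ?pv ?addr0. Qed.

Lemma in_nN u : in_n u -> in_n (- u).
Proof. by move=> pu a b ab; rewrite mxE pu ?oppr0. Qed.

Lemma in_nB u v : in_n u -> in_n v -> in_n (u - v).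
Proof. by move=> pu pv; apply/in_nD/in_nN. Qed.

Lemma in_pZ k u : in_p u -> in_p (k *: u).
Proof. by move=> pu a b ia ib; rewrite mxE pu ?mulr0. Qed.

Lemma in_nZ k u : in_n u -> in_n (k *: u).
Proof. by move=> pu a b ab; rewrite mxE pu ?mulr0. Qed.

Lemma in_p_sum (I : finType) (f : I -> 'M[F]_n) :
  (forall j, in_p (f j)) -> in_p (\sum_j f j).
Proof. by move=> pf a b ia ib; rewrite summxE big1 // => j _; rewrite pf. Qed.

Lemma in_n_sum (I : finType) (f : I -> 'M[F]_n) :
  (forall j, in_n (f j)) -> in_n (\sum_j f j).
Proof. by move=> pf a b ab; rewrite summxE big1 // => j _; rewrite pf. Qed.

Lemma in_pM u v : in_p u -> in_p v -> in_p (u *m v).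
Proof.
move=> pu pv a b ia ib; rewrite mxE big1 // => c _.
by case: (ltnP c i) => ic; [rewrite pu ?mul0r | rewrite pv ?mulr0].
Qed.

Lemma in_nMl u v : in_p u -> in_n v -> in_n (u *m v).
Proof.
move=> pu nv a b ab; rewrite mxE big1 // => c _.
case: (boolP ((c < i)%N && (i <= b)%N)) => [/andP[ic ib]|cb]; last first.
  by rewrite nv ?mulr0.
by rewrite pu ?mul0r //; move: ab; rewrite ib andbT -leqNgt.
Qed.

Lemma in_nMr u v : in_n u -> in_p v -> in_n (u *m v).
Proof.
move=> nu pv a b ab; rewrite mxE big1 // => c _.
case: (boolP ((a < i)%N && (i <= c)%N)) => [/andP[ia ic]|ac]; last first.
  by rewrite nu ?mul0r.
by rewrite pv ?mulr0 //; move: ab; rewrite ia /= -ltnNge.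
Qed.

Lemma in_p_lbr u v : in_p u -> in_p v -> in_p (lbr u v).
Proof. by move=> pu pv; apply: in_pB; apply: in_pM. Qed.

Lemma in_n_lbr u v : in_p u -> in_n v -> in_n (lbr u v).
Proof. by move=> pu nv; apply: in_nB; [apply: in_nMl | apply: in_nMr]. Qed.

Lemma in_p_inv u : u \in unitmx -> in_p u -> in_p (invmx u).
Proof.
move=> uu pu a b ia ib.
apply: (@filtered_inv _ _ (fun c => Posz (c < i)%N)) => //.
  move=> c d; case: (ltnP c i) (ltnP d i) => ic [] id //= _.
  exact: pu.
by rewrite ib ltnNge ia.
Qed.

End Parabolic.

Lemma degree_bound (n : nat) (f : 'I_n -> int) :
  exists N : nat, forall a b, f a - f b < Posz N.
Proof.
exists (\max_a \max_b `|f a - f b|%N).+1 => a b.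
have := leq_trans (leq_bigmax b) (leq_bigmax (F := fun a => \max_b `|f a - f b|%N) a).
by move=> /= h; lia.
Qed.

(** * Descent along the grading *)

Section Filtration.
Variables (F : fieldType) (n i : nat) (f : 'I_n -> int) (S : 'M[F]_n).
Hypothesis char0 : [pchar F] =i pred0.
Hypothesis n_gt0 : (0 < n)%N.
Implicit Types (u v w x nu g : 'M[F]_n) (r : T2 F n).

Definition grade (e : int) u : 'M[F]_n :=
  \matrix_(a, b) if f a - f b == e then u a b else 0.

Hypothesis S_pos : forall a b, 0 < f a - f b -> S a b = 0.
Hypothesis S_zero : forall a b, f a - f b = 0 -> S a b = (a == b)%:R.

Let J := grade (-1) S.

Hypothesis frobenius :
  forall x, in_p i x -> in_n i (lbr J x) -> exists k, x = k%:M.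

Lemma frobenius0 x : in_p i x -> in_n i (lbr J x) -> \tr x = 0 -> x = 0.
Proof.
move=> px nx; have [k ->] := frobenius px nx.
rewrite mxtrace_scalar -mulr_natr => /eqP; rewrite mulf_eq0.
by rewrite (negPf (char0_natr_neq0 char0 n_gt0)) orbF => /eqP ->; rewrite raddf0.
Qed.

Lemma trace_grade e x : \tr x = 0 -> \tr (grade e x) = 0.
Proof.
rewrite /mxtrace => tx; under eq_bigr => a _ do rewrite mxE subrr.
by case: eqP => _ //; rewrite big1.
Qed.

Lemma in_p_grade e x : in_p i x -> in_p i (grade e x).
Proof. by move=> px a b ia ib; rewrite mxE px //; case: ifP. Qed.

Section Step.
Variables (x nu z : 'M[F]_n) (e : int).
Hypothesis x_hi : forall a b, e < f a - f b -> x a b = 0.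
Hypothesis nu_hi : forall a b, e <= f a - f b -> nu a b = 0.
Hypothesis eqn : S *m x - x *m S = nu *m S + z.

Lemma mulSx_top a b : f a - f b = e - 1 ->
  (S *m x) a b = x a b + (J *m grade e x) a b.
Proof.
move=> ab; rewrite mxE [in RHS]mxE.
rewrite -[X in _ = X + _](sum_delta a (fun c => x c b)) -big_split /=.
apply: eq_bigr => c _; rewrite !mxE.
have [ac|ac|ac] := ltgtP (f a - f c) 0.
- have /negPf -> : c != a.
    by apply/eqP => ca; move: ac; rewrite ca subrr ltxx.
  rewrite mul0r add0r; case: eqP => ac1.
    by rewrite (_ : f c - f b == e) //; apply/eqP; lia.
  by rewrite x_hi ?mulr0 ?mul0r //; lia.
- rewrite S_pos // mul0r; have /negPf -> : c != a.
    by apply/eqP => ca; move: ac; rewrite ca subrr ltxx.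
  by rewrite mul0r add0r; case: ifP; rewrite mul0r.
- by rewrite S_zero // [c == a]eq_sym ac /= mul0r addr0.
Qed.

Lemma mulxS_top a b : f a - f b = e - 1 ->
  (x *m S) a b = x a b + (grade e x *m J) a b.
Proof.
move=> ab; rewrite mxE [in RHS]mxE.
rewrite -[X in _ = X + _](sum_deltar b (fun c => x a c)) -big_split /=.
apply: eq_bigr => c _; rewrite !mxE.
have [ac|ac|ac] := ltgtP (f c - f b) 0.
- have /negPf -> : c != b.
    by apply/eqP => ca; move: ac; rewrite ca subrr ltxx.
  rewrite mulr0 add0r; case: eqP => ac1; last first.
    by case: eqP => // ac2; rewrite x_hi ?mulr0 ?mul0r //; lia.
  case: eqP => // ac2; rewrite [x a c]x_hi ?mul0r //; lia.
- rewrite S_pos // mulr0; have /negPf -> : c != b.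
    by apply/eqP => ca; move: ac; rewrite ca subrr ltxx.
  by rewrite mulr0 add0r; case: ifP; rewrite ?mulr0; case: ifP; rewrite ?mulr0.
- by rewrite S_zero // ac /= mulr0 addr0.
Qed.

Lemma mulnuS_top a b : f a - f b = e - 1 -> (nu *m S) a b = nu a b.
Proof.
move=> ab; rewrite mxE -[RHS](sum_deltar b (fun c => nu a c)).
apply: eq_bigr => c _.
have [ac|ac|ac] := ltgtP (f c - f b) 0.
- by rewrite nu_hi ?mul0r //; lia.
- rewrite S_pos // mulr0; have /negPf -> : c != b.
    by apply/eqP => ca; move: ac; rewrite ca subrr ltxx.
  by rewrite mulr0.
- by rewrite S_zero.
Qed.

(** In degree e - 1 the identity part of [S] drops out of the commutator, and a part of [S] below
    [J] would need a component of [x] above degree e; only [J, x_e] is left. On the right, [nu S]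
    reduces to [nu] because [nu] lives below degree e. *)
Lemma lbrJ_top a b : lbr J (grade e x) a b =
  if f a - f b == e - 1 then nu a b + z a b else 0.
Proof.
case: eqP => ab.
  have := congr1 (fun u : 'M[F]_n => u a b) eqn.
  rewrite /= mxE [X in _ + X]mxE [in RHS]mxE mulnuS_top // => <-.
  by rewrite mulSx_top // mulxS_top // lbrE opprD addrACA subrr add0r.
rewrite lbrE !mxE !big1 ?subrr // => c _; rewrite !mxE.
  by case: eqP => h1; case: eqP => h2; rewrite ?mulr0 ?mul0r //; lia.
by case: eqP => h1; case: eqP => h2; rewrite ?mulr0 ?mul0r //; lia.
Qed.

End Step.

(** As long as [z] does not contribute, the top component of [x] satisfies [J, -] in n, so it
    vanishes by the Frobenius property, and then the next component of [nu] vanishes as well. The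
    second conclusion reads off the first degree in which [z] may appear. *)
Lemma filtration x nu (z : 'M[F]_n) (d : int) : in_p i x -> \tr x = 0 -> in_n i nu ->
  S *m x - x *m S = nu *m S + z -> (forall a b, d < f a - f b -> z a b = 0) ->
  (forall a b, d + 1 < f a - f b -> x a b = 0) /\
  in_n i (lbr J (grade (d + 1) x) - grade d z).
Proof.
move=> px tx nnu eqn zd; have [N hN] := degree_bound f.
(* [m] counts the steps down from [N], a strict bound on all degrees; at each stage [nu] is
   controlled one degree further than [x]. *)
have main : forall (m : nat) (e : int), d + 1 <= e -> Posz N <= e + Posz m ->
    (forall a b, e < f a - f b -> x a b = 0) /\
    (forall a b, e <= f a - f b -> nu a b = 0).
  elim=> [|m IH] e de Nem.
    by split=> a b ab; have := hN a b; lia.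
  have [||xh nh] := IH (e + 1); try lia.
  have eJ := lbrJ_top xh nh eqn.
  have comp0 : grade (e + 1) x = 0.
    apply: frobenius0; [exact: in_p_grade | | exact: trace_grade].
    move=> a b ab; rewrite eJ; case: eqP => // abe.
    by rewrite nnu // zd ?addr0 //; lia.
  split=> a b ab.
    case: (ltP (e + 1) (f a - f b)) => abe; first exact: xh.
    have := congr1 (fun u : 'M[F]_n => u a b) comp0; rewrite /= !mxE.
    by rewrite (_ : f a - f b == e + 1) //; apply/eqP; lia.
  case: (leP (e + 1) (f a - f b)) => abe; first exact: nh.
  have := eJ a b; rewrite comp0 (_ : f a - f b == e + 1 - 1); last first.
    by apply/eqP; lia.
  by rewrite /lbr mulmx0 mul0mx subrr mxE zd ?addr0 //; lia.
have [||xh nh] := main (absz (Posz N - (d + 1))%R) (d + 1); try lia.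
split=> // a b ab; rewrite mxE (lbrJ_top xh nh eqn) !mxE addrK.
by case: eqP => _; rewrite ?subrr // nnu // add0r subrr.
Qed.

End Filtration.

(* The pairs [(Rop r u + u/2, Rop r u - u/2)] sweep out the Lagrangian
   subalgebra [{(x, S^-1 (x + nu) S) : x in p, nu in n}] of sl_n x sl_n that
   encodes a solution [r] of the modified equation. *)
Definition lagrangian (F : fieldType) (n i : nat) (S : 'M[F]_n) (r : T2 F n) :=
  forall u : 'M[F]_n, \tr u = 0 ->
    in_p i (Rop r u + 2^-1 *: u) /\
    exists2 nu, in_n i nu &
      S *m (Rop r u + 2^-1 *: u - u) = (Rop r u + 2^-1 *: u + nu) *m S.

(** [K] is a scalar on the upper left block and the identity on the lower right one, so its
    commutator with [p] lies in [n]: it changes [nu] and nothing else. *)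
Lemma lagrangian_act (F : fieldType) (n i : nat) (S S' g K : 'M[F]_n) r (k : F) :
  g \in unitmx -> K \in unitmx -> in_p i g ->
  (forall a b : 'I_n, (i <= a)%N -> K a b = (a == b)%:R) ->
  (forall a b : 'I_n, (a < i)%N -> (b < i)%N -> K a b = k * (a == b)%:R) ->
  K *m g *m S = S' *m g ->
  lagrangian i S r -> lagrangian i S' (act g r).
Proof.
move=> ug uK pg Klow Kup SS' lag u tu; rewrite Rop_act //.
set u0 := conjmx (invmx g) u.
have tu0 : \tr u0 = 0 by rewrite /u0 trace_conjmx ?unitmx_inv.
have [px [nu nnu eqn]] := lag _ tu0.
set x0 := Rop r u0 + _ in px eqn.
have uE : u = conjmx g u0 by rewrite mxconjK.
have xE : conjmx g (Rop r u0) + 2^-1 *: u = conjmx g x0.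
  by rewrite uE -mxconjZ -mxconjD.
rewrite xE; have pgi := in_p_inv ug pg.
have pK : in_p i K.
  move=> a b ia ib; rewrite Klow //; case: eqP => // ab.
  by move: ib; rewrite -ab ltnNge ia.
have pKi := in_p_inv uK pK.
have px1 : in_p i (conjmx g x0) by apply/in_pM => //; apply/in_pM.
split=> //.
have nK x : in_p i x -> in_n i (K *m x - x *m K).
  move=> ppx a b ab; apply/eqP; rewrite mxE [X in _ + X]mxE subr_eq0.
  case: (leqP i a) => ia.
    apply/eqP; transitivity (x a b).
      rewrite mxE -[RHS](sum_delta a (fun c => x c b)).
      by apply: eq_bigr => c _; rewrite Klow // eq_sym.
    rewrite mxE -[LHS](sum_deltar b (fun c => x a c)).
    apply: eq_bigr => c _; case: (ltnP c i) => ic.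
      by rewrite ppx ?mul0r.
    by rewrite Klow.
  have ib : (b < i)%N by move: ab; rewrite ia /= -ltnNge.
  apply/eqP; transitivity (k * x a b).
    rewrite mxE -[RHS](sum_delta a (fun c => k * x c b)).
    apply: eq_bigr => c _; case: (ltnP c i) => ic.
      by rewrite Kup // eq_sym mulrCA mulrA.
    by rewrite ppx ?mulr0.
  rewrite mxE -[LHS](sum_deltar b (fun c => k * x a c)).
  apply: eq_bigr => c _; case: (ltnP c i) => ic.
    by rewrite Kup // mulrCA mulrA.
  rewrite Klow //; case: eqP => [cb|_]; last by rewrite !mulr0.
  by move: ib; rewrite -cb ltnNge ic.
have pn := in_pD px (in_n_p nnu).
pose w := conjmx g (x0 + nu).
have pw : in_p i w by apply/in_pM => //; apply/in_pM.
(* With w = g (x0 + nu) g^-1 one has S' g (x0 - u0) g^-1 = K w K^-1 S'; the new [nu] is K w K^-1 - g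
   x0 g^-1, written so that membership in [n] is visible. *)
exists (conjmx g nu + (K *m w - w *m K) *m invmx K).
  apply: in_nD; first by apply/in_nMr => //; apply/in_nMl.
  by apply: in_nMr => //; apply: nK.
have -> : conjmx g x0 + (conjmx g nu + (K *m w - w *m K) *m invmx K) =
          K *m w *m invmx K.
  by rewrite addrA -mxconjD -/w mulmxBl mulmxK // addrC subrK.
have S'E : S' = K *m g *m S *m invmx g by rewrite SS' mulmxK.
rewrite {1}uE -mxconjB /conjmx S'E !mulmxA !(mulmxKV ug).
rewrite -[_ *m (x0 - u0)]mulmxA eqn /w /conjmx !mulmxA !(mulmxKV uK).
by rewrite !(mulmxKV ug).
Qed.

(** * Homogeneous components of a tensor *)

Section Components.
Variables (F : fieldType) (n : nat) (f : 'I_n -> int) (r : T2 F n).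

Definition degree_part (e : int) : T2 F n :=
  [ffun x : I2 n => let: (a, b, c, d) := x in
     if f a - f b + (f c - f d) == e then r x else 0].

Lemma partE e a b c d : degree_part e (a, b, c, d) =
  if f a - f b + (f c - f d) == e then r (a, b, c, d) else 0.
Proof. by rewrite ffunE. Qed.

Lemma part_skew e : skew_tensor r -> skew_tensor (degree_part e).
Proof.
move=> sk a b c d; rewrite !partE [f c - f d + _]addrC.
by case: eqP => _; rewrite ?oppr0.
Qed.

(** Diagonal entries of a leg have degree 0, so taking a component either keeps or kills a partial
    trace as a whole. *)
Lemma part_trace e : (forall u, \tr (Rop r u) = 0) ->
  forall u, \tr (Rop (degree_part e) u) = 0.
Proof.
move=> tr0 u; rewrite Rop_sumE raddf_sum big1 //= => d _.
rewrite raddf_sum big1 //= => c _; rewrite mxtraceZ.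
suff -> : \tr (Rop (degree_part e) (E F d c)) = 0 by rewrite mulr0.
rewrite /mxtrace; under eq_bigr => a _ do rewrite Rop_E partE subrr add0r.
case: eqP => _; last by rewrite big1.
by rewrite -[RHS](tr0 (E F d c)); apply: eq_bigr => a _; rewrite Rop_E.
Qed.

End Components.

(** * Yang-Baxter equation, degree bound and boundary component from the Lagrangian subalgebra *)

Section FromLagrangian.
Variables (F : fieldType) (n i : nat) (f : 'I_n -> int) (S : 'M[F]_n).
Variable r : T2 F n.
Hypothesis char0 : [pchar F] =i pred0.
Hypothesis n_gt0 : (0 < n)%N.
Hypothesis S_pos : forall a b, 0 < f a - f b -> S a b = 0.
Hypothesis S_zero : forall a b, f a - f b = 0 -> S a b = (a == b)%:R.
Let J := grade f (-1) S.
Hypothesis frobenius :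
  forall x, in_p i x -> in_n i (lbr J x) -> exists k, x = k%:M.
Hypothesis lag : lagrangian i S r.
Hypothesis sk : skew_tensor r.
Hypothesis tr0 : forall u, \tr (Rop r u) = 0.
Implicit Types (u v w x : 'M[F]_n).

Let filt := filtration char0 n_gt0 S_pos S_zero frobenius.

Lemma two_neq0 : 2%:R != 0 :> F. Proof. exact: char0_natr_neq0. Qed.

(** The encoding pairs are closed under brackets and, by descent, a pair is determined by the
    difference of its members. Comparing the bracket of two pairs with the pair of the same
    difference gives the equation; the constant is minus the square of 1/2. *)
Lemma lagrangian_mcybe : mcybe (- 4^-1) r.
Proof.
suff main u v : \tr u = 0 -> \tr v = 0 ->
    lbr (Rop r u) (Rop r v) - Rop r (lbr u (Rop r v) + lbr (Rop r u) v) =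
    - 4^-1 *: lbr u v.
  move=> u v; have := main _ _ (slproj_traceless char0 u n_gt0)
    (slproj_traceless char0 v n_gt0).
  rewrite !Rop_slproj // /slproj !lbrBl !lbrBr !lbr_scalar !subr0.
  by rewrite ![lbr _ (_%:M)]lbrC !lbr_scalar oppr0 !subr0.
move=> tu tv.
have [pxu [nu nnu eu]] := lag tu; have [pxv [nv nnv ev]] := lag tv.
set x := Rop r u + _ in pxu eu; set y := Rop r v + _ in pxv ev.
set z := lbr u (Rop r v) + lbr (Rop r u) v.
have tz : \tr z = 0 by rewrite raddfD /= !trace_lbr addr0.
have [pxz [nz nnz ez]] := lag tz; set X := Rop r z + _ in pxz ez.
(* The bracket ([x, y], [x - u, y - v]) of the two pairs has difference [z], the very argument at
   which R is evaluated. *)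
have zE : lbr x y - lbr (x - u) (y - v) = z.
  rewrite lbrBl !lbrBr opprB /x /y !lbrDl !lbrDr !lbrZl !lbrZr /z.
  apply/matrixP => a b; rewrite !mxE.
  by field; exact: two_neq0.
have ey : S *m lbr (x - u) (y - v) = lbr (x + nu) (y + nv) *m S.
  rewrite /lbr mulmxBr [RHS]mulmxBl; congr (_ - _).
    by rewrite mulmxA eu -!mulmxA ev.
  by rewrite mulmxA ev -!mulmxA eu.
pose nn := lbr (x + nu) (y + nv) - lbr x y.
have nnn : in_n i nn.
  rewrite /nn (lbrDl x nu) (lbrDr y nv x) (lbrDr y nv nu) addrAC [lbr x y + _]addrC addrK.
  apply: in_nD; first exact: in_n_lbr.
  rewrite ![lbr nu _]lbrC; apply: in_nD; apply: in_nN; apply: in_n_lbr => //.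
  exact: in_n_p.
(* The pair of [z] and the bracket pair have the same difference, so their first members differ by a
   traceless element of [p] that commutes with [S] modulo [n S]. *)
have D0 : X - lbr x y = 0.
  have pD : in_p i (X - lbr x y) by apply: in_pB => //; apply: in_p_lbr.
  have tD : \tr (X - lbr x y) = 0.
    by rewrite raddfB raddfD /= mxtraceZ tr0 tz trace_lbr mulr0 addr0 subrr.
  have eD : S *m (X - lbr x y) - (X - lbr x y) *m S = (nz - nn) *m S + 0.
    have DE : X - lbr x y = (X - z) - lbr (x - u) (y - v).
      rewrite -zE; move: (lbr x y) (lbr _ _) => A B.
      by apply/matrixP => a b; rewrite !mxE; ring.
    rewrite {1}DE mulmxBr ez ey -[lbr (x + nu) _](subrK (lbr x y)) -/nn.
    rewrite -!mulmxBl addr0; congr (_ *m _).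
    by apply/matrixP => a b; rewrite !mxE; ring.
  have [N hN] := degree_bound f.
  (* The right-hand side is zero, so [d] may be taken below every degree that occurs, and all
     entries are covered. *)
  have [D0 _] := filt (d := - Posz N - 1) pD tD (in_nB nnz nnn) eD
    (fun a b _ => mxE _ _ a b).
  apply/matrixP => a b; rewrite D0 ?mxE //.
  by have := hN b a; lia.
have XE := subr0_eq D0.
apply/matrixP => a b; have := congr1 (fun u : 'M[F]_n => u a b) XE.
have -> : Rop r z = lbr x y - 2^-1 *: z by rewrite -XE /X addrK.
move=> _; rewrite /x /y !lbrDl !lbrDr !lbrZl !lbrZr /z !mxE.
by field; rewrite two_neq0 (char0_natr_neq0 char0).
Qed.

(** The scalar correction is nonzero only for [d = c], where the matrix unit itself has degree 0. *)
Lemma slproj_deg (d c a b : 'I_n) : f a - f b != f d - f c ->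
  slproj (E F d c) a b = 0.
Proof.
move=> ne; rewrite mxE [X in _ + X]mxE [(_%:M) a b]mxE.
have -> : \tr (E F d c) = (d == c)%:R.
  rewrite /mxtrace -(sum_delta c (fun l => (d == l)%:R)).
  by apply: eq_bigr => l _; rewrite mxE -mulnb natrM mulrC [l == d]eq_sym.
rewrite mxE; have /negPf -> : ~~ ((a == d) && (b == c)) by apply: contra ne => /andP[/eqP-> /eqP->].
case: (eqVneq a b) ne => [->|_ _]; last by rewrite mulr0n subr0.
case: (eqVneq d c) => [->|_ _]; first by rewrite !subrr eqxx.
by rewrite mul0r mul0rn subr0.
Qed.

Section Basis.
Variables d c : 'I_n.
Let u := slproj (E F d c).
Let x := Rop r u + 2^-1 *: u.

Lemma basis_eqn : [/\ in_p i x, \tr x = 0 &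
  exists2 nu, in_n i nu & S *m x - x *m S = nu *m S + S *m u].
Proof.
have tu : \tr u = 0 by exact: slproj_traceless.
have [px [nu nnu eqn]] := lag tu; split => //.
  by rewrite /x raddfD /= mxtraceZ tr0 tu mulr0 addr0.
exists nu => //; move: eqn; rewrite -/x mulmxBr mulmxDl => /(canRL (subrK _)) ->.
by rewrite [x *m S + _]addrC addrAC addrK.
Qed.

Lemma mulS_deg a b : f d - f c < f a - f b -> (S *m u) a b = 0.
Proof.
move=> ab; rewrite mxE big1 // => k _.
case: (eqVneq (f k - f b) (f d - f c)) => kb; last by rewrite slproj_deg ?mulr0.
by rewrite S_pos ?mul0r //; lia.
Qed.

Lemma grade_mulS : grade f (f d - f c) (S *m u) = u.
Proof.
apply/matrixP => a b; rewrite mxE; case: eqP => ab; last first.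
  by rewrite slproj_deg //; apply/eqP.
rewrite mxE -[RHS](sum_delta a (fun k => u k b)); apply: eq_bigr => k _.
case: (eqVneq (f k - f b) (f d - f c)) => kb; last first.
  by rewrite slproj_deg ?mulr0.
by rewrite S_zero 1?eq_sym //; lia.
Qed.

(** Descent with right-hand side S u, whose degree is at most that of [u], leaves room for one more
    degree in [x]. *)
Lemma lagrangian_degree_basis a b : 1 < f a - f b + (f c - f d) ->
  r (a, b, c, d) = 0.
Proof.
move=> ab; have [px tx [nu nnu eqn]] := basis_eqn.
have [xh _] := filt px tx nnu eqn mulS_deg.
have <- : x a b = r (a, b, c, d).
  rewrite /x mxE [X in _ + X = _]mxE Rop_slproj // Rop_E.
  by rewrite slproj_deg ?mulr0 ?addr0 //; apply/eqP; lia.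
by apply: xh; lia.
Qed.

Lemma part1_basis :
  Rop (degree_part f r 1) (E F d c) = grade f (f d - f c + 1) x.
Proof.
apply/matrixP => a b; rewrite Rop_E partE mxE.
have -> : (f a - f b + (f c - f d) == 1) = (f a - f b == f d - f c + 1).
  by apply/eqP/eqP; lia.
case: eqP => // ab; rewrite /x mxE [X in _ + X]mxE Rop_slproj // Rop_E.
by rewrite (slproj_deg (a := a)) ?mulr0 ?addr0 //; apply/eqP; lia.
Qed.

Lemma boundary_basis : in_p i (Rop (degree_part f r 1) (E F d c)) /\
  in_n i (lbr J (Rop (degree_part f r 1) (E F d c)) - u).
Proof.
have [px tx [nu nnu eqn]] := basis_eqn.
have [_ xn] := filt px tx nnu eqn mulS_deg.
by rewrite part1_basis -{1}grade_mulS; split => //; apply: in_p_grade.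
Qed.

End Basis.

Lemma boundary_eqn u : in_p i (Rop (degree_part f r 1) u) /\
  in_n i (lbr J (Rop (degree_part f r 1) u) - slproj u).
Proof.
rewrite Rop_sumE [X in slproj X](mx_sumE u) slproj_sum lbr_sumr -sumrB.
split; first by apply: in_p_sum => d; apply: in_p_sum => c;
  apply: in_pZ; have [] := boundary_basis d c.
apply: in_n_sum => d; rewrite slproj_sum lbr_sumr -sumrB.
apply: in_n_sum => c; rewrite slprojZ lbrZr -scalerBr.
by apply: in_nZ; have [] := boundary_basis d c.
Qed.

(** Both sides are traceless elements of [p] with the same image under [J, -] modulo [n], and the
    Frobenius property makes such an element unique. *)
Lemma boundary_inv M : in_p i M -> \tr M = 0 ->
  Rop (degree_part f r 1) (lbr J M) = M.
Proof.
move=> pM tM; have [pB nB] := boundary_eqn (lbr J M).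
apply: subr0_eq; apply: (frobenius0 char0 n_gt0 frobenius).
- exact: in_pB.
- by move: nB; rewrite slproj_id ?trace_lbr // lbrBr.
- by rewrite raddfB /= part_trace // tM subrr.
Qed.

End FromLagrangian.

(** * The Cremmer-Gervais tensor *)

Section Prec.
Local Open Scope nat_scope.
Variables (i n : nat).
Hypothesis i_gt0 : (0 < i)%N.
Hypothesis i_ltn : (i < n)%N.
Hypothesis co_in : coprime i n.

(** The exception is the zeroth iterate, which is [j] itself and not its residue. *)
Lemma iter_Tmap m j : iter m (Tmap i n) j = (j + m * i) %% n \/ m = 0%N.
Proof.
case: m => [|m]; [by right | left].
elim: m => [|m IH]; first by rewrite mul1n.
by rewrite iterS IH /Tmap modnDml [m.+2 * i]mulSn [i + _]addnC addnA.
Qed.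

Lemma prec_S1 c l : prec i n c l -> S1 i n c.
Proof. by case=> N [N0 h _]; apply: (h 0). Qed.

Lemma precS c l : S1 i n c ->
  prec i n c l <-> Tmap i n c = l \/ prec i n (Tmap i n c) l.
Proof.
move=> Sc; split.
  case=> -[|[|N]] [] // _ h e; first by left.
  right; exists N.+1; split => // [m mN|]; last by rewrite -iterSr.
  by rewrite -iterSr; apply: h.
case=> [<-|[N [N0 h e]]].
  by exists 1%N; split => // -[|//] _.
exists N.+1; split => //; last by rewrite iterSr.
by case=> [//|m] mN; rewrite iterSr; apply: h.
Qed.

Lemma Tmap_inj j k : (j < n)%N -> (k < n)%N -> Tmap i n j = Tmap i n k -> j = k.
Proof.
move=> jn kn /eqP; rewrite /Tmap eqn_modDr => /eqP.
by rewrite !modn_small.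
Qed.

Lemma S1_lt j : S1 i n j -> (j < n)%N.
Proof. by case/and3P=> ? ? _; lia. Qed.

Lemma prec_last c l : S1 i n l ->
  prec i n c (Tmap i n l) <-> c = l \/ prec i n c l.
Proof.
move=> Sl; split.
  case=> -[|N] [] // _ h; rewrite iterS => e.
  have eN : iter N (Tmap i n) c = l.
    by apply: Tmap_inj e; apply: S1_lt => //; apply: h.
  case: N h e eN => [|N] h e eN; first by left.
  by right; exists N.+1; split => // m mN; apply: h; apply: ltnW.
case=> [->|[N [N0 h e]]].
  by exists 1%N; split => // -[|//] _.
exists N.+1; split => //; last by rewrite iterS e.
move=> m; rewrite ltnS leq_eqVlt => /orP[/eqP->|]; first by rewrite e.
exact: h.
Qed.

(** Only the residue 0 is translated to [i], and 0 is not a simple root. *)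
Lemma prec_not_i c : ~ prec i n c i.
Proof.
case=> -[|N] [] // _ h; rewrite iterS => e.
have /and3P[] := h N (leqnn _); set z := iter _ _ _ in e * => z0 zn _.
have : z = 0 by apply: Tmap_inj; rewrite ?e /Tmap ?modn_small; lia.
by lia.
Qed.

(** Since [i] is coprime to [n], a cycle has length divisible by [n]; it would therefore pass
    through the residue 0, which lies outside [S1]. *)
Lemma prec_irr c : ~ prec i n c c.
Proof.
case=> N [N0 h e].
have cn : (c < n)%N by apply: S1_lt; apply: h N0.
have [e'|] := iter_Tmap N c; last by lia.
have dN : (n %| N)%N.
  have : c + N * i == c + 0 %[mod n] by rewrite addn0 -e' e modn_small.
  by rewrite eqn_modDl mod0n -/(dvdn _ _) Gauss_dvdl // coprime_sym.
have nN : (n <= N)%N by apply: dvdn_leq.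
(* With [w] an inverse of [i] modulo [n], [u] is the number of steps from [c] to 0. *)
have [u un /dvdnP[k uE]] : exists2 u, (u < n)%N & (n %| c + u * i)%N.
  have n0 : (0 < n)%N by lia.
  have [w wE] : exists w, w * i = 1 %[mod n].
    case: (egcdnP n i_gt0) => km kn e2 _; exists km.
    by rewrite e2 (eqP co_in) modnMDl.
  exists ((n - c) * w %% n)%N; first by rewrite ltn_pmod.
  rewrite /dvdn -modnDmr modnMml -mulnA -modnMmr wE modnMmr muln1 modnDmr.
  by rewrite subnKC ?modnn // ltnW.
have := h u (leq_trans un nN); have [->|u0] := iter_Tmap u c.
  by rewrite uE modnMl.
move: uE; rewrite u0 addn0 /= => ck /and3P[c0 _ _].
by case: k ck => [|k] ck; [lia | nia].
Qed.

(** The formula of [Tmap], but on 0-based matrix indices: the simple root k joins the indices k - 1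
    and k. *)
Definition tau a := (a + i) %% n.

Lemma tau_small a : a < n - i -> tau a = a + i.
Proof. by move=> ai; rewrite /tau modn_small //; lia. Qed.

Lemma tau_big a : n - i <= a -> a < n -> tau a = a + i - n.
Proof.
move=> ai an; rewrite /tau -{1}(subnK (_ : n <= a + i)); last by lia.
by rewrite modnDr modn_small //; lia.
Qed.

Lemma S1_small k : 0 < k -> k < n - i -> S1 i n k.
Proof. by move=> k0 kn; apply/and3P; split; [| |apply/eqP]; lia. Qed.

Lemma S1_big k : n - i < k -> k < n -> S1 i n k.
Proof. by move=> k0 kn; apply/and3P; split; [| |apply/eqP]; lia. Qed.

(** The order in 0-based indices; the larger root is written (d, c) because the relation is read off
    the coefficient of e_ab (x) e_cd. *)
Definition rho a b d c := rootprec i n a.+1 b.+1 d.+1 c.+1.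

Lemma rhoP a b d c : reflect
  [/\ a < b, d < c, c - d = b - a &
      forall s, s < b - a -> prec i n (a.+1 + s) (d.+1 + s)]
  (rho a b d c).
Proof.
rewrite /rho /rootprec !subSS !ltnS.
apply: (iffP and4P) => [[ab dc /eqP e /allP h]|[ab dc e h]]; split => //.
- by move=> s sb; apply/asboolP; apply: h; rewrite mem_iota.
- exact/eqP.
- by apply/allP => s; rewrite mem_iota => /h /asboolP.
Qed.

(** A root straddling n - i contains the simple root n - i, which is outside [S1]. *)
Lemma rho_cross1 a b d c : a < n - i -> n - i <= b -> rho a b d c = false.
Proof.
move=> an nb; apply/negP => /rhoP [ab dc e h].
have := prec_S1 (h (n - i - a.+1) _); rewrite /S1 subnKC //.
by rewrite eqxx !andbF => /(_ _)/negP; apply; lia.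
Qed.

(** A root straddling [i] contains the simple root [i], which has no predecessor. *)
Lemma rho_cross2 c d q p : q < i -> i <= p -> rho c d q p = false.
Proof.
move=> qi ip; apply/negP => /rhoP [ab dc e h].
have := h (i - q.+1); rewrite subnKC // => h'.
by apply: (@prec_not_i (c.+1 + (i - q.+1))); apply: h'; lia.
Qed.

Lemma rho_irr a b : rho a b a b = false.
Proof.
apply/negP => /rhoP [ab _ _ h]; apply: (@prec_irr (a.+1 + 0)); apply: h; lia.
Qed.

(** An interval of indices on one side of the cut at n - i is translated rigidly, by i or by i -
    n. *)
Lemma tau_cut a b s : a < b -> b < n -> (b < n - i) || (n - i <= a) ->
  s < b - a -> [/\ S1 i n (a.+1 + s), Tmap i n (a.+1 + s) = (tau a).+1 + s,
                  tau a < tau b & tau b - tau a = b - a].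
Proof.
move=> ab bn /orP[bi|ai] sb.
  rewrite !tau_small; try lia; split; [apply: S1_small| | |]; try lia.
  by rewrite /Tmap modn_small; lia.
rewrite !tau_big; try lia; split; [apply: S1_big| | |]; try lia.
by rewrite -[LHS]/(tau (a.+1 + s)) tau_big; lia.
Qed.

(** A chain starting at e_ab stops after its first step or goes on; irreflexivity makes the two
    exclusive, whence a sum of numbers instead of a disjunction. *)
Lemma rho_front a b d c : a < b -> b < n -> (b < n - i) || (n - i <= a) ->
  (rho a b d c : nat) = rho (tau a) (tau b) d c + ((tau a == d) && (tau b == c)).
Proof.
move=> ab bn nc; have tc s := tau_cut ab bn nc (s := s).
have [_ _ tab tba] : [/\ true, true, tau a < tau b & tau b - tau a = b - a].
  by have [|_ _ ? ?] := tc 0; [lia | split].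
case: (boolP (_ && _)) => [/andP[/eqP <- /eqP <-]|ne].
  rewrite rho_irr; suff -> : rho a b (tau a) (tau b) by [].
  apply/rhoP; split => // s sb; have [Ss Ts _ _] := tc s sb.
  by rewrite precS // Ts; left.
rewrite addn0; congr nat_of_bool; apply/rhoP/rhoP; last first.
  move=> [_ dc e h]; split => //; first by rewrite e.
  move=> s sb; have [Ss Ts _ _] := tc s sb; rewrite precS // Ts; right.
  by apply: h; rewrite tba.
move=> [_ dc e h]; split => //; first by rewrite tba.
rewrite tba => s sb; have [Ss Ts _ _] := tc s sb.
have := h s sb; rewrite precS // Ts => -[e2|//].
by move: ne; rewrite (_ : tau a = d) ?eqxx /=; [case/eqP; lia | lia].
Qed.

(** Mirror image of [rho_front]: the last step of the chain is removed. *)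
Lemma rho_back c d p q : p < q -> q < n -> (q < n - i) || (n - i <= p) ->
  (rho c d (tau p) (tau q) : nat) = rho c d p q + ((p == c) && (q == d)).
Proof.
move=> ab bn nc; have tc s := tau_cut ab bn nc (s := s).
have [_ _ tab tba] : [/\ true, true, tau p < tau q & tau q - tau p = q - p].
  by have [|_ _ ? ?] := tc 0; [lia | split].
case: (boolP (_ && _)) => [/andP[/eqP <- /eqP <-]|ne].
  rewrite rho_irr; suff -> : rho p q (tau p) (tau q) by [].
  apply/rhoP; split => // s sb; have [Ss Ts _ _] := tc s sb.
  by rewrite -Ts prec_last //; left.
rewrite addn0; congr nat_of_bool; apply/rhoP/rhoP; last first.
  move=> [cd _ e h]; split => //; first by rewrite tba.
  move=> s sb; have [|Ss Ts _ _] := tc s; first by lia.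
  by rewrite -Ts prec_last //; right; apply: h.
move=> [cd _ e h]; split => //; first by rewrite -tba.
move=> s sb; have [|Ss Ts _ _] := tc s; first by lia.
have := h s sb; rewrite -Ts prec_last // => -[e2|//].
by move: ne; rewrite (_ : p = c) ?eqxx /=; [case/eqP; lia | lia].
Qed.

(** A step that wraps around lands strictly between 0 and i, so a multiple of [i] is reached only
    from a multiple of [i]. *)
Lemma prec_dvd c l : prec i n c l -> i %| l -> i %| c.
Proof.
case=> N [N0 h <-]; elim: N {N0} h => [//|N IH] h.
rewrite iterS => dT; apply: IH; first by move=> m mN; apply: h; lia.
have /and3P[] := h N (leqnn _); move: dT; set k := iter _ _ _ => dT k0 kn kni.
case: (ltnP k (n - i)) => ki; move: dT.
  by rewrite -[Tmap _ _ _]/(tau k) tau_small // dvdn_addl.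
rewrite -[Tmap _ _ _]/(tau k) tau_big //; last by lia.
by move/dvdn_leq; move/eqP: kni; lia.
Qed.

Lemma hqS k : hq i k.+1 = if i %| k.+1 then (hq i k - Posz i)%R else (hq i k + 1)%R.
Proof.
rewrite /hq; case: ifP => dk.
  have [m mE] := dvdnP dk; rewrite mE modnMl mulnK //.
  have -> : k = m.-1 * i + i.-1 by case: m mE => [|m] mE; nia.
  rewrite modnMDl divnMDl // modn_small ?divn_small; try lia.
  case: m mE => [|m] mE; first by lia.
  by rewrite /= ; lia.
have ks : (k %% i).+1 < i.
  rewrite ltn_neqAle ltn_pmod // andbT; apply/eqP => e.
  by move: dk; rewrite (divn_eq k i) -addnS e dvdn_addr ?dvdn_mull ?dvdnn.
have -> : k.+1 = k %/ i * i + (k %% i).+1 by rewrite addnS -divn_eq.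
rewrite modnMDl divnMDl // modn_small // (divn_small ks); lia.
Qed.

(** By [hqS] the simple root k has degree i when i divides k and -1 otherwise; by [prec_dvd] the
    larger root contains no new multiples of [i]. This keeps alpha out of negative degrees. *)
Lemma rho_deg a b d c : rho a b d c ->
  (hq i d - hq i c <= hq i a - hq i b)%R.
Proof.
case/rhoP => ab dc e h.
have -> : b = a + (b - a) by lia.
have -> : c = d + (b - a) by lia.
have {h} : forall s, s < b - a -> i %| d.+1 + s -> i %| a.+1 + s.
  by move=> s sb; apply: prec_dvd; apply: h.
elim: (b - a) => [|L IH] h; first by rewrite !addn0 !subrr.
have := IH (fun s sL => h s (leqW sL)); have := h L (leqnn _).
rewrite !addnS !hqS !addSn.
case: ifP => dd; first by move=> -> //; lia.
by move=> _; case: ifP; lia.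
Qed.

End Prec.

(** * Coefficients of rCG and its Lagrangian subalgebra *)

Section CremmerGervais.
Variables (F : fieldType) (i n : nat).
Hypothesis char0 : [pchar F] =i pred0.
Hypothesis i_gt0 : (0 < i)%N.
Hypothesis i_ltn : (i < n)%N.
Hypothesis co_in : coprime i n.

Lemma iinvP : (iinv i n * i = 1 %[mod n])%N.
Proof.
have n1 : (1 < n)%N by lia.
have : ((iinv i n * i)%:R : 'Z_n) = 1%:R.
  by rewrite natrM natr_Zp mulVr // unitZpE // coprime_sym.
by move/(congr1 val); rewrite /= val_Zp_nat // Zp_cast.
Qed.

(** The number of steps of [tau] from [c] to [a], that is (a - c) / i modulo [n], as it occurs in
    beta; [n - c] avoids a truncated subtraction. *)
Definition cshift a c := ((n - c + a) * iinv i n %% n)%N.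

Lemma cshift_lt a c : (cshift a c < n)%N.
Proof. by rewrite ltn_pmod //; lia. Qed.

Lemma cshift_eq0 a c : (a < n)%N -> (c < n)%N -> (cshift a c == 0%N) = (a == c).
Proof.
move=> an cn; apply/eqP/eqP => [|->]; last first.
  by rewrite /cshift subnK ?modnMr ?modnMl //; lia.
rewrite /cshift => h.
have : ((n - c + a) = 0 %[mod n])%N.
  rewrite -[(n - c + a)%N]muln1 -modnMmr -iinvP modnMmr mulnA.
  by rewrite -modnMml h mul0n.
rewrite mod0n; case: (leqP c a) => ca.
  rewrite (_ : (n - c + a = n + (a - c))%N); last by lia.
  by rewrite modnDl modn_small; lia.
by rewrite modn_small; lia.
Qed.

Lemma cshift_tau a c : (c < n)%N ->
  cshift (tau i n a) c = ((cshift a c).+1 %% n)%N.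
Proof.
move=> cn; transitivity (((n - c + a) * iinv i n + iinv i n * i) %% n)%N.
  by rewrite /cshift /tau -modnMml modnDmr modnMml addnA mulnDl [(i * _)%N]mulnC.
by rewrite -modnDmr iinvP modnDmr /cshift -[in RHS]addn1 modnDml.
Qed.

Lemma cshift_sym a c : (a < n)%N -> (c < n)%N -> a != c ->
  (cshift a c + cshift c a = n)%N.
Proof.
move=> an cn ac.
have : (cshift a c + cshift c a = 0 %[mod n])%N.
  rewrite /cshift modnDml modnDmr -mulnDl.
  rewrite (_ : (n - c + a + (n - a + c) = 2 * n)%N); last by lia.
  by rewrite mulnAC modnMl mod0n.
have h1 := cshift_lt a c; have h2 := cshift_lt c a.
have := cshift_eq0 an cn; rewrite (negPf ac) => /eqP h3.
rewrite mod0n; case: (ltnP (cshift a c + cshift c a) n) => h.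
  by rewrite modn_small; lia.
by rewrite -{1}(subnK h) modnDr modn_small; lia.
Qed.

Lemma betacoefE a c : (c <= n)%N ->
  betacoef F i n a.+1 c.+1 = -1 + 2%:R / n%:R * (cshift a c)%:R.
Proof.
move=> cn; rewrite /betacoef; congr (_ + _ * _).
have -> : (Posz a.+1 - Posz c.+1) * Posz (iinv i n) =
   (- Posz (iinv i n)) * Posz n + Posz ((n - c + a) * iinv i n)%N by nia.
by rewrite modzMDl modz_nat.
Qed.

(** One formula serves both orders of [a] and [c] because the two shifts add up to [n] off the
    diagonal; the half identity fits the diagonal to it up to a Kronecker delta. *)
Lemma half_betacoef a c : (a < n)%N -> (c < n)%N ->
  2^-1 * ((a < c)%N%:R * betacoef F i n a.+1 c.+1 -
          (c < a)%N%:R * betacoef F i n c.+1 a.+1) + 2^-1 * (a == c)%:R =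
  - 2^-1 + (cshift a c)%:R / n%:R + (a == c)%:R :> F.
Proof.
move=> an cn; have n0 : n%:R != 0 :> F by apply: char0_natr_neq0 => //; lia.
have two0 : 2%:R != 0 :> F by apply: char0_natr_neq0.
rewrite !betacoefE ?(ltnW an) ?(ltnW cn) //.
have := cshift_eq0 an cn; case: (ltngtP a c) => [ac|ac|->] /=.
- by move=> _; field; rewrite n0 two0.
- move=> _; have := cshift_sym an cn; rewrite neq_ltn ac orbT => /(_ isT) h.
  have -> : (cshift c a)%:R = n%:R - (cshift a c)%:R :> F.
    by apply/eqP; rewrite eq_sym subr_eq addrC -natrD h.
  by field; rewrite n0 two0.
- by move=> /eqP ->; field; rewrite n0 two0.
Qed.

Let cross1 := rho_cross1 i_gt0 i_ltn co_in.
Let cross2 := rho_cross2 i_gt0 i_ltn co_in.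
Let front := rho_front i_gt0 i_ltn co_in.
Let back := rho_back i_gt0 i_ltn co_in.
Let tauS := tau_small i_gt0 i_ltn co_in.
Let tauB := tau_big i_gt0 i_ltn co_in.
Local Notation rho := (rho i n).
Local Notation tau := (tau i n).

Lemma wedgeE (u v : 'M[F]_n) a b c d :
  wedge u v (a, b, c, d) = 2^-1 * (u a b * v c d - v a b * u c d).
Proof. by rewrite !ffunE. Qed.

Lemma sum4_delta (a b d c : 'I_n) (P : 'I_n -> 'I_n -> 'I_n -> 'I_n -> bool) :
  \sum_j \sum_k \sum_l \sum_(m | P j k l m) E F j k a b * E F m l c d =
  (P a b d c)%:R.
Proof.
have EE (p q j k : 'I_n) : E F j k p q = (j == p)%:R * (k == q)%:R.
  by rewrite mxE ![_ == k]eq_sym ![_ == j]eq_sym -natrM mulnb.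
transitivity (\sum_j \sum_k \sum_l \sum_m
   (j == a)%:R * ((k == b)%:R * ((l == d)%:R * ((m == c)%:R * (P j k l m)%:R))) : F).
  apply: eq_bigr => j _; apply: eq_bigr => k _; apply: eq_bigr => l _.
  rewrite big_mkcond; apply: eq_bigr => m _.
  by case: (P j k l m); rewrite ?mulr0 //= !EE mulr1; ring.
under eq_bigr => j _ do (under eq_bigr => k _ do
   (under eq_bigr => l _ do rewrite -!mulr_sumr sum_delta;
    rewrite -!mulr_sumr sum_delta); rewrite -!mulr_sumr sum_delta).
by rewrite sum_delta.
Qed.

Lemma alphaE (a b c d : 'I_n) :
  alpha F i n (a, b, c, d) = (rho a b d c)%:R - (rho c d b a)%:R.
Proof.
have two0 : 2%:R != 0 :> F by apply: char0_natr_neq0.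
rewrite ffunE sum_ffunE -(sum4_delta a b d c (fun j k l m => rho j k l m)).
rewrite -(sum4_delta c d b a (fun j k l m => rho j k l m)) -sumrB.
rewrite /GRing.scale /= mulr_sumr; apply: eq_bigr => j _.
rewrite sum_ffunE -sumrB mulr_sumr; apply: eq_bigr => k _.
rewrite sum_ffunE -sumrB mulr_sumr; apply: eq_bigr => l _.
rewrite sum_ffunE -sumrB mulr_sumr; apply: eq_bigr => m _.
by rewrite wedgeE mulrA mulfV // mul1r [E F j k c d * _]mulrC.
Qed.

Lemma betaE (a b c d : 'I_n) :
  beta F i n (a, b, c, d) = (a == b)%:R * (c == d)%:R *
  (2^-1 * ((a < c)%N%:R * betacoef F i n a.+1 c.+1 -
          (c < a)%N%:R * betacoef F i n c.+1 a.+1)).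
Proof.
have EE (p q j : 'I_n) : E F j j p q = (p == q)%:R * (j == p)%:R.
  rewrite mxE -natrM mulnb ![_ == j]eq_sym; case: (eqVneq j p) => [->|_].
    by rewrite /= andbT.
  by rewrite andbF.
rewrite sum_ffunE.
transitivity (\sum_(j < n) \sum_(l < n) (j < l)%N%:R * betacoef F i n j.+1 l.+1 *
   ((a == b)%:R * (c == d)%:R * 2^-1) *
   ((j == a)%:R * (l == c)%:R - (l == a)%:R * (j == c)%:R)).
  apply: eq_bigr => j _; rewrite sum_ffunE big_mkcond; apply: eq_bigr => l _.
  case: (_ < _)%N; last by rewrite !mul0r.
  rewrite mul1r.
  by rewrite ffunE wedgeE !EE /GRing.scale /=; ring.
under eq_bigr => j _ do under eq_bigr => l _ do rewrite mulrBr.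
under eq_bigr => j _ do rewrite sumrB.
rewrite sumrB.
under eq_bigr => j _ do (under eq_bigr => l _ do rewrite mulrA; rewrite sum_deltar).
rewrite sum_deltar exchange_big.
under [X in _ - X]eq_bigr => l _ do
  (under eq_bigr => j _ do rewrite mulrA; rewrite sum_deltar).
by rewrite sum_deltar; ring.
Qed.

Lemma gammaE (a b c d : 'I_n) :
  gamma F n (a, b, c, d) = (a == d)%:R * (b == c)%:R *
  (2^-1 * ((a < b)%N%:R - (b < a)%N%:R)).
Proof.
have EE (p q j k : 'I_n) : E F j k p q = (j == p)%:R * (k == q)%:R.
  by rewrite mxE ![_ == k]eq_sym ![_ == j]eq_sym -natrM mulnb.
rewrite sum_ffunE.
transitivity (\sum_(j < n) \sum_(l < n) (j < l)%N%:R * 2^-1 *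
   ((l == b)%:R * (l == c)%:R * (j == d)%:R * (j == a)%:R -
    (l == d)%:R * (l == a)%:R * (j == c)%:R * (j == b)%:R) : F).
  apply: eq_bigr => j _; rewrite sum_ffunE big_mkcond; apply: eq_bigr => l _.
  case: (_ < _)%N; last by rewrite !mul0r.
  rewrite mul1r.
  by rewrite wedgeE !EE; ring.
rewrite exchange_big.
under eq_bigr => l _ do under eq_bigr => j _ do rewrite mulrBr !mulrA.
under eq_bigr => l _ do rewrite sumrB !sum_deltar.
rewrite sumrB.
rewrite (bigD1 b) //= [X in _ + X - _]big1 ?addr0; last first.
  by move=> l /negPf ->; rewrite !mulr0 !mul0r.
rewrite (bigD1 a) //= [X in _ - (_ + X)]big1 ?addr0; last first.
  by move=> l /negPf ->; rewrite !(mulr0, mul0r).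
by rewrite !eqxx /= !mulr1; ring.
Qed.

Lemma rCGE (a b c d : 'I_n) :
  rCG F i n (a, b, c, d) =
  alpha F i n (a, b, c, d) + beta F i n (a, b, c, d) + gamma F n (a, b, c, d).
Proof. by rewrite ffunE [X in X + _]ffunE. Qed.

Lemma rCG_skew : skew_tensor (rCG F i n).
Proof.
move=> a b c d; rewrite !rCGE !alphaE !betaE !gammaE.
rewrite [c == b]eq_sym [d == a]eq_sym [a == d]eq_sym.
case: (eqVneq b c) => [<-|_]; case: (eqVneq d a) => [->|_] /=; ring.
Qed.

Lemma rCG_halfE (a b c d : 'I_n) :
  rCG F i n (a, b, c, d) + 2^-1 * E F d c a b =
  (rho a b d c)%:R - (rho c d b a)%:R + [&& a == d, b == c & (a < b)%N]%:R +
  (a == b)%:R * (c == d)%:R *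
  (- 2^-1 + (cshift a c)%:R / n%:R + (a == c)%:R).
Proof.
rewrite -half_betacoef // rCGE alphaE betaE gammaE mxE.
have two0 : 2%:R != 0 :> F by apply: char0_natr_neq0.
rewrite [X in _ = _ + X]mulrDr addrA [_ + [&& _, _ & _]%:R + _]addrAC.
rewrite -!addrA; congr (_ + (_ + (_ + _))).
have key : [&& a == b, c == d & a == c] = [&& a == d, b == c & a == b].
  by apply/and3P/and3P => -[/eqP-> /eqP-> /eqP->]; rewrite !eqxx.
have -> : (a == b)%:R * (c == d)%:R * (2^-1 * (a == c)%:R) =
    2^-1 * [&& a == b, c == d & a == c]%:R :> F.
  by rewrite -!mulnb !natrM; ring.
rewrite key -!val_eqE; case: (ltngtP a b) => _ /=;
  case: (_ == _ :> nat); case: (_ == _ :> nat) => /=; field; exact: two0.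
Qed.

(** A nonzero coefficient would need a chain ending at a root that straddles [i]. *)
Lemma rCG_half_in_p (a b c d : 'I_n) : (i <= a)%N -> (b < i)%N ->
  rCG F i n (a, b, c, d) + 2^-1 * E F d c a b = 0.
Proof.
move=> ia bi; rewrite rCG_halfE (cross2 _ _ bi ia).
have -> : rho a b d c = false by apply/negP => /rhoP[]; lia.
have -> : (a < b)%N = false by lia.
have -> : (a == b) = false by rewrite -val_eqE /=; lia.
by rewrite !andbF !mul0r /= subrr !addr0.
Qed.

Definition tauO (a : 'I_n) : 'I_n :=
  Ordinal (ltn_pmod (a + i) (leq_ltn_trans (leq0n i) i_ltn)).

(** R - 1/2 is R + 1/2 moved by [tau]: the chains of alpha lose or gain a step, gamma and the half
    identity account for chains of length one, and beta advances by 1/n. The excluded pairs (a, b)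
    are those that [tau] sends into [n], and the last term only contributes a multiple of tr u. *)
Lemma rCG_half_tau (a b c d : 'I_n) : ~~ ((n - i <= a)%N && (b < n - i)%N) ->
  rCG F i n (a, b, c, d) + 2^-1 * E F d c a b - E F d c a b =
  rCG F i n (tauO a, tauO b, c, d) + 2^-1 * E F d c (tauO a) (tauO b) -
  (a == b)%:R * (c == d)%:R / n%:R.
Proof.
move=> ab; rewrite !rCG_halfE mxE.
have n0 : n%:R != 0 :> F by apply: char0_natr_neq0 => //; lia.
have rhoF j k l m : (k <= j)%N -> rho j k l m = false.
  by move=> kj; apply/negP => /rhoP[]; lia.
have rhoF2 j k l m : (m <= l)%N -> rho j k l m = false.
  by move=> kj; apply/negP => /rhoP[]; lia.
have an := ltn_ord a; have bn := ltn_ord b; have cn := ltn_ord c.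
have vE (p q : 'I_n) : (p == q) = (p == q :> nat) by [].
have tneq p q : (p < n)%N -> (q < n)%N -> p != q -> tau p != tau q.
  by move=> pn qn; rewrite eqn_modDr !modn_small.
case: (ltngtP a b) => [lab|lab|eab].
- have /negPf -> : a != b by rewrite vE neq_ltn lab.
  have /negPf -> : tauO a != tauO b.
    by rewrite vE tneq // neq_ltn lab.
  rewrite (rhoF2 c d) ?(ltnW lab) // !mul0r !andbT !vE /= -/(tau a) -/(tau b).
  case: (boolP ((b < n - i)%N || (n - i <= a)%N)) => nc.
    have [|_ _ tab _] := tau_cut i_gt0 i_ltn co_in (s := 0) lab bn nc.
      by lia.
    rewrite (front _ _ lab bn nc) (rhoF2 c d _ _ (ltnW tab)) tab andbT natrD.
    by rewrite /= !subr0 !addr0 addrK.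
  (* A positive root across the cut starts no chain, and [tau] turns it into a negative root
     straddling [i], where no chain ends: both sides vanish. *)
  have ai : (a < n - i)%N by lia.
  have bi : (n - i <= b)%N by lia.
  have tba : (tau b < tau a)%N by rewrite (tauS ai) (tauB bi bn); lia.
  have tbi : (tau b < i)%N by rewrite (tauB bi bn); lia.
  have tai : (i <= tau a)%N by rewrite (tauS ai); lia.
  rewrite cross1 // (rhoF _ _ _ _ (ltnW tba)) cross2 //.
  by rewrite (ltnNge (tau a)) (ltnW tba) /= !andbF !subr0 !addr0 add0r subrr.
- have /negPf -> : a != b by rewrite vE neq_ltn lab orbT.
  have /negPf -> : tauO a != tauO b.
    by rewrite vE tneq // neq_ltn lab orbT.
  rewrite (rhoF a b) ?(ltnW lab) // !mul0r !andbF !vE /= -/(tau a) -/(tau b).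
  have nc : (a < n - i)%N || (n - i <= b)%N by lia.
  have [|_ _ tab _] := tau_cut i_gt0 i_ltn co_in (s := 0) lab an nc.
    by lia.
  rewrite (back _ _ lab an nc) (rhoF _ _ _ _ (ltnW tab)) natrD.
  rewrite (ltnNge (tau a)) (ltnW tab) /= !andbF !subr0 !addr0.
  by rewrite !sub0r opprD [(b == c :> nat) && _]andbC.
- have eqab : a = b by apply: val_inj.
  rewrite -eqab !eqxx !(rhoF2 c d) // !rhoF // ltnn !andbF !mul1r /= -/(tau a) !subr0 !add0r.
  case: (eqVneq c d) => [<-|cd]; last first.
    have /negPf -> : ~~ ((a == d) && (a == c)).
      by apply: contra cd => /andP[/eqP <- /eqP <-].
    by rewrite !mul0r subrr.
  rewrite andbb !mul1r addrK !vE /= -/(tau a) (cshift_tau _ cn).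
  have tn : (tau a < n)%N by rewrite ltn_pmod //; lia.
  have := cshift_eq0 tn cn; rewrite (cshift_tau _ cn) => <-.
  (* The shift grows by one except from n - 1 to 0; there the delta on the right supplies the
     missing 1. *)
  have := cshift_lt a c; rewrite leq_eqVlt => /orP[/eqP e|h].
    rewrite e modnn eqxx /=.
    have -> : (cshift a c)%:R = n%:R - 1 :> F
      by apply/eqP; rewrite eq_sym subr_eq natr1 e.
    by field; rewrite n0 (char0_natr_neq0 char0).
  rewrite modn_small // /= -natr1.
  by field; rewrite n0 (char0_natr_neq0 char0).
Qed.

Definition cyclic_mx : 'M[F]_n := \matrix_(a, b) (a == tauO b)%:R.

Lemma tauO_inj : injective tauO.
Proof.
move=> a b /(congr1 val) /= e; apply: val_inj => /=.
by apply: (@Tmap_inj i n).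
Qed.

Lemma cyclic_mxK : cyclic_mx^T *m cyclic_mx = 1%:M.
Proof.
apply/matrixP => a b; rewrite !mxE.
under eq_bigr => c _ do rewrite !mxE.
by rewrite sum_delta (inj_eq tauO_inj).
Qed.

Lemma mul_cyclic (u : 'M[F]_n) a b : (cyclic_mx *m u) (tauO a) b = u a b.
Proof.
rewrite mxE -[RHS](sum_delta a (fun c => u c b)); apply: eq_bigr => c _.
by rewrite mxE (inj_eq tauO_inj) eq_sym.
Qed.

Lemma mulmx_cyclic (u : 'M[F]_n) a b : (u *m cyclic_mx) a b = u a (tauO b).
Proof.
rewrite mxE -[RHS](sum_deltar (tauO b) (fun c => u a c)).
by apply: eq_bigr => c _; rewrite mxE.
Qed.

Lemma mul_cyclicT (u : 'M[F]_n) a b : (u *m cyclic_mx^T) a (tauO b) = u a b.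
Proof.
rewrite mxE -[RHS](sum_deltar b (fun c => u a c)); apply: eq_bigr => c _.
by rewrite !mxE (inj_eq tauO_inj) eq_sym.
Qed.

Lemma rCG_half_sumE (u : 'M[F]_n) a b :
  (Rop (rCG F i n) u + 2^-1 *: u) a b = \sum_d \sum_c u d c *
    (rCG F i n (a, b, c, d) + 2^-1 * E F d c a b).
Proof.
rewrite Rop_sumE {2}(mx_sumE u) scaler_sumr -big_split summxE.
apply: eq_bigr => d _; rewrite scaler_sumr -big_split summxE.
by apply: eq_bigr => c _ /=; rewrite scalerA mulrC -scalerA -scalerDr !mxE
  -/(E F d c) -[in RHS]Rop_E !mxE.
Qed.

Lemma rCG_lagrangian : lagrangian i cyclic_mx (rCG F i n).
Proof.
move=> u tu; split.
  move=> a b ia bi; rewrite rCG_half_sumE big1 // => d _; rewrite big1 // => c _.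
  by rewrite rCG_half_in_p ?mulr0.
set x := Rop _ u + _.
(* The equation forces this [nu]; what remains is that it lies in [n]. *)
exists (cyclic_mx *m (x - u) *m cyclic_mx^T - x); last first.
  by rewrite addrCA subrr addr0 -mulmxA cyclic_mxK mulmx1.
move=> a b ab.
have [[a' aE] [b' bE]] : (exists a', a = tauO a') /\ (exists b', b = tauO b').
  by split; [exists (invF tauO_inj a)|exists (invF tauO_inj b)]; rewrite f_invF.
rewrite aE bE mxE mul_cyclicT mul_cyclic [X in _ + X]mxE [X in X - _]mxE.
rewrite [X in _ + X - _]mxE.
have ab' : ~~ ((n - i <= a')%N && (b' < n - i)%N).
  move: ab; rewrite aE bE /= -!/(tau _); apply: contra => /andP[ha hb].
  by rewrite (tauB ha) // (tauS hb); have := ltn_ord a'; lia.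
rewrite {1 2}/x !rCG_half_sumE.
have -> : \sum_d \sum_c u d c * (rCG F i n (a', b', c, d) + 2^-1 * E F d c a' b')
  - u a' b' = \sum_d \sum_c u d c * (rCG F i n (tauO a', tauO b', c, d) +
      2^-1 * E F d c (tauO a') (tauO b')) - (a' == b')%:R / n%:R * \tr u.
  have -> : u a' b' = \sum_d \sum_c u d c * E F d c a' b'.
    rewrite {1}(mx_sumE u) summxE; apply: eq_bigr => d _.
    by rewrite summxE; apply: eq_bigr => c _; rewrite mxE.
  have -> : \tr u = \sum_d \sum_c u d c * (c == d)%:R.
    by apply: eq_bigr => d _; rewrite sum_deltar.
  rewrite mulr_sumr -!sumrB; apply: eq_bigr => d _.
  rewrite mulr_sumr -!sumrB; apply: eq_bigr => c _.
  by rewrite -mulrBr (rCG_half_tau _ _ ab'); ring.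
by rewrite tu mulr0 subr0 subrr.
Qed.

Lemma sum_cshift (c : 'I_n) :
  \sum_(a < n) (cshift a c)%:R = (n%:R * (n%:R - 1)) / 2%:R :> F.
Proof.
pose f (a : 'I_n) : 'I_n := Ordinal (cshift_lt a c).
have f_inj : injective f.
  move=> a b /(congr1 val) /= e; apply: val_inj => /=.
  have : (n - c + a = n - c + b %[mod n])%N.
    have h k : (k = k * iinv i n %% n * i %[mod n])%N.
      by rewrite modnMml -mulnA -modnMmr iinvP modnMmr muln1.
    by rewrite (h (n - c + a)%N) (h (n - c + b)%N) -!/(cshift _ _) e.
  by move/eqP; rewrite eqn_modDl !modn_small // => /eqP.
have two0 : 2%:R != 0 :> F by apply: char0_natr_neq0.
transitivity (\sum_(a < n) (nat_of_ord a)%:R : F).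
  by rewrite [RHS](reindex_inj f_inj).
rewrite -natr_sum -(big_mkord xpredT (fun k => k)) triangular_sum.
apply: (mulIf two0); rewrite divfK // -natrM.
have -> : ('C(n, 2) * 2 = n * n.-1)%N.
  by rewrite mulnC -[2%N]/(1.+1) -mul_bin_diag bin1.
by rewrite natrM -subn1 natrB //; lia.
Qed.

(** On the diagonal the shifts run through 0, ..., n - 1, and -n/2 + (n - 1)/2 + 1/2 = 0. *)
Lemma rCG_trace u : \tr (Rop (rCG F i n) u) = 0.
Proof.
rewrite Rop_sumE raddf_sum big1 //= => d _; rewrite raddf_sum big1 //= => c _.
rewrite mxtraceZ; apply/eqP; rewrite mulf_eq0; apply/orP; right; apply/eqP.
have n0 : n%:R != 0 :> F by apply: char0_natr_neq0 => //; lia.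
have two0 : 2%:R != 0 :> F by apply: char0_natr_neq0.
rewrite /mxtrace; under eq_bigr => a _ do rewrite Rop_E.
transitivity (\sum_(a < n) ((c == d)%:R *
    (- 2^-1 + (cshift a c)%:R / n%:R + 2^-1 * (a == c)%:R) : F)).
  apply: eq_bigr => a _.
  have -> : rCG F i n (a, a, c, d) =
     rCG F i n (a, a, c, d) + 2^-1 * E F d c a a - 2^-1 * E F d c a a.
    by rewrite addrK.
  have rF j k : rho j k a a = false by apply/negP => /rhoP[]; lia.
  have rF2 j k : rho a a j k = false by apply/negP => /rhoP[]; lia.
  rewrite rCG_halfE rF rF2 ltnn !andbF eqxx mxE /= subrr !add0r mul1r.
  case: (eqVneq c d) => [<-|cd]; last first.
    have /negPf -> : ~~ ((a == d) && (a == c)).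
      by apply: contra cd => /andP[/eqP <- /eqP <-].
    by rewrite /= mulr0 !mul0r subr0.
  by rewrite andbb !mul1r /=; field; rewrite ?n0 two0.
rewrite -mulr_sumr !big_split /= sumr_const card_ord -mulr_suml sum_cshift.
rewrite -mulr_sumr.
have -> : \sum_(a < n) (a == c)%:R = 1 :> F.
  by rewrite -[RHS](sum_delta c (fun _ => 1)); apply: eq_bigr => a _; rewrite mulr1.
rewrite -[(- 2^-1) *+ n]mulr_natr.
by field; rewrite n0 two0.
Qed.

(** beta and gamma are of degree 0, and alpha is handled by [rho_deg]. *)
Lemma rCG_degree (a b c d : 'I_n) :
  hq i a - hq i b + (hq i c - hq i d) < 0 -> rCG F i n (a, b, c, d) = 0.
Proof.
move=> deg; rewrite rCGE alphaE betaE gammaE.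
have -> : rho a b d c = false.
  by apply/negP => /(rho_deg i_gt0 i_ltn co_in); lia.
have -> : rho c d b a = false.
  by apply/negP => /(rho_deg i_gt0 i_ltn co_in); lia.
have h1 : (a == b) && (c == d) = false.
  by apply/negP => /andP[/eqP e1 /eqP e2]; move: deg; rewrite e1 e2; lia.
have h2 : (a == d) && (b == c) = false.
  by apply/negP => /andP[/eqP e1 /eqP e2]; move: deg; rewrite e1 e2; lia.
by rewrite -!natrM !mulnb h1 h2 /= !mul0r subrr !addr0.
Qed.

End CremmerGervais.

(** * The conjugating matrix *)

Lemma sum_delta_nat {F : fieldType} {n : nat} (k : nat) (f : nat -> F) :
  \sum_(c < n) (c == k :> nat)%:R * f c = (k < n)%N%:R * f k.
Proof.
case: ltnP => kn.
  rewrite (bigD1 (Ordinal kn)) //= eqxx big1 ?addr0 // => c.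
  by rewrite -val_eqE /= => /negPf ->; rewrite mul0r.
rewrite mul0r big1 // => c _; rewrite (_ : (c == k :> nat) = false) ?mul0r //.
by have := ltn_ord c; lia.
Qed.

(** * Binomial formulas for the exponentials *)

Section ClosedForms.
Variables (F : fieldType) (i n : nat).
Hypothesis char0 : [pchar F] =i pred0.
Hypothesis i_gt0 : (0 < i)%N.
Hypothesis i_ltn : (i < n)%N.

Lemma expmxE (u : 'M[F]_n) (f : nat -> nat -> nat -> F) :
  (forall m (a b : 'I_n), (u ^+ m) a b = m`!%:R * f m a b) ->
  forall a b, expmx u a b = \sum_(m < n) f m a b.
Proof.
move=> uE a b; rewrite summxE; apply: eq_bigr => m _.
by rewrite mxE uE mulrA mulVf ?mul1r // (char0_natr_neq0 char0) // fact_gt0.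
Qed.

(** The number of steps of length [i] that stay in range from the 0-based index [a]; this is the
    coefficient c_(a+1) of X. *)
Definition colen a := ((n - a.+1) %/ i)%N.

Lemma colen_sub a : (a + i < n)%N -> colen a = (colen (a + i)).+1.
Proof.
move=> ain; rewrite /colen (_ : (n - a.+1 = 1 * i + (n - (a + i).+1))%N); last by lia.
by rewrite divnMDl.
Qed.

Lemma XmE (a b : 'I_n) : Xm F i n a b = (b == a + i :> nat)%N%:R * (colen a)%:R.
Proof.
rewrite summxE big_mkcond (bigD1 a) //= big1 ?addr0; last first.
  move=> j /negPf ja; case: ifP => // _; rewrite !mxE.
  by rewrite eqz_nat eqSS [a == j :> nat]eq_sym [j == a :> nat]ja /= mulr0.
have e : (Posz b.+1 == Posz (a.+1 + i)%N) = (b == a + i :> nat)%N.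
  by rewrite eqz_nat addSn eqSS.
rewrite !mxE eqxx e /=.
case: ltnP => ai; first by rewrite mulrC.
rewrite (_ : (b == _ :> nat) = false) ?mul0r //.
by have := ltn_ord b; lia.
Qed.

(** Each step along X lowers [colen] by one, so the weights multiply to a falling factorial, that is
    m! times a binomial. *)
Lemma XmX m (a b : 'I_n) : ((- Xm F i n) ^+ m) a b =
  m`!%:R * ((b == a + m * i :> nat)%N%:R * ((-1) ^+ m * 'C(colen a, m)%:R)).
Proof.
suff -> : ((- Xm F i n) ^+ m) a b =
    (b == a + m * i :> nat)%N%:R * ((-1) ^+ m * (colen a ^_ m)%:R) :> F.
  by rewrite -bin_ffact natrM; ring.
elim: m a b => [|m IH] a b.
  by rewrite expr0 mxE mul0n addn0 ffactn0 expr0 !mulr1 eq_sym.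
rewrite exprS mxE.
transitivity (\sum_(c < n) (c == a + i :> nat)%N%:R * (- (colen a)%:R *
   ((b == c + m * i :> nat)%N%:R * ((-1) ^+ m * (colen c ^_ m)%:R))) : F).
  by apply: eq_bigr => c _; rewrite mxE XmE IH; ring.
rewrite (sum_delta_nat (a + i) (fun c => - (colen a)%:R *
   ((b == c + m * i :> nat)%N%:R * ((-1) ^+ m * (colen c ^_ m)%:R)))).
rewrite mulSn addnA exprS.
case: ltnP => ain; last first.
  rewrite (_ : (b == _ :> nat) = false) ?mul0r //.
  by have := ltn_ord b; lia.
by rewrite (colen_sub ain) ffactnS /= natrM; ring.
Qed.

Definition sbin (c x y : nat) : F :=
  if (x <= y)%N then (-1) ^+ (y - x) * 'C(c, y - x)%:R else 0.

Definition Efun (a b : nat) : F :=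
  (a %% i == b %% i)%N%:R * sbin (colen a) (a %/ i)%N (b %/ i)%N.

Lemma expX (a b : 'I_n) : expmx (- Xm F i n) a b = Efun a b.
Proof.
rewrite (expmxE (f := fun m a b => (b == a + m * i)%N%:R *
   ((-1) ^+ m * 'C(colen a, m)%:R))); last exact: XmX.
rewrite /Efun /sbin.
have bn := ltn_ord b.
case: (eqVneq (a %% i)%N (b %% i)%N) => [e|ne]; last first.
  rewrite mul0r big1 // => m _; case: eqP => [be|_]; last by rewrite mul0r.
  by case/eqP: ne; rewrite be addnC modnMDl.
rewrite mul1r; case: leqP => ab; last first.
  rewrite big1 // => m _; case: eqP => [be|_]; last by rewrite mul0r.
  by move: ab; rewrite be addnC divnMDl //; lia.
have mn : (b %/ i - a %/ i < n)%N.
  by apply: leq_ltn_trans (leq_subr _ _) _; apply: leq_ltn_trans (leq_div _ _) bn.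
have dE : b = (a + (b %/ i - a %/ i) * i)%N :> nat.
  rewrite {1}(divn_eq b i) {1}(divn_eq a i) -e mulnBl.
  by have := leq_mul ab (leqnn i); lia.
rewrite (bigD1 (Ordinal mn)) //= -dE eqxx mul1r big1 ?addr0 // => m mne.
case: eqP => [be|_]; last by rewrite mul0r.
case/eqP: mne; apply: val_inj => /=.
by rewrite [in RHS]be addnC divnMDl // addnK.
Qed.

Lemma ZmE (z : nat -> F) :
  (forall j : nat, (0 < j)%N -> (j < i)%N -> (ac i n j)%:~R = z j) ->
  forall a b : 'I_n, Zm F i n a b =
    (a == b.+1 :> nat)%:R * (if (0 < a %% i)%N then z (a %% i)%N else 0).
Proof.
move=> zE a b; rewrite summxE big_mkcond /=.
have xiE (j : nat) : (j < i)%N -> xi F i n (Posz j + 1) (Posz j) a b =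
   ((a == b.+1 :> nat) && (j == a %% i :> nat))%N%:R.
  move=> ji; rewrite mxE; congr (nat_of_bool _)%:R.
  have -> : (Posz a.+1 - (Posz j + 1) == Posz b.+1 - Posz j) = (a == b.+1 :> nat).
    by apply/eqP/eqP; lia.
  case: eqP => //= _.
  have -> : Posz a.+1 - (Posz j + 1) = Posz a - Posz j by lia.
  rewrite -eqz_mod_dvd !modz_nat eqz_nat (modn_small ji).
  by rewrite eq_sym.
pose j0 : 'I_i := Ordinal (ltn_pmod a i_gt0).
rewrite (bigD1 j0) //= big1 ?addr0; last first.
  move=> j /negPf ne; case: ifP => // _; rewrite mxE xiE //.
  by rewrite [j == _ :> nat]ne andbF mulr0.
case: ifP => j1; last by rewrite mulr0.
by rewrite mxE xiE ?ltn_pmod //= eqxx andbT zE ?ltn_pmod // mulrC.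
Qed.

Lemma modS b : (b.+1 %% i = if (b %% i).+1 == i then 0 else (b %% i).+1)%N.
Proof.
have bi := ltn_pmod b i_gt0.
rewrite {1}(divn_eq b i) -addnS modnMDl; case: eqP => [->|h].
  by rewrite modnn.
by rewrite modn_small //; lia.
Qed.

(** The entries of exp(-Z) in the two congruence cases; the binomials vanish as soon as [a] and [b]
    lie in different blocks of i consecutive indices. *)
Definition Afun (eps : bool) (a b : nat) : F :=
  if (b <= a)%N then
    if eps then (-1) ^+ (a - b) * 'C(i.-1 - b %% i, a - b)%:R
    else 'C(a %% i, a - b)%:R
  else 0.

Lemma sum_Afun (f : nat -> F) (a b : 'I_n) :
  \sum_(m < n) (a == b + m :> nat)%N%:R * f m =
  if (b <= a)%N then f (a - b)%N else 0.
Proof.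
case: leqP => ba; last first.
  rewrite big1 // => m _; case: eqP => [|_]; last by rewrite mul0r.
  by move=> e; move: ba; rewrite e; lia.
have h : forall m : nat, (a == b + m :> nat)%N = (m == a - b)%N by lia.
under eq_bigr => m _ do rewrite h.
rewrite sum_delta_nat (_ : (a - b < n)%N) ?mul1r //.
by have := ltn_ord a; lia.
Qed.

Lemma expZ_eps (a b : 'I_n) : (n %% i = 1)%N ->
  expmx (- Zm F i n) a b = Afun true a b.
Proof.
move=> ni1; have eb : eps_bool i n by rewrite /eps_bool ni1.
have zE (j : nat) : (0 < j)%N -> (j < i)%N -> (ac i n j)%:~R = (i - j)%:R :> F.
  move=> j0 ji; rewrite /ac eb mul1r.
  have -> : - Posz (n * j)%N = - Posz (n %/ i * j + 1)%N * Posz i + Posz (i - j)%N.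
    by have := divn_eq n i; rewrite ni1; nia.
  by rewrite modzMDl modz_nat modn_small //; lia.
have ZE (a' b' : 'I_n) : (- Zm F i n) a' b' =
    (b'.+1 == a' :> nat)%:R * - (i.-1 - b' %% i)%:R.
  rewrite mxE (ZmE zE) eq_sym mulrN; congr (- _).
  case: eqP => [<-|_]; last by rewrite !mul0r.
  have bi := ltn_pmod b' i_gt0.
  rewrite modS; case: eqP => e /=; rewrite !mul1r.
    by rewrite (_ : (i.-1 - b' %% i = 0)%N) //; lia.
  by congr (_%:R); lia.
rewrite (expmxE (f := fun m a b => (a == b + m)%N%:R *
   ((-1) ^+ m * 'C(i.-1 - b %% i, m)%:R))).
  exact: (sum_Afun (fun m => (-1) ^+ m * 'C(i.-1 - b %% i, m)%:R)).
move=> m {}a {}b.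
suff -> : ((- Zm F i n) ^+ m) a b = (a == b + m :> nat)%N%:R *
   ((-1) ^+ m * ((i.-1 - b %% i) ^_ m)%:R) :> F.
  by rewrite -bin_ffact natrM; ring.
elim: m a b => [|m IH] a b.
  by rewrite expr0 mxE addn0 ffactn0 expr0 !mulr1.
rewrite exprSr mxE.
transitivity (\sum_(c < n) (c == b.+1 :> nat)%N%:R * (- (i.-1 - b %% i)%:R *
   ((a == c + m :> nat)%N%:R * ((-1) ^+ m * ((i.-1 - c %% i) ^_ m)%:R))) : F).
  by apply: eq_bigr => c _; rewrite ZE IH [b.+1 == _]eq_sym; ring.
rewrite (sum_delta_nat b.+1 (fun c => - (i.-1 - b %% i)%:R *
   ((a == c + m :> nat)%N%:R * ((-1) ^+ m * ((i.-1 - c %% i) ^_ m)%:R)))).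
rewrite addSn addnS; case: ltnP => bn; last first.
  rewrite (_ : (a == _ :> nat) = false) ?mul0r //.
  by have := ltn_ord a; lia.
have bi := ltn_pmod b i_gt0.
rewrite ffactnS natrM exprS modS; case: ((b %% i).+1 =P i)%N => e.
  (* At the end of a block the coefficient of Z is zero, so no power crosses it. *)
  have -> : (i.-1 - b %% i = 0)%N by lia.
  by rewrite mulr0n ?(oppr0, mul0r, mulr0).
rewrite (_ : (i.-1 - (b %% i).+1 = (i.-1 - b %% i).-1)%N); last by lia.
by rewrite /= mul1r; ring.
Qed.

Lemma expZ_neps (a b : 'I_n) : eps_bool i n = false -> (i %| n.+1)%N ->
  expmx (- Zm F i n) a b = Afun false a b.
Proof.
move=> eb din.
have zE (j : nat) : (0 < j)%N -> (j < i)%N -> (ac i n j)%:~R = - j%:R :> F.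
  move=> j0 ji; rewrite /ac eb mulN1r rmorphN /=; congr (- _).
  have [q qE] := dvdnP din.
  have -> : - Posz (n * j)%N = - Posz (q * j)%N * Posz i + Posz j by nia.
  by rewrite modzMDl modz_nat modn_small.
have ZE (a' b' : 'I_n) : (- Zm F i n) a' b' =
    (b'.+1 == a' :> nat)%:R * (a' %% i)%:R.
  rewrite mxE (ZmE zE) eq_sym -mulrN; congr (_ * _).
  by case: posnP => [->|_]; rewrite ?oppr0 ?opprK.
rewrite (expmxE (f := fun m a b => (a == b + m)%N%:R * 'C(a %% i, m)%:R : F)).
  exact: (sum_Afun (fun m => 'C(a %% i, m)%:R : F)).
move=> m {}a {}b.
suff -> : ((- Zm F i n) ^+ m) a b = (a == b + m :> nat)%N%:R *
   ((a %% i) ^_ m)%:R :> F.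
  by rewrite -bin_ffact natrM; ring.
elim: m a b => [|m IH] a b.
  by rewrite expr0 mxE addn0 ffactn0 !mulr1.
rewrite exprS mxE.
transitivity (\sum_(c < n) (c.+1 == a :> nat)%N%:R * ((a %% i)%:R *
   ((c == b + m :> nat)%N%:R * ((c %% i) ^_ m)%:R)) : F).
  by apply: eq_bigr => c _; rewrite ZE IH; ring.
case: (posnP a) => a0.
  have -> : (a == b + m.+1 :> nat)%N = false by lia.
  rewrite mul0r big1 // => c _.
  by have -> : (c.+1 == a :> nat) = false; [lia | rewrite mul0r].
have h : forall c : nat, (c.+1 == a :> nat) = (c == a.-1)%N by lia.
under eq_bigr => c _ do rewrite h.
rewrite (sum_delta_nat a.-1 (fun c => (a %% i)%:R *
   ((c == b + m :> nat)%N%:R * ((c %% i) ^_ m)%:R))).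
rewrite (_ : (a.-1 < n)%N) ?mul1r; last by have := ltn_ord a; lia.
rewrite (_ : (a.-1 == b + m)%N = (a == b + m.+1 :> nat)%N); last by lia.
rewrite ffactnS natrM; have aE : (a = a.-1.+1 :> nat)%N by lia.
have := modS a.-1; rewrite -aE; case: eqP => _ ->.
  by rewrite mulr0n !(mul0r, mulr0).
by rewrite /=; ring.
Qed.

Lemma YmE_eps (a b : 'I_n) : eps_bool i n -> Ym F i n a b =
  ((0 < a %% i) && (b == (a %/ i).+1 * i :> nat))%N%:R * 'C(i, a %% i)%:R.
Proof.
move=> eb; rewrite summxE big_mkcond /=.
have xiE (k : nat) : (k < i)%N -> Emk F i n (Posz k) (Posz i) a b =
   ((k == a %% i) && (b == (a %/ i).+1 * i :> nat))%N%:R.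
  move=> ki; rewrite /Emk eb mxE; congr (nat_of_bool _)%:R.
  have -> : Posz a.+1 - (Posz k + 1) = Posz a - Posz k by lia.
  have -> : Posz b.+1 - (Posz i + 1) = Posz b - Posz i by lia.
  rewrite andbC -eqz_mod_dvd !modz_nat eqz_nat (modn_small ki) eq_sym.
  case: eqP => // kE /=; have := divn_eq a i; rewrite -kE => aE.
  by apply/eqP/eqP; nia.
pose j0 : 'I_i := Ordinal (ltn_pmod a i_gt0).
rewrite (bigD1 j0) //= big1 ?addr0; last first.
  move=> j /negPf ne; case: ifP => // _; rewrite mxE xiE //.
  by rewrite [j == _ :> nat]ne mulr0.
case: ifP => j1; last by rewrite mul0r.
by rewrite mxE xiE ?ltn_pmod //= eqxx mulrC.
Qed.

Lemma YmE_neps (a b : 'I_n) : eps_bool i n = false -> Ym F i n a b =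
  - ([&& i %| a.+1, a < b & b < a + i]%N%:R * 'C(i, b - a)%:R).
Proof.
move=> eb; rewrite summxE big_mkcond /=.
have xiE (k : nat) : (0 < k)%N -> (k < i)%N ->
    Emk F i n (Posz k) (Posz i) a b =
   - ([&& i %| a.+1, a < b, b < a + i & k == i - (b - a)])%N%:R.
  move=> k0 ki; rewrite /Emk eb !mxE; congr (- (nat_of_bool _)%:R).
  have -> : Posz a.+1 - (Posz i - Posz i) = Posz a.+1 by lia.
  rewrite andbC dvdzE /=; case: (i %| a.+1)%N => //=.
  by apply/eqP/and3P => [e|[h1 h2 /eqP h3]]; [split; lia | lia].
case: (boolP [&& _, _ & _]) => [/and3P[da ab ba]|ne]; last first.
  rewrite mul0r oppr0 big1 // => k _; case: ifP => // k0; rewrite mxE xiE //.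
  have -> : [&& i %| a.+1, a < b, b < a + i & nat_of_ord k == i - (b - a)]%N = false.
    apply/negbTE; apply: contra ne => /and4P[-> -> -> _] //.
  by rewrite oppr0 mulr0.
have ki : (i - (b - a) < i)%N by lia.
rewrite (bigD1 (Ordinal ki)) //= big1 ?addr0; last first.
  move=> j /negPf ne; case: ifP => // j0; rewrite mxE xiE //.
  by rewrite [j == _ :> nat]ne !andbF oppr0 mulr0.
have -> : (0 < i - (b - a))%N by lia.
rewrite mxE xiE //; last by lia.
rewrite da ab ba eqxx /= mulrN mulr1 mul1r; congr (- _%:R).
by rewrite bin_sub //; lia.
Qed.

Lemma expmx_sqr0 (u : 'M[F]_n) : u *m u = 0 -> expmx (- u) = 1%:M - u.
Proof.
move=> uu; have n1 : (1 < n)%N by lia.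
rewrite /expmx (bigD1 (Ordinal (ltnW n1))) // (bigD1 (Ordinal n1)) //=.
rewrite big1 ?addr0; last first.
  move=> [[|[|m]] mn] //= _; rewrite !exprS mulrA mulrNN.
  by rewrite [u * u]uu mul0r scaler0.
by rewrite expr0 expr1 fact0 invr1 !scale1r.
Qed.

(** No nonzero column of Y meets a nonzero row: in the first case columns are multiples of [i] and
    rows are not; in the second rows are -1 modulo [i] and columns are not. Hence exp(-Y) = 1 -
    Y. *)
Lemma YmM : Ym F i n *m Ym F i n = 0.
Proof.
case: (boolP (eps_bool i n)) => [eb|/negbTE eb]; apply/matrixP => a b; rewrite !mxE big1 // => c _.
  rewrite !YmE_eps //.
  case: (c =P _ :> nat) => [->|_]; last by rewrite andbF !mul0r.
  by rewrite modnMl /= !mul0r mulr0.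
rewrite !YmE_neps // mulrNN.
case: (boolP [&& _, _ & _]) => [/and3P[da ab ba]|_]; last by rewrite !mul0r.
case: (boolP [&& _, _ & _]) => [/and3P[dc _ _]|_]; last by rewrite mul0r mulr0.
have : (i %| c.+1 - a.+1)%N by apply: dvdn_sub.
by rewrite subSS => /dvdn_leq; lia.
Qed.

(** The entries of exp(-X) exp(-Y). Y contributes only at residues where exp(-X) vanishes, so the
    two never add up. Arguments are naturals so that shifts may leave the matrix. *)
Definition Gfun (eps : bool) (a b : nat) : F :=
  if eps then
    if (b %% i == 0)%N && (0 < a %% i)%N
    then - ('C(i, a %% i)%:R * sbin (colen a) (a %/ i).+1 (b %/ i)%N)
    else Efun a b
  else
    if (a %% i == i.-1)%N && (b %% i != i.-1)%N
    then 'C(i, (b %% i).+1)%:R * sbin (colen a) (a %/ i).+1 (b %/ i)%N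
    else Efun a b.

Lemma sbinSS c x y : sbin c x.+1 y.+1 = sbin c x y.
Proof. by rewrite /sbin ltnS subSS. Qed.

Lemma expXY_eps (a b : 'I_n) : eps_bool i n ->
  (expmx (- Xm F i n) *m expmx (- Ym F i n)) a b = Gfun true a b.
Proof.
move=> eb; rewrite (expmx_sqr0 YmM).
rewrite mulmxBr mulmx1 mxE [X in _ + X]mxE expX /Gfun.
have bn := ltn_ord b; have ai := ltn_pmod a i_gt0.
case: (boolP (_ && _)) => [/andP[/eqP bi a0]|ne]; last first.
  rewrite mxE big1 ?subr0 // => c _; rewrite expX YmE_eps // /Efun.
  case: eqP => [e|_]; last by rewrite !mul0r.
  case: eqP => [be|_]; last by rewrite andbF mul0r mulr0.
  move: ne; rewrite be modnMl eqxx /= -e => /negPf ->.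
  by rewrite mul0r mulr0.
rewrite {1}/Efun bi (_ : (a %% i == 0)%N = false) ?mul0r ?sub0r; last by lia.
congr (- _); rewrite mxE.
case b0 : (b %/ i)%N => [|p].
  rewrite /sbin mulr0 big1 // => c _; rewrite YmE_eps //.
  case: eqP => [be|_]; last by rewrite andbF mul0r mulr0.
  by move: b0; rewrite be mulnK.
rewrite sbinSS.
have bE : b = (p.+1 * i)%N :> nat by rewrite {1}(divn_eq b i) bi b0 addn0.
have cn : (p * i + a %% i < n)%N by apply: leq_ltn_trans _ bn; rewrite bE mulSn; lia.
rewrite (bigD1 (Ordinal cn)) //= big1 ?addr0; last first.
  move=> c ne; rewrite expX YmE_eps // /Efun.
  case: eqP => [e|_]; last by rewrite !mul0r.
  case: eqP => [be|_]; last by rewrite andbF mul0r mulr0.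
  case/eqP: ne; apply: val_inj => /=; rewrite (divn_eq c i) -e.
  by congr (_ * _ + _)%N; move: be; rewrite bE => /eqP; rewrite eqn_pmul2r // => /eqP [].
rewrite expX YmE_eps //= /Efun modnMDl modn_mod eqxx divnMDl // (divn_small ai).
by rewrite a0 addn0 bE eqxx /= !mul1r mulrC.
Qed.

Lemma expXY_neps (a b : 'I_n) : eps_bool i n = false ->
  (expmx (- Xm F i n) *m expmx (- Ym F i n)) a b = Gfun false a b.
Proof.
move=> eb; rewrite (expmx_sqr0 YmM).
rewrite mulmxBr mulmx1 mxE [X in _ + X]mxE expX /Gfun.
have bn := ltn_ord b; have ai := ltn_pmod a i_gt0.
have bi := ltn_pmod b i_gt0.
have dvdS c : (i %| c.+1)%N = (c %% i == i.-1)%N.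
  by rewrite /dvdn modS; case: ((c %% i).+1 =P i)%N => e; lia.
have split_b (c : 'I_n) : (i %| c.+1)%N -> (c < b)%N -> (b < c + i)%N ->
    [/\ c.+1 = b %/ i * i, (b - c = (b %% i).+1) & b %% i != i.-1]%N.
  move=> dc cb bc; have [m mE] := dvdnP dc.
  have cm : (m = b %/ i)%N.
    have -> : b = (m * i + (b - c.+1))%N :> nat by lia.
    by rewrite divnMDl // divn_small ?addn0 //; lia.
  have := divn_eq b i; rewrite -cm -mE => bE.
  by split; [done | lia | apply/eqP; lia].
case: (boolP (_ && _)) => [/andP[/eqP ea be]|ne]; last first.
  rewrite mxE big1 ?subr0 // => c _; rewrite expX YmE_neps // /Efun.
  case: eqP => [e|_]; last by rewrite !mul0r.
  case: (boolP [&& _, _ & _]) => [/and3P[dc cb bc]|_]; last first.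
    by rewrite mul0r oppr0 mulr0.
  have [_ _ h] := split_b c dc cb bc.
  by move: ne; rewrite h andbT e -dvdS dc.
rewrite {1}/Efun ea eq_sym (negPf be) mul0r add0r mxE -sumrN.
case b0 : (b %/ i)%N => [|p].
  rewrite /sbin mulr0 big1 // => c _; rewrite YmE_neps //.
  case: (boolP [&& _, _ & _]) => [/and3P[dc cb bc]|_]; last first.
    by rewrite mul0r oppr0 mulr0 oppr0.
  by have [] := split_b c dc cb bc; rewrite b0.
rewrite sbinSS.
have bE : b = (p.+1 * i + b %% i)%N :> nat by rewrite {1}(divn_eq b i) b0.
have cn : (p * i + i.-1 < n)%N by apply: leq_ltn_trans _ bn; rewrite bE mulSn; lia.
rewrite (bigD1 (Ordinal cn)) //= big1 ?addr0; last first.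
  move=> c ne; rewrite expX YmE_neps // /Efun.
  case: (boolP [&& _, _ & _]) => [/and3P[dc cb bc]|_]; last first.
    by rewrite mul0r oppr0 mulr0 oppr0.
  have [e _ _] := split_b c dc cb bc.
  case/eqP: ne; apply: val_inj => /=; move: e; rewrite b0 mulSn; lia.
rewrite expX YmE_neps //= /Efun modnMDl divnMDl // (modn_small (_ : i.-1 < i)%N); last by lia.
rewrite (divn_small (_ : i.-1 < i)%N); last by lia.
rewrite ea eqxx addn0 mul1r mulrN opprK.
have -> : [&& i %| (p * i + i.-1).+1, p * i + i.-1 < b & b < p * i + i.-1 + i]%N.
  apply/and3P; split; first by rewrite dvdS modnMDl modn_small //; lia.
    by rewrite bE mulSn; lia.
  by rewrite bE mulSn; move/eqP: be; lia.
rewrite mul1r mulrC; congr ('C(_, _)%:R * _).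
by rewrite {1}bE mulSn; lia.
Qed.

End ClosedForms.

(** * The identity K g S = S' g *)

Section KeyIdentity.
Variables (F : fieldType) (i n : nat).
Hypothesis char0 : [pchar F] =i pred0.
Hypothesis i_gt0 : (0 < i)%N.
Hypothesis i_ltn : (i < n)%N.
Hypothesis n_pm1 : ((i %| n.-1) || (i %| n.+1))%N.

Local Notation eps := (eps_bool i n).
Local Notation Afun := (Afun F i).
Local Notation Gfun := (Gfun F i n).
Local Notation Efun := (Efun F i n).
Local Notation sbin := (sbin F).
Local Notation colen := (colen i n).

Lemma eps_modn : eps -> (n %% i = 1)%N.
Proof. by move/eqP. Qed.

(** The case i = 1 falls here, since the residue of [n] is then 0 and not 1; the conclusion is
    trivial for it. *)
Lemma neps_dvdn : eps = false -> (i %| n.+1)%N.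
Proof.
move=> e; case/orP: n_pm1 => // /dvdnP[m mE].
case: (ltnP 1 i) => i1; last first.
  by have -> : i = 1%N by lia.
by move: e; rewrite /eps_bool (_ : n = (m * i + 1)%N) ?modnMDl ?modn_small //; lia.
Qed.

Lemma coprime_in : coprime i n.
Proof.
have h k : (k %| i)%N -> (k %| n)%N -> k = 1%N.
  move=> ki kn; apply/eqP; rewrite -dvdn1.
  case/orP: n_pm1 => d; have kd := dvdn_trans ki d.
    by rewrite -(dvdn_addr _ kd) addn1 (prednK (leq_ltn_trans (leq0n i) i_ltn)).
  by rewrite -(dvdn_addr _ kn) addn1.
by rewrite /coprime (h (gcdn i n)) // ?dvdn_gcdl ?dvdn_gcdr.
Qed.

Lemma sbin_pascal c x y : sbin c x.+1 y + sbin c.+1 x y = sbin c x.+1 y.+1.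
Proof.
rewrite sbinSS /sbin; case: (ltngtP x y) => [xy|xy|->].
- have -> : (y - x = (y - x.+1).+1)%N by lia.
  by rewrite binS natrD exprS; ring.
- by rewrite addr0.
- by rewrite subnn !bin0 add0r.
Qed.

Lemma sbin_gt c x y : (c + x < y)%N -> sbin c x y = 0.
Proof. by move=> h; rewrite /sbin bin_small ?mulr0; [case: ifP | lia]. Qed.

Lemma sbin_lt c x y : (y < x)%N -> sbin c x y = 0.
Proof. by move=> h; rewrite /sbin leqNgt h. Qed.

Lemma divn_shift a : (i <= a)%N -> (a %/ i = ((a - i) %/ i).+1)%N.
Proof. by move=> ia; rewrite -{1}(subnK ia) divnDr // divnn i_gt0 addn1. Qed.

Lemma modn_shift a : (i <= a)%N -> ((a - i) %% i = a %% i)%N.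
Proof. by move=> ia; rewrite -{2}(subnK ia) modnDr. Qed.

(** Pascal's rule, as [colen] drops by one from row a - i to row a: adding the row shifted by [i]
    amounts to shifting the columns. *)
Lemma Gfun_shift e a b : (i <= a)%N -> (a < n)%N ->
  Gfun e a b + Gfun e (a - i) b = Gfun e a (b + i).
Proof.
move=> ia an; rewrite /Gfun /Efun modnDr modn_shift //.
have -> : ((b + i) %/ i = (b %/ i).+1)%N by rewrite divnDr // divnn i_gt0 addn1.
have cE : colen (a - i) = (colen a).+1
  by rewrite (colen_sub i_gt0 i_ltn (a := a - i)) subnK.
rewrite divn_shift // cE.
case: e; case: ifP => _; rewrite -sbin_pascal; ring.
Qed.

Lemma Gfun_lower e a b : (i <= a)%N -> (b < i)%N -> Gfun e a b = 0.
Proof.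
move=> ia bi; rewrite /Gfun /Efun (divn_small bi) divn_shift // !sbin_lt //.
by rewrite !mulr0 oppr0; case: e; case: ifP.
Qed.

Lemma Gfun_id e a b : (a < i)%N -> (b < i)%N -> Gfun e a b = (a == b)%:R.
Proof.
move=> ai bi; rewrite /Gfun /Efun (divn_small bi) (divn_small ai).
rewrite (modn_small ai) (modn_small bi) !(@sbin_lt _ 1 0) // /sbin /= bin0 !mulr1 !mulr0 oppr0.
case: e; case: ifP => // /andP[/eqP h1 h2].
  by rewrite (_ : (a == b) = false) //; lia.
by rewrite (_ : (a == b) = false) //; lia.
Qed.

Lemma Efun_large a b : (a < n)%N -> (n <= b)%N -> Efun a b = 0.
Proof.
move=> an nb; rewrite /Efun; case: eqP => [e|_]; last by rewrite mul0r.
rewrite sbin_gt ?mulr0 // /colen.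
have h1 := divn_eq a i; have h2 := divn_eq b i.
have ab : (a %/ i <= b %/ i)%N by apply: leq_div2r; apply: ltnW (leq_trans an nb).
rewrite addnC -ltn_subRL ltn_divLR // mulnBl.
have := leq_mul ab (leqnn i); move: h1 h2; rewrite -e.
by move: (a %/ i * i)%N (b %/ i * i)%N (a %% i)%N; clear -an nb; lia.
Qed.

(** The congruence fixes the length of the last, incomplete block, and with it [colen]: past the
    last column every binomial has its lower index above its upper one. *)
Lemma Gfun_large a b : (a < n)%N -> (n <= b)%N -> Gfun eps a b = 0.
Proof.
move=> an nb; rewrite /Gfun Efun_large //.
have h1 := divn_eq a i; have h2 := divn_eq b i.
have h3 := ltn_pmod a i_gt0; have h4 := ltn_pmod b i_gt0.
case: (boolP eps) => [e|/negbTE e].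
  have [q nE] : exists q, n = (q * i + 1)%N.
    by exists (n %/ i)%N; rewrite -(eps_modn e) -divn_eq.
  case: ifP => // /andP[/eqP b0 a0].
  rewrite sbin_gt ?mulr0 ?oppr0 // /colen.
  move: (a %/ i)%N (a %% i)%N (b %/ i)%N (b %% i)%N h1 h2 h3 h4 a0 b0.
  move=> pa sa pb sb h1 h2 h3 h4 a0 b0; clear e n_pm1.
  have bq : (q < pb)%N.
    rewrite ltnNge; apply/negP => h; have := leq_mul h (leqnn i).
    by clear -h2 b0 nE nb; lia.
  have aq : (pa < q)%N.
    rewrite ltnNge; apply/negP => h; have := leq_mul h (leqnn i).
    by clear -h1 a0 nE an; lia.
  have -> : (n - a.+1 = (q - pa.+1) * i + (i - sa))%N.
    rewrite mulnBl; have := leq_mul aq (leqnn i); rewrite !mulSn.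
    by clear -h1 h3 nE; lia.
  rewrite divnMDl // divn_small; last by clear -a0 h3; lia.
  by clear -aq bq; lia.
have [q nE] := dvdnP (neps_dvdn e).
case: ifP => // /andP[/eqP a0 /eqP b0].
rewrite sbin_gt ?mulr0 // /colen.
move: (a %/ i)%N (a %% i)%N (b %/ i)%N (b %% i)%N h1 h2 h3 h4 a0 b0.
move=> pa sa pb sb h1 h2 h3 h4 a0 b0; clear e n_pm1.
have bq : (q <= pb)%N.
  rewrite leqNgt; apply/negP => h; have := leq_mul h (leqnn i); rewrite mulSn.
  by clear -h2 h4 b0 nE nb; lia.
have aq : (pa.+1 < q)%N.
  rewrite ltnNge; apply/negP => h; have := leq_mul h (leqnn i); rewrite mulSn.
  by clear -h1 h3 a0 nE an; lia.
have -> : (n - a.+1 = (q - pa.+2) * i + i.-1)%N.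
  rewrite mulnBl; have := leq_mul aq (leqnn i); rewrite !mulSn.
  by clear -h1 h3 a0 nE; lia.
rewrite divnMDl // divn_small; last by clear -i_gt0; lia.
by clear -aq bq; lia.
Qed.

(* [(-1)^k * Qfun] is the upper right i x i block of exp(-X)exp(-Y). *)
Definition Qfun (e : bool) (s t : nat) : F :=
  if e then - (s == t.+1)%:R + (t.+1 == i)%:R * 'C(i, s)%:R
  else (s.+1 == i)%:R * 'C(i, t)%:R - (s.+1 == t)%:R.

(** In the last [i] columns each surviving binomial of [sbin] is of the form C(c, c) or C(c, 0); up
    to one common sign only coefficients of Y and a partial shift remain. *)
Lemma Gfun_corner : exists k, forall s t, (s < i)%N -> (t < i)%N ->
  Gfun eps s (n - i + t) = (-1) ^+ k * Qfun eps s t.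
Proof.
case: (boolP eps) => [e|/negbTE e].
  have [q nE] : exists q, n = (q * i + 1)%N.
    by exists (n %/ i)%N; rewrite -(eps_modn e) -divn_eq.
  have i1 : (1 < i)%N by have := eps_modn e; case: (i) i_gt0 => [|[|]] //; rewrite modn1.
  have q0 : (0 < q)%N by case: (q) nE => //; clear -i_gt0 i_ltn; lia.
  clear e n_pm1.
  exists q => s t si ti; rewrite /Gfun /Efun /Qfun (modn_small si) (divn_small si).
  case: (t.+1 =P i) => [ti1|/eqP tne].
  - have -> : (n - i + t = q * i + 0)%N by nia.
    rewrite modnMDl divnMDl // mod0n div0n addn0 eqxx /=.
    rewrite (_ : (s == t.+1) = false); last by lia.
    rewrite mul1r oppr0 add0r; case: (posnP s) => [->|s0].
      rewrite mul1r /sbin subn0 bin0 mulr1 /colen.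
      by rewrite (_ : (n - 1 = q * i)%N) ?mulnK ?binn ?mulr1 //; lia.
    rewrite /colen (_ : (n - s.+1 = q.-1 * i + (i - s))%N); last by nia.
    rewrite divnMDl // divn_small ?addn0; last by lia.
    by case: q q0 {nE} => // q _; rewrite sbinSS /sbin subn0 binn exprS /=; ring.
  - have ti1 : (t.+1 < i)%N by lia.
    have -> : (n - i + t = q.-1 * i + t.+1)%N by nia.
    rewrite modnMDl divnMDl // (modn_small ti1) (divn_small ti1) addn0 /= mul0r addr0.
    case: eqP => [sE|_]; last by rewrite !mul0r oppr0 mulr0.
    rewrite /colen (_ : (n - s.+1 = q.-1 * i + (i - s))%N); last by nia.
    rewrite divnMDl // divn_small ?addn0; last by lia.
    by case: q q0 {nE} => // q _; rewrite /sbin subn0 binn exprS /=; ring.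
have [q nE] := dvdnP (neps_dvdn e).
have q1 : (1 < q)%N.
  by case: (q) nE => [|[|?]] //; clear -i_gt0 i_ltn; rewrite ?mul1n; lia.
clear e n_pm1.
exists q => s t si ti; rewrite /Gfun /Efun /Qfun (modn_small si) (divn_small si).
have qE : exists p, q = p.+2 by exists q.-2; lia.
case: qE nE q1 => p -> nE _ {q}.
have cE1 : (s.+1 = i)%N -> colen s = p.
  move=> si1; rewrite /colen (_ : (n - s.+1 = p * i + i.-1)%N); last by nia.
  by rewrite divnMDl // divn_small ?addn0; lia.
have cE2 : (s.+1 < i)%N -> colen s = p.+1.
  move=> si1; rewrite /colen (_ : (n - s.+1 = p.+1 * i + (i - s.+2))%N); last by nia.
  by rewrite divnMDl // divn_small ?addn0; lia.
have sE : (s == i.-1) = (s.+1 == i) by lia.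
case: (posnP t) => [->|t0].
  have -> : (n - i + 0 = p * i + i.-1)%N.
    by move: nE; rewrite !mulSn; clear -i_gt0; lia.
  rewrite modnMDl divnMDl // (modn_small (_ : i.-1 < i)%N); last by lia.
  rewrite (divn_small (_ : i.-1 < i)%N); last by lia.
  rewrite eqxx andbF addn0 sE bin0 subr0.
  case: eqP => [si1|_]; last by rewrite !mul0r mulr0.
  by rewrite cE1 // /sbin subn0 binn !exprS /=; ring.
have -> : (n - i + t = p.+1 * i + t.-1)%N.
  by move: nE; rewrite !mulSn; clear -i_gt0 t0; lia.
rewrite modnMDl divnMDl // (modn_small (_ : t.-1 < i)%N); last by lia.
rewrite (divn_small (_ : t.-1 < i)%N); last by lia.
rewrite addn0 sE prednK // (_ : (t.-1 != i.-1)); last by lia.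
rewrite andbT; case: (s.+1 =P i) => [si1|si1].
  rewrite sbinSS cE1 // (_ : (s.+1 == t) = false); last by lia.
  by rewrite /sbin subn0 binn !exprS /=; ring.
rewrite (_ : (s == t.-1) = (s.+1 == t)); last by clear -t0; lia.
case: eqP => st; last by rewrite !mul0r subr0 mulr0.
by rewrite cE2 /sbin ?subn0 ?binn ?exprS /=; [ring | lia].
Qed.

Lemma bin_mul_sub m s : (s <= m)%N -> (m <= i)%N ->
  ('C(i, s) * 'C(i - s, m - s) = 'C(i, m) * 'C(m, s))%N.
Proof.
move=> sm mi.
have h1 := bin_fact (leq_trans sm mi); have h2 := bin_fact mi.
have h3 := bin_fact sm.
have h4 : ('C(i - s, m - s) * ((m - s)`! * (i - m)`!) = (i - s)`!)%N.
  by rewrite -(@bin_fact (i - s) (m - s)) ?leq_sub2r // subnBA // subnK //; lia.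
have p1 := fact_gt0 s; have p2 := fact_gt0 (m - s); have p3 := fact_gt0 (i - m).
apply/eqP; rewrite -(@eqn_pmul2r (s`! * ((m - s)`! * (i - m)`!))); last first.
  by rewrite !muln_gt0 p1 p2 p3.
apply/eqP; transitivity (i`!).
  by rewrite -h1 -h4; ring.
by rewrite -h2 -h3; ring.
Qed.

Lemma alt_bin_sum m : (0 < m)%N ->
  \sum_(s < m.+1) (-1) ^+ (m - s) * 'C(m, s)%:R = 0 :> F.
Proof.
move=> m0; have := exprDn (-1 : F) 1 m; rewrite addNr expr0n.
case: m m0 => // m _ /= e; apply: etrans (esym e); apply: eq_bigr => s _.
by rewrite expr1n mulr1 mulr_natr.
Qed.

(** The upper left block of the conjugated matrix: a difference operator in one case, a summation
    operator in the other. *)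
Definition Pfun (e : bool) (a b : nat) : F :=
  if e then (a == b)%:R - (b == a.+1)%:R else (a <= b)%N%:R.

Lemma Afun_diff a s : (a < i)%N -> (s < i)%N ->
  Afun true a s - Afun true a.+1 s =
  - (if (s <= a.+1)%N then (-1) ^+ (a.+1 - s) * 'C(i - s, a.+1 - s)%:R else 0).
Proof.
move=> ai si; rewrite /Afun (modn_small si).
case: (leqP s a) => sa; last first.
  case: (leqP s a.+1) => sa1; last by rewrite subrr oppr0.
  by rewrite (_ : (a.+1 - s = 0)%N) ?bin0 ?sub0r //; lia.
rewrite leqW // subSn // (_ : (i - s = (i.-1 - s).+1)%N); last by lia.
by rewrite binS natrD exprS; ring.
Qed.

(** P takes differences of consecutive rows of A Q, and by Pascal's rule the differences of A are
    signed binomials again; the last column of Q produces an alternating binomial sum. *)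
Lemma PAQ_eps a t : (a < i)%N -> (t < i)%N ->
  \sum_(c < i) Pfun true a c * (\sum_(s < i) Afun true c s * Qfun true s t) =
  Afun true a t.
Proof.
move=> ai ti; pose U c := \sum_(s < i) Afun true c s * Qfun true s t.
transitivity (U a - U a.+1).
  transitivity (\sum_(c < i) (c == a :> nat)%:R * U c -
                \sum_(c < i) (c == a.+1 :> nat)%:R * U c).
    rewrite -sumrB; apply: eq_bigr => c _.
    by rewrite /Pfun [a == _]eq_sym mulrBl.
  rewrite !sum_delta_nat ai mul1r; case: ltnP => ai1; first by rewrite mul1r.
  congr (_ - _); rewrite mul0r /U big1 // => s _.
  rewrite /Afun (modn_small (ltn_ord s)) bin_small ?mulr0; last first.
    by have := ltn_ord s; lia.
  by case: ifP; rewrite mul0r.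
rewrite /U -sumrB; under eq_bigr => s _ do rewrite -mulrBl Afun_diff //.
pose B s : F := if (s <= a.+1)%N
   then (-1) ^+ (a.+1 - s) * 'C(i - s, a.+1 - s)%:R else 0.
transitivity (\sum_(s < i) (s == t.+1 :> nat)%:R * B s -
   (t.+1 == i)%:R * \sum_(s < i) B s * 'C(i, s)%:R).
  rewrite mulr_sumr -sumrB; apply: eq_bigr => s _.
  by rewrite -/(B s) /Qfun; ring.
rewrite sum_delta_nat; case: (ltngtP t.+1 i) => [ti1|ti1|ti1].
- rewrite mul1r mul0r subr0 /B /Afun ltnS subSS (modn_small ti).
  by rewrite (_ : (i - t.+1 = i.-1 - t)%N) //; lia.
- by lia.
rewrite mul0r mul1r sub0r.
have BE s : (s <= a.+1)%N -> B s * 'C(i, s)%:R =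
    'C(i, a.+1)%:R * ((-1) ^+ (a.+1 - s) * 'C(a.+1, s)%:R).
  move=> sa; rewrite /B sa -mulrA [X in _ * X = _]mulrC -natrM bin_mul_sub //.
  by rewrite natrM; ring.
have full : \sum_(s < a.+2) B s * 'C(i, s)%:R = 0.
  under eq_bigr => s _ do rewrite BE -1?ltnS //.
  by rewrite -mulr_sumr alt_bin_sum // mulr0.
(* The vanishing sum runs over s <= a + 1. For a + 1 < i all its terms are present; for a + 1 = i
   the term s = i is missing, which leaves the diagonal entry 1. *)
case: (ltnP a.+1 i) => ai1.
  rewrite /Afun (_ : (t <= a)%N = false); last by lia.
  rewrite -[RHS]oppr0; congr (- _); apply: etrans full.
  rewrite [RHS](big_ord_widen i (fun s => B s * 'C(i, s)%:R)) // [RHS]big_mkcond.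
  apply: eq_bigr => s _; case: ltnP => // sa.
  by rewrite /B leqNgt sa mul0r.
have aE : a.+1 = i by lia.
move: full; rewrite aE big_ord_recr /= => /eqP; rewrite addr_eq0 => /eqP ->.
rewrite opprK /B aE leqnn subnn !bin0 binn /Afun mulr1 expr0 mulr1.
have -> : t = a by clear -aE ti1; lia.
by rewrite leqnn subnn bin0 mulr1.
Qed.

(** The rows of A Q are consecutive differences of C(c, t), cut off at c = i by the last row of Q,
    so the summation by P telescopes. *)
Lemma PAQ_neps a t : (a < i)%N -> (t < i)%N ->
  \sum_(c < i) Pfun false a c * (\sum_(s < i) Afun false c s * Qfun false s t) =
  Afun false a t.
Proof.
move=> ai ti; pose W c : F := if (c < i)%N then 'C(c, t)%:R else 0.
have UE (c : 'I_i) : \sum_(s < i) Afun false c s * Qfun false s t = W c - W c.+1.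
  have ci := ltn_ord c.
  transitivity (\sum_(s < i) (s == i.-1 :> nat)%:R * (Afun false c s * 'C(i, t)%:R)
     - (0 < t)%N%:R * \sum_(s < i) (s == t.-1 :> nat)%:R * Afun false c s).
    rewrite mulr_sumr -sumrB; apply: eq_bigr => s _; rewrite /Qfun.
    have -> : (s.+1 == i) = (s == i.-1 :> nat) by lia.
    have -> : (s.+1 == t) = (0 < t)%N && (s == t.-1 :> nat) by lia.
    by rewrite -mulnb natrM; ring.
  rewrite (sum_delta_nat _ (fun s => Afun false c s * 'C(i, t)%:R)).
  have i1 : (i.-1 < i)%N by clear -i_gt0; lia.
  have t1 : (t.-1 < i)%N by clear -ti; lia.
  rewrite sum_delta_nat i1 t1 !mul1r /W ci /Afun (modn_small ci).
  have -> : (if (t.-1 <= c)%N then 'C(c, c - t.-1)%:R else 0) = 'C(c, t.-1)%:R :> F.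
    by case: leqP => tc; rewrite ?bin_sub // bin_small.
  case: (ltnP c.+1 i) => ci1.
    have -> : (i.-1 <= c)%N = false by clear -ci1; lia.
    rewrite mul0r sub0r.
    case: (posnP t) => [->|t0]; first by rewrite mul0r !bin0 oppr0 subrr.
    by rewrite mul1r -(prednK t0) binS /= natrD opprD addrA subrr sub0r.
  have iE : i = c.+1 by clear -ci ci1; lia.
  have -> : 'C(i, t) = 'C(c.+1, t) by congr ('C(_, _)).
  have -> : i.-1 = c by clear -iE; lia.
  rewrite leqnn subnn bin0 mul1r subr0.
  case: (posnP t) => [->|t0]; first by rewrite mul0r !bin0 subr0.
  by rewrite mul1r -(prednK t0) binS /= natrD addrK.
under eq_bigr => c _ do rewrite UE.
transitivity (\sum_(a <= c < i) (W c - W c.+1)).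
  rewrite [RHS]big_geq_mkord [RHS]big_mkcond; apply: eq_bigr => c _ /=.
  by rewrite /Pfun; case: ifP; rewrite ?mul1r ?mul0r.
rewrite (_ : \sum_(a <= c < i) _ = - \sum_(a <= c < i) (W c.+1 - W c)); last first.
  by rewrite -sumrN; apply: eq_bigr => c _; rewrite opprB.
rewrite telescope_sumr ?(ltnW ai) // opprB /W ai ltnn subr0 /Afun (modn_small ai).
by case: leqP => ta; rewrite ?bin_sub // bin_small.
Qed.

Lemma PAQ e a t : (a < i)%N -> (t < i)%N ->
  \sum_(c < i) Pfun e a c * (\sum_(s < i) Afun e c s * Qfun e s t) = Afun e a t.
Proof. by case: e; [exact: PAQ_eps | exact: PAQ_neps]. Qed.

Lemma Afun_block e a b : (a %/ i != b %/ i)%N -> Afun e a b = 0.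
Proof.
move=> ne; rewrite /Afun; case: leqP => // ba.
have h1 := divn_eq a i; have h2 := divn_eq b i.
have h3 := ltn_pmod a i_gt0; have h4 := ltn_pmod b i_gt0.
have ab : (b %/ i < a %/ i)%N by rewrite ltn_neqAle eq_sym ne leq_div2r.
have := leq_mul ab (leqnn i); rewrite mulSn => h5.
have h6 : ((i.-1 - b %% i < a - b) && (a %% i < a - b))%N.
  move: h1 h2 h3 h4 h5.
  by move: (a %/ i * i)%N (b %/ i * i)%N (a %% i)%N (b %% i)%N; clear; lia.
by case/andP: h6 => ? ?; case: e; rewrite bin_small ?mulr0.
Qed.

Lemma Afun_shift e a b : Afun e (a + i) (b + i) = Afun e a b.
Proof. by rewrite /Afun leq_add2r subnDr !modnDr. Qed.

Lemma Afun_lt e a b : (a < b)%N -> Afun e a b = 0.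
Proof. by move=> ab; rewrite /Afun leqNgt ab. Qed.

Lemma Afun_diag e a : Afun e a a = 1.
Proof. by rewrite /Afun leqnn subnn !bin0 mulr1; case: e. Qed.

Lemma Gfun_gt e a b : (b < a)%N -> Gfun e a b = 0.
Proof.
move=> ba; have h1 := divn_eq a i; have h2 := divn_eq b i.
have h3 := ltn_pmod a i_gt0; have h4 := ltn_pmod b i_gt0.
have E0 : Efun a b = 0.
  rewrite /Efun; case: eqP => [e1|_]; last by rewrite mul0r.
  rewrite sbin_lt ?mulr0 // ltnNge; apply/negP => h.
  by have := leq_mul h (leqnn i); lia.
have S0 : sbin (colen a) (a %/ i).+1 (b %/ i) = 0.
  by rewrite sbin_lt // ltnS leq_div2r // ltnW.
by rewrite /Gfun E0 S0 !mulr0 oppr0; case: e; case: ifP.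
Qed.

Lemma Gfun_diag e a : Gfun e a a = 1.
Proof.
rewrite /Gfun /Efun eqxx /sbin leqnn subnn bin0 !mulr1.
by case: e; case: ifP => // /andP[/eqP ->]; rewrite ?eqxx.
Qed.

Definition Amx : 'M[F]_n := \matrix_(a, b) Afun eps a b.
Definition Gmx : 'M[F]_n := \matrix_(a, b) Gfun eps a b.

Lemma gmatE : gmat F i n = Amx *m Gmx.
Proof.
rewrite /gmat -mulmxA; congr (_ *m _); apply/matrixP => a b; rewrite [RHS]mxE.
  case: (boolP eps) => [e|/negbTE e]; first by rewrite expZ_eps // eps_modn.
  by rewrite expZ_neps // neps_dvdn.
case: (boolP eps) => [e|/negbTE e]; first by rewrite expXY_eps.
by rewrite expXY_neps.
Qed.

Lemma det_gmat : \det (gmat F i n) = 1.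
Proof.
rewrite gmatE det_mulmx -[\det Gmx]det_tr !det_trig; first last.
- by apply/is_trig_mxP => a b ab; rewrite mxE Afun_lt.
- by apply/is_trig_mxP => a b ab; rewrite !mxE Gfun_gt.
by rewrite !big1 ?mulr1 // => a _; rewrite !mxE ?Afun_diag ?Gfun_diag.
Qed.

Lemma gmat_unit : gmat F i n \in unitmx.
Proof. by rewrite unitmxE det_gmat unitr1. Qed.

Lemma gmat_in_p : in_p i (gmat F i n).
Proof.
rewrite gmatE; apply: in_pM => a b ia bi; rewrite mxE.
  rewrite Afun_block // (divn_small bi) divn_shift //.
exact: Gfun_lower.
Qed.

Lemma gmat_degree (a b : 'I_n) : hq i a < hq i b -> gmat F i n a b = 0.
Proof.
move=> ab; rewrite gmatE mxE big1 // => c _; rewrite !mxE.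
have [bi ci] := (ltn_pmod b i_gt0, ltn_pmod c i_gt0).
case: (ltP (hq i a) (hq i c)) => ac.
  rewrite (_ : Afun eps a c = 0) ?mul0r //.
  case: (eqVneq (a %/ i)%N (c %/ i)%N) => e; last exact: Afun_block.
  apply: Afun_lt; rewrite (divn_eq a i) (divn_eq c i) e ltn_add2l.
  by move: ac; rewrite /hq e; move: (_ %/ _)%N (_ %% _)%N (_ %% _)%N; clear; lia.
have {ac ab} := le_lt_trans ac ab.
suff main : hq i c < hq i b -> Gfun eps c b = 0 by move/main => ->; rewrite mulr0.
rewrite /hq /Gfun /Efun.
move: (b %/ i)%N (b %% i)%N (c %/ i)%N (c %% i)%N bi ci.
move=> pb sb pc sc bi ci cb.
have -> : (sc == sb)%:R * sbin (colen c) pc pb = 0.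
  case: eqP => [e|_]; last by rewrite mul0r.
  by rewrite sbin_lt ?mulr0 //; clear -cb e; lia.
case: (eps); case: ifP => // /andP[/eqP e1 e2]; rewrite sbin_lt ?mulr0 ?oppr0 //.
  by clear -cb e1 e2; lia.
by clear -cb e1 e2 bi ci; lia.
Qed.

(** The matrix S' that replaces [cyclic_mx] after conjugation: from row [i] on it is 1 plus the
    shift of [Gfun_shift], and its corner P is the one with P A Q = A. *)
Definition Smx : 'M[F]_n := \matrix_(a, b)
  if (a < i)%N then (b < i)%N%:R * Pfun eps a b
  else (a == b :> nat)%:R + (a == b + i :> nat)%N%:R.

Definition gfun a b : F := \sum_(k < n) Afun eps a k * Gfun eps k b.

Lemma gmat_gfun (a b : 'I_n) : gmat F i n a b = gfun a b.
Proof. by rewrite gmatE mxE; apply: eq_bigr => c _; rewrite !mxE. Qed.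

(** exp(-Z) commutes with shifting rows by [i], which reduces the claim to [Gfun_shift]; a column
    that wraps around gives 0 on both sides, by [Gfun_large] and [Gfun_lower]. *)
Lemma Smx_rows (a b : 'I_n) : (i <= a)%N ->
  (Smx *m gmat F i n) a b = (gmat F i n *m cyclic_mx F i_ltn) a b.
Proof.
move=> ia; have an := ltn_ord a; rewrite mulmx_cyclic mxE.
transitivity (gfun a b + gfun (a - i)%N b).
  transitivity (\sum_(c < n) (c == a :> nat)%:R * gfun c b +
                \sum_(c < n) (c == a - i :> nat)%N%:R * gfun c b).
    rewrite -big_split; apply: eq_bigr => c _ /=.
    rewrite mxE ltnNge ia /= gmat_gfun -mulrDl [a == c :> nat]eq_sym.
    by rewrite (_ : (a == c + i :> nat)%N = (c == a - i :> nat)%N) //; lia.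
  rewrite (sum_delta_nat _ (fun c => gfun c b)).
  rewrite (sum_delta_nat _ (fun c => gfun c b)) an mul1r.
  by rewrite (_ : (a - i < n)%N) ?mul1r //; lia.
rewrite gmat_gfun.
have -> : gfun (a - i)%N b =
    \sum_(k < n) (i <= k)%N%:R * (Afun eps a k * Gfun eps (k - i) b).
  rewrite /gfun -(big_mkord xpredT (fun k => Afun eps (a - i) k * Gfun eps k b)).
  rewrite -(big_mkord xpredT (fun k =>
     (i <= k)%N%:R * (Afun eps a k * Gfun eps (k - i) b))).
  rewrite [RHS](big_cat_nat (n := i)) //=; last by apply: ltnW.
  rewrite [X in _ = X + _]big_nat [X in _ = X + _]big1 ?add0r; last first.
    by move=> k /andP[_ ki]; rewrite leqNgt ki mul0r.
  rewrite [LHS](big_cat_nat (n := n - i)) //=; last by apply: leq_subr.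
  rewrite [X in _ + X]big_nat [X in _ + X]big1 ?addr0; last first.
    by move=> k /andP[ki _]; rewrite Afun_lt ?mul0r //; lia.
  rewrite -[in RHS](add0n i) big_addn; apply: eq_bigr => k _.
  rewrite leq_addl mul1r addnK; congr (_ * _).
  by rewrite -(Afun_shift _ (a - i)) subnK.
rewrite /gfun -big_split; apply: eq_bigr => k _ /=.
have kn := ltn_ord k; have bn := ltn_ord b.
case: (leqP i k) => ik; last first.
  by rewrite Afun_block ?mul0r ?mulr0 ?addr0 // (divn_small ik) divn_shift.
rewrite mul1r -mulrDr Gfun_shift //; congr (_ * _).
case: (ltnP (b + i) n) => bi; first by rewrite modn_small.
rewrite Gfun_large // Gfun_lower //.
by rewrite -{1}(subnK bi) modnDr modn_small; lia.
Qed.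

Lemma sum_restrict (f : nat -> F) :
  \sum_(c < n) (c < i)%N%:R * f c = \sum_(c < i) f c.
Proof.
rewrite (big_ord_widen n f (ltnW i_ltn)) [RHS]big_mkcond.
by apply: eq_bigr => c _; case: ltnP; rewrite ?mul1r ?mul0r.
Qed.

Lemma gfun_top a b : (a < i)%N ->
  gfun a b = \sum_(s < i) Afun eps a s * Gfun eps s b.
Proof.
move=> ai; rewrite -(sum_restrict (fun s => Afun eps a s * Gfun eps s b)).
apply: eq_bigr => k _; case: ltnP => ik; first by rewrite mul1r.
by rewrite Afun_block ?mul0r // (divn_small ai) divn_shift.
Qed.

(** In its first [i] rows, [g] is A times a matrix whose left block is 1 and whose right block is a
    sign times Q, so the claim is P A Q = A. *)
Lemma Smx_corner : exists2 k : F, k != 0 &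
  forall a b : 'I_n, (a < i)%N -> (b < i)%N ->
  (Smx *m gmat F i n *m (cyclic_mx F i_ltn)^T) a b = k * gmat F i n a b.
Proof.
have [q Q] := Gfun_corner; exists ((-1) ^+ q); first by rewrite signr_eq0.
move=> a b ai bi.
have b'n : (n - i + b < n)%N by lia.
have bE : b = tauO i_ltn (Ordinal b'n).
  apply: val_inj => /=; rewrite (_ : (n - i + b + i = b + n)%N); last by lia.
  by rewrite modnDr modn_small.
rewrite {1}bE mul_cyclicT mxE.
transitivity (\sum_(c < i) Pfun eps a c * gfun c (n - i + b)%N).
  rewrite -(sum_restrict (fun c => Pfun eps a c * gfun c (n - i + b)%N)).
  by apply: eq_bigr => c _; rewrite mxE ai gmat_gfun mulrA.
transitivity ((-1) ^+ q * \sum_(c < i) Pfun eps a c *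
    \sum_(s < i) Afun eps c s * Qfun eps s b).
  rewrite mulr_sumr; apply: eq_bigr => c _; rewrite gfun_top // mulrCA.
  congr (_ * _); rewrite mulr_sumr; apply: eq_bigr => s' _.
  by rewrite Q // mulrCA.
rewrite PAQ // gmat_gfun gfun_top //; congr (_ * _).
transitivity (\sum_(s < i) (s == b :> nat)%:R * Afun eps a s).
  by rewrite (sum_delta_nat _ (fun s => Afun eps a s)) bi mul1r.
by apply: eq_bigr => s' _; rewrite Gfun_id // mulrC.
Qed.

Lemma key_identity : exists K (k : F), [/\ K \in unitmx,
  forall a b : 'I_n, (i <= a)%N -> K a b = (a == b)%:R,
  forall a b : 'I_n, (a < i)%N -> (b < i)%N -> K a b = k * (a == b)%:R &
  K *m gmat F i n *m cyclic_mx F i_ltn = Smx *m gmat F i n].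
Proof.
have [k k0 corner] := Smx_corner; set g := gmat F i n in corner *.
have ug : g \in unitmx by exact: gmat_unit.
set C := cyclic_mx F i_ltn in corner *.
have CK : C^T *m C = 1%:M by apply: cyclic_mxK.
have CK' : C *m C^T = 1%:M by apply: mulmx1C.
(* Forced by the identity to be proved, since [C^T] inverts [C]. *)
pose K := Smx *m g *m C^T *m invmx g.
have Kg : K *m g = Smx *m g *m C^T by rewrite mulmxKV.
have Klow (a b : 'I_n) : (i <= a)%N -> K a b = (a == b)%:R.
  move=> ia; have -> : (a == b)%:R = (g *m C *m C^T *m invmx g) a b.
    by rewrite -[g *m C *m _]mulmxA CK' mulmx1 mulmxV // mxE.
  have -> : K = (Smx *m g) *m (C^T *m invmx g) by rewrite /K !mulmxA.
  rewrite -[g *m C *m _ *m _]mulmxA [LHS]mxE [RHS]mxE.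
  by apply: eq_bigr => c _; rewrite Smx_rows.
have Kup (a b : 'I_n) : (a < i)%N -> (b < i)%N -> K a b = k * (a == b)%:R.
  move=> ai bi; have -> : k * (a == b)%:R = (k *: g *m invmx g) a b.
    by rewrite -scalemxAl mulmxV // !mxE.
  apply/eqP; rewrite -subr_eq0; apply/eqP.
  rewrite /K [X in X - _]mxE [X in _ - X]mxE -sumrB big1 // => c _.
  case: (ltnP c i) => ci; first by rewrite corner // [X in _ - X * _]mxE subrr.
  by rewrite (in_p_inv ug gmat_in_p) // !mulr0 subrr.
exists K, k; split => //; last by rewrite Kg -[LHS]mulmxA CK mulmx1.
rewrite unitmxE unitfE -det_tr det_trig; last first.
  apply/is_trig_mxP => a b ab; rewrite mxE.
  case: (leqP i b) => ib; first by rewrite Klow // -val_eqE gtn_eqF.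
  by rewrite Kup ?(ltn_trans ab) // -val_eqE gtn_eqF // mulr0.
apply/prodf_neq0 => a _; rewrite mxE; case: (leqP i a) => ia.
  by rewrite Klow // eqxx oner_eq0.
by rewrite Kup // eqxx mulr1.
Qed.

End KeyIdentity.

(** * The Frobenius functional *)

Section Frobenius.
Variables (F : fieldType) (i n : nat).
Hypothesis i_gt0 : (0 < i)%N.
Hypothesis i_ltn : (i < n)%N.
Hypothesis n_pm1 : ((i %| n.-1) || (i %| n.+1))%N.

Local Notation eps := (eps_bool i n).
Local Notation Smx := (Smx F i n).
Local Notation h := (fun a : 'I_n => hq i a).

Lemma hq_small a : (a < i)%N -> hq i a = Posz a.
Proof. by move=> ai; rewrite /hq modn_small // divn_small // subr0. Qed.

Lemma hq_shift a : hq i (a + i) = hq i a - 1.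
Proof. by rewrite /hq modnDr divnDr // divnn i_gt0; lia. Qed.

Lemma Smx_pos (a b : 'I_n) : 0 < h a - h b -> Smx a b = 0.
Proof.
rewrite /= mxE; case: ltnP => ai; last first.
  case: eqP => [->|_]; first by rewrite subrr.
  by case: eqP => [->|_]; [rewrite hq_shift; lia | rewrite addr0].
case: ltnP => bi; last by rewrite mul0r.
rewrite !hq_small // mul1r /Pfun => ab.
case: eps; last by rewrite leqNgt (_ : (b < a)%N) //; lia.
have -> : (a == b :> nat) = false by clear -ab; lia.
have -> : (b == a.+1 :> nat) = false by clear -ab; lia.
by rewrite subrr.
Qed.

Lemma Smx_zero (a b : 'I_n) : h a - h b = 0 -> Smx a b = (a == b)%:R.
Proof.
rewrite /= mxE -val_eqE /=; case: ltnP => ai; last first.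
  case: (a =P (b + i)%N :> nat) => [->|_]; last by rewrite addr0.
  by rewrite hq_shift; lia.
case: ltnP => bi; last by rewrite mul0r ltn_eqF // (leq_trans ai).
rewrite !hq_small // mul1r /Pfun => ab.
have -> : nat_of_ord a = b by clear -ab; lia.
rewrite eqxx; case: eps; last by rewrite leqnn.
by rewrite ltn_eqF // subr0.
Qed.

Definition sgJ : F := if eps then -1 else 1.

Lemma JE (a b : 'I_n) : grade h (-1) Smx a b =
  if (a < i)%N then ((b < i)%N && (b == a.+1 :> nat))%:R * sgJ
  else (a == b + i :> nat)%N%:R.
Proof.
rewrite mxE mxE; case: ltnP => ai; last first.
  case: (a =P (b + i)%N :> nat) => [->|ab].
    rewrite hq_shift (_ : _ == -1); last by apply/eqP; lia.
    by rewrite (_ : (b + i == b)%N = false) ?add0r //; lia.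
  case: (a =P b :> nat) => [->|_]; first by rewrite subrr.
  by rewrite addr0; case: ifP.
case: ltnP => bi; last by rewrite !mul0r; case: ifP.
rewrite !hq_small // mul1r /= (_ : (_ == -1) = (b == a.+1 :> nat)); last first.
  by apply/eqP/eqP; lia.
case: eqP => [->|_]; last by rewrite mul0r.
rewrite /Pfun /sgJ mul1r; case: eps; last by rewrite leqnSn.
by rewrite eqxx ltn_eqF // sub0r.
Qed.

Section Centralizer.
Variable x : 'M[F]_n.
Hypothesis px : in_p i x.
Hypothesis nx : in_n i (lbr (grade h (-1) Smx) x).

(** [x] extended by zero to all naturals, so that shifted indices may leave the matrix. *)
Definition ext (a b : nat) : F :=
  oapp (fun a' => oapp (fun b' => x a' b') 0 (insub b)) 0 (insub a).

Lemma extE (a b : 'I_n) : ext a b = x a b.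
Proof. by rewrite /ext !valK. Qed.

Lemma ext_geqr a b : (n <= b)%N -> ext a b = 0.
Proof. by move=> nb; rewrite /ext [insub b]insubN -?leqNgt //; case: insub. Qed.

Lemma ext_geql a b : (n <= a)%N -> ext a b = 0.
Proof. by move=> nb; rewrite /ext [insub a]insubN -?leqNgt. Qed.

Lemma ext_p a b : (i <= a)%N -> (b < i)%N -> ext a b = 0.
Proof.
move=> ia bi; case: (ltnP a n) => an; last by rewrite ext_geql.
have bn := ltn_trans bi i_ltn.
by rewrite -[a]/(val (Ordinal an)) -[b]/(val (Ordinal bn)) extE px.
Qed.

Lemma mulJx (a b : 'I_n) : (grade h (-1) Smx *m x) a b =
  if (a < i)%N then (a.+1 < i)%N%:R * (sgJ * ext a.+1 b) else ext (a - i) b.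
Proof.
rewrite mxE; case: ltnP => ai.
  transitivity (\sum_(c < n) (c == a.+1 :> nat)%:R *
      ((c < i)%N%:R * (sgJ * ext c b))).
    apply: eq_bigr => c _; rewrite JE ai extE -mulnb natrM; ring.
  rewrite (sum_delta_nat _ (fun c => (c < i)%N%:R * (sgJ * ext c b))).
  case: (ltnP a.+1 i) => ai1; last by rewrite mul0r mulr0.
  by rewrite (_ : (a.+1 < n)%N) ?mul1r //; lia.
have an := ltn_ord a.
transitivity (\sum_(c < n) (c == a - i :> nat)%N%:R * ext c b).
  apply: eq_bigr => c _; rewrite JE ltnNge ai /= extE.
  by rewrite (_ : (a == c + i :> nat)%N = (c == a - i :> nat)%N) //; lia.
rewrite (sum_delta_nat _ (fun c => ext c b)) (_ : (a - i < n)%N) ?mul1r //; lia.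
Qed.

Lemma mulxJ (a b : 'I_n) : (x *m grade h (-1) Smx) a b =
  ext a (b + i) + (0 < b < i)%N%:R * (sgJ * ext a b.-1).
Proof.
have bn := ltn_ord b.
transitivity (\sum_(c < n) (c == b + i :> nat)%N%:R * ext a c +
  \sum_(c < n) (c == b.-1 :> nat)%N%:R * ((0 < b < i)%N%:R * (sgJ * ext a c))).
  rewrite mxE -big_split; apply: eq_bigr => c _ /=; rewrite JE extE.
  case: ltnP => ci.
    rewrite (_ : (c == b + i :> nat)%N = false) ?mul0r ?add0r; last by lia.
    rewrite (_ : (b < i)%N && (b == c.+1 :> nat) =
      (c == b.-1 :> nat) && (0 < b < i)%N); last by lia.
    by rewrite -mulnb natrM; ring.
  case: (boolP (0 < b < i)%N) => [bi|_]; last by rewrite !mul0r mulr0 addr0 mulrC.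
  rewrite (_ : (c == b.-1 :> nat) = false); last by lia.
  by rewrite mul0r addr0 mulrC.
rewrite (sum_delta_nat _ (fun c => ext a c)).
rewrite (sum_delta_nat _ (fun c => (0 < b < i)%N%:R * (sgJ * ext a c))).
rewrite (_ : (b.-1 < n)%N) ?mul1r; last by lia.
by congr (_ + _); case: ltnP => bi; rewrite ?mul1r // mul0r ext_geqr.
Qed.

Lemma centralizer (a b : 'I_n) : ~~ ((a < i)%N && (i <= b)%N) ->
  (grade h (-1) Smx *m x) a b = (x *m grade h (-1) Smx) a b.
Proof. by move=> ab; apply/eqP; rewrite -subr_eq0 -lbrE nx. Qed.

Lemma ext_diag a b : (i <= a)%N -> (a < n)%N -> ext (a - i) b = ext a (b + i).
Proof.
move=> ia an; case: (ltnP b n) => bn; last by rewrite !ext_geqr //; lia.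
have := @centralizer (Ordinal an) (Ordinal bn); rewrite mulJx mulxJ /= ltnNge ia /=.
move=> -> //; case: (boolP (0 < b < i)%N) => [/andP[b0 bi]|_].
  by rewrite [ext a b.-1]ext_p ?mulr0 ?addr0 //; lia.
by rewrite mul0r addr0.
Qed.

Lemma ext_top a b : (a < i)%N -> (b < i)%N ->
  (a.+1 < i)%N%:R * (sgJ * ext a.+1 b) =
  ext a (b + i) + (0 < b)%N%:R * (sgJ * ext a b.-1).
Proof.
move=> ai bi; have an := ltn_trans ai i_ltn; have bn := ltn_trans bi i_ltn.
have := @centralizer (Ordinal an) (Ordinal bn); rewrite mulJx mulxJ /= ai bi andbT.
by move=> -> //; rewrite -ltnNge bi.
Qed.

Lemma ext_iter a b t : (a + t * i < n)%N -> ext a b = ext (a + t * i) (b + t * i).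
Proof.
elim: t => [|t IH] at_n; first by rewrite mul0n !addn0.
rewrite IH; last by move: at_n; rewrite mulSn; lia.
rewrite mulSn [(i + _)%N]addnC !addnA -ext_diag ?addnK //; first by lia.
by move: at_n; rewrite mulSn; lia.
Qed.

(** Slide along (i, i) until the column has left the matrix while the row is still inside. *)
Lemma ext_vanish a b t : (a + t * i < n)%N -> (n <= b + t * i)%N -> ext a b = 0.
Proof. by move=> an bn; rewrite (ext_iter _ an) ext_geqr. Qed.

Lemma sgJ_neq0 : sgJ != 0.
Proof. by rewrite /sgJ; case: eps; rewrite ?oppr_eq0 oner_eq0. Qed.

(** Sliding kills the columns far to the right; how far depends on how many steps of [i] fit below
    row s. For these [n] only one row is exceptional: 0 when n = q i + 1, and i - 1 when n = q i -
    1. What is left is commutation with a regular nilpotent block of size i. *)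
Lemma ext_row s b : (s < i)%N -> ext s b = (s == b)%:R * ext 0 0.
Proof.
case: (boolP eps) => [e|/negbTE e].
  have [q nE] : exists q, n = (q * i + 1)%N.
    by exists (n %/ i)%N; rewrite -(eps_modn e) -divn_eq.
  (* Row 0 slides to the last row n - 1 = q i, so only its first entry can survive. *)
  have row0 k : (0 < k)%N -> ext 0 k = 0.
    by move=> k0; apply: (@ext_vanish _ _ q); lia.
  have far a k : (0 < a)%N -> (a < i)%N -> (i < k)%N -> ext a k = 0.
    move=> a0 ai ik; have q0 : (0 < q)%N by case: (q) nE => //; lia.
    have nE' : n = (q.-1 * i + i + 1)%N
      by move: nE; case: (q) q0 => // p _ -> /=; rewrite mulSn; clear; lia.
    by apply: (@ext_vanish _ _ q.-1); clear -nE' ai ik; lia.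
  have far' a k : (a < i)%N -> (i < k)%N -> ext a k = 0.
    by case: a => [|a] ai ik; [rewrite row0 //; lia | apply: far].
  have step a k : (a < i)%N -> (k.+1 < i)%N ->
      (a.+1 < i)%N%:R * ext a.+1 k.+1 = ext a k.
    move=> ai ki; have := ext_top ai ki; rewrite /= mul1r (far' a) //; last by lia.
    by rewrite add0r mulrCA => /(mulfI sgJ_neq0).
  (* Induction upwards from row i - 1, where the left-hand side of [ext_top] is zero. *)
  have below d a k : (k < a)%N -> (a + d = i.-1)%N -> ext a k = 0.
    elim: d a k => [|d IH] a k ka ad.
      rewrite -(step a k); [|clear -ad i_gt0; lia|clear -ka ad i_gt0; lia].
      have -> : (a.+1 < i)%N = false by clear -ad i_gt0; lia.
      exact: mul0r.
    rewrite -(step a k); [|clear -ad; lia|clear -ka ad; lia].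
    by rewrite (IH a.+1 k.+1) ?mulr0 //; clear -ad; lia.
  (* Column [i] escapes sliding; [ext_top] in column 0 ties it to the strictly lower part. *)
  have near a : (a < i)%N -> ext a i = 0.
    move=> ai; have := ext_top ai i_gt0; rewrite mul0r addr0 add0n => <-.
    case: ltnP => ai1; last by rewrite mul0r.
    by rewrite (below (i.-1 - a.+1)%N) ?mulr0 //; clear -ai1; lia.
  move=> si; case: (ltngtP s b) => [sb|sb|<-]; last first.
  - rewrite mul1r; elim: s si => // s IH si.
    by rewrite -(IH (ltnW si)) -(step s s) ?si ?mul1r // ltnW.
  - by rewrite mul0r (below (i.-1 - s)%N) //; clear -si; lia.
  rewrite mul0r; case: (ltngtP b i) => [bi|bi|->]; [|exact: far'|exact: near].
  elim: s b si sb bi => [|s IH] b si sb bi; first exact: row0.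
  have := @step s b.-1; rewrite prednK; last by lia.
  by rewrite si mul1r => -> //; [apply: IH | ]; clear -si sb bi; lia.
have [q nE] := dvdnP (neps_dvdn i_gt0 i_ltn n_pm1 e).
have q1 : (1 < q)%N by nia.
have qE : q = q.-2.+2 by clear -q1; lia.
have nE' : n.+1 = (q.-2 * i + i + i)%N by rewrite nE {1}qE !mulSn; clear; lia.
(* Rows before i - 1 slide q - 1 times, row i - 1 only q - 2 times. *)
have far1 a k : (a.+1 < i)%N -> (i.-1 <= k)%N -> ext a k = 0.
  by move=> ai ik; apply: (@ext_vanish _ _ q.-2.+1); rewrite mulSn; clear -nE' ai ik; lia.
have far2 k : (i.*2.-1 <= k)%N -> ext i.-1 k = 0.
  by move=> ik; apply: (@ext_vanish _ _ q.-2); clear -nE' i_gt0 ik; lia.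
have step a k : (a.+1 < i)%N -> (k.+1 < i)%N -> ext a.+1 k.+1 = ext a k.
  move=> ai ki; have := ext_top (ltnW ai) ki; rewrite /= ai !mul1r (far1 a) ?add0r; [|done|lia].
  by move/(mulfI sgJ_neq0).
have col0 a : (a.+1 < i)%N -> ext a.+1 0 = 0.
  move=> ai; have := ext_top (ltnW ai) i_gt0; rewrite ai mul1r mul0r addr0 (far1 a) //; last by lia.
  by move/eqP; rewrite mulf_eq0 (negPf sgJ_neq0) => /eqP.
have below a k : (k < a)%N -> (a < i)%N -> ext a k = 0.
  elim: k a => [|k IH] [|a] // ka ai; first exact: col0.
  by rewrite step ?IH //; clear -ka ai; lia.
have above d a k : (a < k)%N -> (k + d = i.-1)%N -> ext a k = 0.
  elim: d a k => [|d IH] a k ak kd; first by apply: far1; lia.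
  rewrite -(step a k); [|clear -ak kd; lia|clear -kd; lia].
  by apply: IH; clear -ak kd; lia.
move=> si; case: (ltngtP s b) => [sb|sb|<-]; last first.
- rewrite mul1r; elim: s si => // s IH si.
  by rewrite step ?IH // ltnW.
- by rewrite mul0r below.
rewrite mul0r; case: (ltnP b i) => bi; first by apply: (above (i.-1 - b)%N); lia.
case: (ltnP s.+1 i) => si1; first by apply: far1; lia.
(* Row i - 1 remains: columns from i to 2i - 1 are tied by [ext_top] to the strictly lower part,
   later ones vanish by sliding. *)
have -> : s = i.-1 by lia.
case: (ltnP b i.*2) => b2; last by apply: far2; lia.
have i1 : (i.-1 < i)%N by clear -i_gt0; lia.
have b1 : (b - i < i)%N by clear -b2 bi i_gt0; lia.
have := ext_top i1 b1; rewrite prednK // ltnn mul0r subnK // => /esym/eqP.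
rewrite addr_eq0 => /eqP ->.
case: (ltnP 0 (b - i)) => b0; last by rewrite mul0r oppr0.
by rewrite (below i.-1) ?mulr0 ?oppr0 //; clear -i_gt0 b0 b1; lia.
Qed.

Lemma centralizer_scalar : exists k, x = k%:M.
Proof.
exists (ext 0 0); apply/matrixP => a b; rewrite mxE -extE -mulr_natl.
rewrite -val_eqE /=; have an := ltn_ord a; have bn := ltn_ord b.
elim/ltn_ind: (val a) (val b) an bn => {a b} a IH b an bn.
case: (ltnP a i) => ai; first exact: ext_row.
case: (ltnP b i) => bi.
  by rewrite ext_p // (_ : (a == b) = false) ?mul0r //; lia.
have := ext_diag (b - i) ai an; rewrite subnK // => <-.
rewrite IH; try lia.
by rewrite (_ : (a - i == b - i)%N = (a == b)) //; lia.
Qed.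

End Centralizer.

End Frobenius.

(** * The pencil and its limits *)

Section Closure.
Variables (F : fieldType) (n : nat).
Hypothesis char0 : [pchar F] =i pred0.

Lemma natr_inj_char0 : injective (fun k => k%:R : F).
Proof.
move=> k l; wlog kl : k l / (k <= l)%N.
  by move=> H; case/orP: (leq_total k l) => kl e; [|symmetry]; apply: H.
rewrite /= -(subnK kl) natrD => /eqP; rewrite eq_sym -subr_eq0 addrK.
by rewrite (iffLR (pcharf0P F) char0) => /eqP ->.
Qed.

(** The N-th powers of 1, 2, 3, ... are distinct in characteristic zero, so no root extraction is
    needed. *)
Lemma poly_eq0_powers (N : nat) (p : {poly F}) : (0 < N)%N ->
  (forall t : F, t != 0 -> p.[t ^+ N] = 0) -> p = 0.
Proof.
move=> N0 pt; apply/eqP; apply: contraT => p0.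
pose rs := [seq (k.+1%:R ^+ N : F) | k <- iota 0 (size p)].
have /(_ rs) := max_poly_roots p0; rewrite size_map size_iota ltnn; apply.
  apply/allP => _ /mapP[k _ ->]; rewrite /root pt //.
  exact: char0_natr_neq0.
rewrite map_inj_uniq ?iota_uniq // => k l; rewrite -!natrX => /natr_inj_char0.
by move/eqP; rewrite eqn_exp2r // => /eqP[].
Qed.

(** A polynomial vanishing on [X] restricts to a polynomial in s on the line u + s v; it vanishes at
    all nonzero N-th powers, hence identically, in particular at s = 0. *)
Lemma zclosure_line (X : T2 F n -> Prop) (u v : T2 F n) (N : nat) : (0 < N)%N ->
  u != 0 -> (forall t : F, t != 0 -> X (u + t ^+ N *: v)) -> zclosure X u.
Proof.
move=> N0 u0 Xl; split => // d p _ pX.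
pose q : {poly F} := \sum_(m <- msupp p) (p@_m)%:P *
  \prod_k ((coords u k)%:P + coords v k *: 'X) ^+ m k.
have qE s : q.[s] = p.@[coords (u + s *: v)].
  rewrite mevalE horner_sum; apply: eq_bigr => m _.
  rewrite hornerM hornerC horner_prod; congr (_ * _); apply: eq_bigr => k _.
  rewrite horner_exp hornerD hornerZ hornerC hornerX /coords !ffunE.
  by congr ((_ + _) ^+ _); rewrite mulrC.
have q0 : q = 0.
  by apply: (poly_eq0_powers N0) => t t0; rewrite qE; apply: pX; apply: Xl.
by have := qE 0; rewrite q0 horner0 scale0r addr0 => <-.
Qed.

(** The equation is quadratic in the tensor: along the line its constant coefficient in s is the
    equation for [u] and its s^2 coefficient is the classical equation for [v]. *)
Lemma mcybe_line (k : F) (N : nat) (u v : T2 F n) : (0 < N)%N ->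
  (forall t : F, t != 0 -> mcybe k (u + t ^+ N *: v)) -> mcybe k u /\ mcybe 0 v.
Proof.
move=> N0 h.
pose Q (r s : T2 F n) x y := lbr (Rop r x) (Rop s y) -
  Rop r (lbr x (Rop s y)) - Rop r (lbr (Rop s x) y).
have QE r x y : lbr (Rop r x) (Rop r y) -
    Rop r (lbr x (Rop r y) + lbr (Rop r x) y) = Q r r x y.
  by rewrite RopD opprD addrA.
have add6 (A B C D G H : 'M[F]_n) :
    A + B - (C + D) - (G + H) = (A - C - G) + (B - D - H).
  by apply/matrixP => a b; rewrite !mxE; ring.
have QDl r1 r2 s x y : Q (r1 + r2) s x y = Q r1 s x y + Q r2 s x y.
  rewrite /Q !RopDl lbrDl; exact: add6.
have QDr r s1 s2 x y : Q r (s1 + s2) x y = Q r s1 x y + Q r s2 x y.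
  rewrite /Q !RopDl !lbrDr lbrDl !RopD; exact: add6.
have QZl l r s x y : Q (l *: r) s x y = l *: Q r s x y.
  by rewrite /Q !RopZl lbrZl !scalerBr.
have QZr l r s x y : Q r (l *: s) x y = l *: Q r s x y.
  by rewrite /Q !RopZl !lbrZr lbrZl !RopZ !scalerBr.
have expand s x y a b : Q (u + s *: v) (u + s *: v) x y a b =
    Q u u x y a b + s * (Q u v x y + Q v u x y) a b + s ^+ 2 * Q v v x y a b.
  rewrite !(QDl, QDr, QZl, QZr).
  by move: (Q u u x y) (Q u v x y) (Q v u x y) (Q v v x y) => *; rewrite !mxE; ring.
have key x y a b : Q u u x y a b = k * lbr x y a b /\ Q v v x y a b = 0.
  have := fun t t0 => congr1 (fun w : 'M[F]_n => w a b) (h t t0 x y).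
  move: (fun s => expand s x y a b).
  move: (Q u u x y a b) ((Q u v x y + Q v u x y) a b) (Q v v x y a b).
  move=> q0 q1 q2 qE e.
  pose p : {poly F} := (q0 - k * lbr x y a b)%:P + q1%:P * 'X + q2%:P * 'X^2.
  have p0 : p = 0.
    apply: (poly_eq0_powers N0) => t t0; rewrite /p !hornerE.
    have := e t t0; rewrite /= QE qE [in RHS]mxE => <-; ring.
  have c0 := congr1 (fun w : {poly F} => w`_0) p0.
  have c2 := congr1 (fun w : {poly F} => w`_2) p0.
  move: c0 c2; rewrite /p !coefE /= !mulr0 !mulr1 !addr0 !add0r.
  by move=> /eqP; rewrite subr_eq0 => /eqP.
split=> x y; rewrite QE; apply/matrixP => a b; rewrite [RHS]mxE.
  by have [] := key x y a b.
by rewrite mul0r; have [] := key x y a b.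
Qed.

End Closure.

(** * The action of the torus t^(2nH) *)

Section Torus.
Variables (F : fieldType) (i n : nat) (t : F).
Hypothesis t_neq0 : t != 0.

Definition tHV : 'M[F]_n := diag_mx (\row_(a < n) t ^ (- hexp i n a)).

Lemma tHK : tH i n t *m tHV = 1%:M.
Proof.
apply/matrixP => a b; rewrite mul_diag_mx !mxE.
case: eqP => [->|_]; last by rewrite mulr0.
by rewrite mulr1n -expfzDr // subrr expr0z.
Qed.

Lemma tH_unit : tH i n t \in unitmx.
Proof. by have [] := mulmx1_unit tHK. Qed.

Lemma tH_inv : invmx (tH i n t) = tHV.
Proof.
by rewrite -[RHS]mul1mx -(mulVmx tH_unit) -mulmxA tHK mulmx1.
Qed.

Lemma sum_hexp : \sum_(a < n) hexp i n a = 0.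
Proof.
rewrite /hexp sumrB sumr_const card_ord -mulr_sumr.
by rewrite -[X in _ - X]mulr_natr natz; ring.
Qed.

Lemma det_tH : \det (tH i n t) = 1.
Proof.
rewrite det_diag; transitivity (t ^ (\sum_(a < n) hexp i n a)); last first.
  by rewrite sum_hexp expr0z.
rewrite (big_morph (fun k : int => t ^ k) (fun x y => expfzDr x y t_neq0) (expr0z t)).
by apply: eq_bigr => a _; rewrite mxE.
Qed.

(** The scalar Theta cancels under conjugation, and degree e is scaled by t^(2ne); degree one gives
    the exponent 2n of the pencil. *)
Lemma act_tH (r : T2 F n) (a b c d : 'I_n) :
  act (tH i n t) r (a, b, c, d) =
  t ^ ((2 * n)%N%:Z * (hq i a - hq i b + (hq i c - hq i d))) * r (a, b, c, d).
Proof.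
rewrite -Rop_E Rop_act ?tH_unit //.
have cE : conjmx (invmx (tH i n t)) (E F d c) =
    t ^ (hexp i n c - hexp i n d) *: E F d c.
  apply/matrixP => j k; rewrite /conjmx invmxK tH_inv mul_mx_diag mul_diag_mx !mxE.
  case: eqP => [->|_]; last by rewrite !(mulr0, mul0r).
  case: eqP => [->|_]; last by rewrite !(mulr0, mul0r).
  by rewrite !mulr1 -expfzDr // addrC.
rewrite cE RopZ mxconjZ mxE /conjmx tH_inv mul_mx_diag mxE mul_diag_mx.
rewrite mxE Rop_E !mxE mulrC -mulrA [r _ * _]mulrC !mulrA -!expfzDr //.
rewrite mulrAC -expfzDr //; congr (t ^ _ * _).
by rewrite /hexp PoszM; move: (\sum_(k < n) _) => s; ring.
Qed.

End Torus.

(** * Trace functionals, contractions and the final assembly *)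

Section TracePairing.
Variables (F : fieldType) (n : nat) (z : 'M[F]_n).

(** The sign cancels that of [contractE], which arises from contracting the first leg where [Rop]
    contracts the second. *)
Definition trpair (u : 'M[F]_n) : F^o := - \tr (u *m z).

Lemma trpair_linear : linear trpair.
Proof.
move=> k u v; rewrite /trpair mulmxDl -scalemxAl raddfD /= mxtraceZ opprD.
by rewrite -mulrN.
Qed.

HB.instance Definition _ := GRing.isLinear.Build F 'M[F]_n F^o _ trpair trpair_linear.

End TracePairing.

Lemma contractE (F : fieldType) (n : nat) (phi : {linear 'M[F]_n -> F^o})
    (r : T2 F n) : skew_tensor r ->
  contract phi r = - Rop r (\matrix_(j, k) phi (E F k j)).
Proof.
move=> sk; apply/matrixP => c d; rewrite summxE sum_I2 [RHS]mxE [X in - X]mxE -sumrN.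
apply: eq_bigr => a _; rewrite -sumrN; apply: eq_bigr => b _.
transitivity (\sum_(c1 < n) (c1 == c)%:R * \sum_(d1 < n) (d1 == d)%:R *
   (r (a, b, c1, d1) * phi (E F a b)) : F).
  apply: eq_bigr => c1 _; rewrite mulr_sumr; apply: eq_bigr => d1 _.
  rewrite !mxE ![_ == c1]eq_sym ![_ == d1]eq_sym -mulnb natrM /GRing.scale /=; ring.
by rewrite !sum_delta mxE sk mulNr.
Qed.

Lemma skew_tensorD (F : fieldType) (n : nat) (r s : T2 F n) :
  skew_tensor r -> skew_tensor s -> skew_tensor (r + s).
Proof. by move=> sr ss a b c d; rewrite !ffunE sr ss opprD. Qed.

Lemma skew_tensorZ (F : fieldType) (n : nat) (k : F) (r : T2 F n) :
  skew_tensor r -> skew_tensor (k *: r).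
Proof. by move=> sr a b c d; rewrite !ffunE sr scalerN. Qed.

Lemma act_entry (F : fieldType) (n : nat) (g : 'M[F]_n) (r : T2 F n) a b c d :
  act g r (a, b, c, d) = \sum_(x : I2 n) r x * (let: (j, k, l, m) := x in
    (g a j * invmx g k b) * (g c l * invmx g m d)).
Proof.
have cE (j k a' b' : 'I_n) : conjmx g (E F j k) a' b' = g a' j * invmx g k b'.
  rewrite /conjmx mxE.
  under eq_bigr => p _ do rewrite mulmx_E mulrAC.
  by rewrite sum_deltar.
rewrite sum_ffunE; apply: eq_bigr => -[[[j k] l] m] _.
by rewrite !ffunE !cE.
Qed.

(** Conjugation involves [g] and its inverse, and the inverse has no negative degree either, by
    [filtered_inv]. *)
Lemma act_degree (F : fieldType) (n : nat) (f : 'I_n -> int) (g : 'M[F]_n)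
    (r : T2 F n) : g \in unitmx ->
  (forall a b, f a < f b -> g a b = 0) ->
  (forall a b c d, f a - f b + (f c - f d) < 0 -> r (a, b, c, d) = 0) ->
  forall a b c d, f a - f b + (f c - f d) < 0 -> act g r (a, b, c, d) = 0.
Proof.
move=> ug fg fr a b c d deg; rewrite act_entry big1 // => -[[[j k] l] m] _.
have fgi := filtered_inv ug fg.
case: (ltP (f a) (f j)) => aj; first by rewrite fg // !mul0r mulr0.
case: (ltP (f k) (f b)) => kb; first by rewrite fgi // !(mul0r, mulr0).
case: (ltP (f c) (f l)) => cl; first by rewrite [g c l]fg // !(mul0r, mulr0).
case: (ltP (f m) (f d)) => md; first by rewrite [invmx g m d]fgi // !(mul0r, mulr0).
by rewrite fr ?mul0r //; lia.
Qed.

Theorem mainTheorem1 (F : fieldType) (i n : nat) :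
  [pchar F] =i pred0 ->
  (0 < i)%N -> (i < n)%N -> ((i %| n.-1) || (i %| n.+1))%N ->
  exists r' b : T2 F n,
    [/\ inM r' /\ inC b,
        forall t : F, t != 0 ->
          act (Phi i n t) (rCG F i n) = r' + t ^+ (2 * n) *: b,
        zclosure (Mcomp (rCG F i n)) r' /\ zclosure (Mcomp (rCG F i n)) b,
        boundary b
      & forall M : 'M[F]_n, carrier b M <-> in_parabolic i M].
Proof.
move=> char0 i_gt0 i_ltn n_pm1.
have co := coprime_in i_ltn n_pm1.
have n0 : (0 < n)%N by apply: ltn_trans i_ltn.
have n1 : (1 < n)%N by apply: leq_ltn_trans i_ltn.
have N0 : (0 < 2 * n)%N by rewrite muln_gt0.
pose f (a : 'I_n) := hq i a.
have ug := gmat_unit char0 i_gt0 i_ltn n_pm1.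
set g := gmat F i n in ug.
pose r := act g (rCG F i n).
have sk0 : skew_tensor (rCG F i n) by apply: rCG_skew.
have tr0 := rCG_trace char0 i_gt0 i_ltn co.
have sk : skew_tensor r by apply: skew_act.
have tr : forall u, \tr (Rop r u) = 0 by apply: trace_act.
have lag : lagrangian i (Smx F i n) r.
  have [K [k [uK Klow Kup KE]]] := key_identity char0 i_gt0 i_ltn n_pm1.
  apply: (lagrangian_act ug uK _ Klow Kup KE); last exact: rCG_lagrangian.
  exact: gmat_in_p.
have S_pos : forall a b, 0 < f a - f b -> Smx F i n a b = 0 by apply: Smx_pos.
have S_zero : forall a b, f a - f b = 0 -> Smx F i n a b = (a == b)%:R.
  by apply: Smx_zero.
pose J := grade f (-1) (Smx F i n).
have frob : forall x, in_p i x -> in_n i (lbr J x) -> exists k, x = k%:M.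
  by move=> x px nx; apply: (centralizer_scalar i_gt0 i_ltn n_pm1 px nx).
have mr := lagrangian_mcybe char0 n0 S_pos S_zero frob lag sk tr.
have hi := lagrangian_degree_basis char0 n0 S_pos S_zero frob lag sk tr.
have lo : forall a b c d, f a - f b + (f c - f d) < 0 -> r (a, b, c, d) = 0.
  apply: act_degree => // [a b|a b c d].
    exact: gmat_degree.
  exact: rCG_degree.
pose r' := degree_part f r 0; pose b := degree_part f r 1.
have skr' : skew_tensor r' by apply: part_skew.
have skb : skew_tensor b by apply: part_skew.
have trr' := part_trace f 0 tr; have trb := part_trace f 1 tr.
have actE (t : F) : t != 0 -> act (Phi i n t) (rCG F i n) = r' + t ^+ (2 * n) *: b.
  move=> t0; rewrite /Phi act_comp ?tH_unit // -/r.
  apply/ffunP => -[[[a c] d] e]; rewrite act_tH // !ffunE -/(f a) -/(f c) -/(f d) -/(f e).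
  case: (ltP (f a - f c + (f d - f e)) 0) => d0.
    by rewrite lo // !if_same scaler0 mulr0 addr0.
  case: (ltP 1 (f a - f c + (f d - f e))) => d1.
    by rewrite hi // !if_same scaler0 mulr0 addr0.
  have [->|->] : f a - f c + (f d - f e) = 0 \/ f a - f c + (f d - f e) = 1 by lia.
    by rewrite /= mulr0 expr0z mul1r scaler0 addr0.
  by rewrite /= mulr1 add0r -exprnP.
have dPhi (t : F) : t != 0 -> \det (Phi i n t) = 1.
  by move=> t0; rewrite det_mulmx det_tH // mul1r det_gmat //.
have k0 : - 4^-1 != 0 :> F.
  by rewrite oppr_eq0 invr_eq0 (char0_natr_neq0 char0).
have mline (t : F) : t != 0 -> mcybe (- 4^-1) (r' + t ^+ (2 * n) *: b).
  move=> t0; rewrite -(actE t t0) /Phi.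
  rewrite act_comp; [|exact: tH_unit|exact: ug].
  by apply: mcybe_act; [exact: tH_unit|exact: mr].
have [mr' mb] := mcybe_line char0 N0 mline.
have Mr' : inM r' by apply: inMP mr'.
have Cb : inC b by apply: inCP mb.
have binv := boundary_inv char0 n0 S_pos S_zero frob lag sk tr.
(* The operator of [b] takes [J, M] to M on traceless M in [p]; the matrix unit in the upper right
   corner is a nonzero such M. *)
have b_neq0 : b != 0.
  apply/eqP => b0; pose a0 : 'I_n := Ordinal n0.
  have nn : (n.-1 < n)%N by rewrite prednK.
  pose a1 : 'I_n := Ordinal nn.
  have a01 : (a1 == a0) = false by apply/eqP => /(congr1 val) /=; lia.
  have := binv (E F a0 a1) _ _; rewrite -/b b0.
  have -> : Rop (0 : T2 F n) (lbr J (E F a0 a1)) = 0.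
    by have := RopZl 0 (0 : T2 F n) (lbr J (E F a0 a1)); rewrite !scale0r.
  move=> /(_ _ _)/matrixP/(_ a0 a1); rewrite !mxE !eqxx /= => h.
  have : (0 : F) = 1.
    apply: h.
      move=> j k ij ki; rewrite mxE; case: eqP => //= ja; move: ij.
      by rewrite ja /= leqNgt i_gt0.
    rewrite -[E F a0 a1]mulmx1 trace_mulE mxE a01 //.
  by move/eqP; rewrite eq_sym oner_eq0.
(* A zero tensor would also satisfy the classical equation, against [inM r']. *)
have r'_neq0 : r' != 0.
  apply/eqP => r0; case: Mr' => _ /eqP h _; apply: h.
  have m0 : mcybe 0 r'.
    by have := mcybeZ 0 mr'; rewrite r0 scaler0 expr0n mul0r.
  by have [_ ->] : inC r' by apply: inCP m0.
have Mcomp1 (t : F) : t != 0 -> Mcomp (rCG F i n) (r' + t ^+ (2 * n) *: b).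
  move=> t0; exists 1, (Phi i n t); split; first exact: oner_neq0.
    exact: dPhi.
  by rewrite scale1r actE.
(* Replacing t by its inverse and rescaling by t^(2n) reverses the pencil, so that [b] becomes its
   limit at t = 0. *)
have swap (t : F) : t != 0 -> b + t ^+ (2 * n) *: r' =
    t ^+ (2 * n) *: (r' + t^-1 ^+ (2 * n) *: b).
  by move=> t0; rewrite scalerDr scalerA exprVn mulfV ?expf_neq0 // scale1r addrC.
have tV (t : F) : t != 0 -> t^-1 != 0 :> F by rewrite invr_eq0.
have Mcomp2 (t : F) : t != 0 -> Mcomp (rCG F i n) (b + t ^+ (2 * n) *: r').
  move=> t0; exists (t ^+ (2 * n)), (Phi i n t^-1).
  by split; [exact: expf_neq0 | exact/dPhi/tV | rewrite swap // actE ?tV].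
exists r', b; split => //.
- split; first exact: zclosure_line N0 r'_neq0 Mcomp1.
  exact: zclosure_line N0 b_neq0 Mcomp2.
- split; first exact: Cb.
  apply: (zclosure_line (v := r') char0 N0 b_neq0) => t t0.
  rewrite (swap t t0).
  have mt := mcybeZ (t ^+ (2 * n)) (mline _ (tV _ t0)).
  apply: (inMP _ _ _ _ _ mt) => //.
  + by rewrite mulf_neq0 ?expf_neq0.
  + by apply: skew_tensorZ; apply: skew_tensorD => //; apply: skew_tensorZ.
  + by move=> u; rewrite RopZl RopDl RopZl mxtraceZ raddfD /= mxtraceZ trr' trb mulr0 addr0 mulr0.
(* Contractions of [b] are values of its operator, hence lie in [p] by [boundary_eqn]; conversely
   [M] is the value at [J, M], the contraction by the functional u |-> -tr (u [J, M]). *)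
- move=> M; split.
    case=> s ->; elim: s => [|[k phi] s [IHt IHp]].
      rewrite big_nil; split; first by rewrite /traceless mxtrace0.
      by move=> j l _ _; rewrite mxE.
    have [pB _] := boundary_eqn char0 n0 S_pos S_zero frob lag sk tr
      (\matrix_(j, l) phi (E F l j)).
    rewrite big_cons contractE //; split.
      by rewrite /traceless raddfD /= mxtraceZ raddfN /= trb oppr0 mulr0 add0r.
    move=> j l ij li; rewrite mxE IHp // addr0 mxE [X in _ * X]mxE pB //.
    by rewrite oppr0 mulr0.
  case=> /eqP tM pM; exists [:: (1, trpair (lbr J M) : {linear 'M[F]_n -> F^o})].
  have pM' : in_p i M by move=> j l ij li; apply: pM.
  rewrite big_seq1 scale1r contractE //=.
  apply: etrans (esym (binv M pM' tM)) _.
  rewrite -RopN; congr (Rop _ _); apply/matrixP => j l.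
  by rewrite [RHS]mxE [X in _ = - X]mxE /trpair trace_mulE opprK.
Qed.
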